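(* Let $1<p<2$. There exists a positive constant $C(p)$ such that for any subspace $X_n$ of $\mathcal{C}(\Omega)$ of dimension at most $n$ satisfying the Nikol'skii inequality $$\|f\|_\infty\le \sqrt{Kn}\,\|f\|_{L_2(\Omega,\mu)}\qquad\text{for all } f\in X_n$$ for some probability measure $\mu$ (where $K\ge1$), and for any $\varepsilon\in(0,1)$, there is a finite set of points $\{\xi^1,\dots,\xi^m\}\subset\Omega$ with $$m\le C(p)\,\varepsilon^{-2}Kn\bigl(\log(Kn)+\log(1/\varepsilon)\bigr)\bigl(\log(1/\varepsilon)+\log\log(Kn)\bigr)^2,$$ which provides the following discretization inequalities for any $f\in X_n$: $$(1-\varepsilon)\|f\|_{L_p(\Omega,\mu)}^p\le \frac1m\sum_{j=1}^m|f(\xi^j)|^p\le (1+\varepsilon)\|f\|_{L_p(\Omega,\mu)}^p$$ and $$(1-\varepsilon)\|f\|_{L_2(\Omega,\mu)}^2\le \frac1m\sum_{j=1}^m|f(\xi^j)|^2\le (1+\varepsilon)\|f\|_{L_2(\Omega,\mu)}^2 .$$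
   Context: $\Omega$ is a compact subset of $\mathbb{R}^d$ and $\mu$ is a probability measure on $\Omega$. $\mathcal{C}(\Omega)$ is the space of continuous functions on $\Omega$, $\|f\|_\infty=\max_{x\in\Omega}|f(x)|$, and $\|f\|_{L_p(\Omega,\mu)}=(\int_\Omega|f|^p\,d\mu)^{1/p}$ for $1\le p<\infty$. The constant $C(p)$ depends only on $p$.
   Formalization: For Kn<3 the bound on m is read with log 3 in place of log(Kn), since log log(Kn) is undefined at Kn=1 and the stated bound can vanish or tend to 0 for Kn<=e although m>=1; the points ξ^1,…,ξ^m may repeat. *)

(* Defs.v *)
From HB Require Import structures.
From mathcomp Require Import all_boot all_order all_algebra.
From mathcomp Require Import all_classical all_reals all_analysis.

Set Implicit Arguments.
Unset Strict Implicit.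
Unset Printing Implicit Defensive.

Import Order.TTheory GRing.Theory Num.Theory.
Import numFieldNormedType.Exports.

Local Open Scope classical_set_scope.
Local Open Scope ring_scope.

Notation borel_rV R d := (g_sigma_algebraType (@open 'rV[R]_d)).

(* C(Omega): a continuous function on Omega is represented by its extension by
   zero to R^d, so that functions which agree on Omega are equal and linear
   algebra in 'rV[R]_d -> R is linear algebra in C(Omega). *)
Definition contOn (R : realType) (d : nat) (Omega : set 'rV[R]_d) :
    set ('rV[R]_d -> R) :=
  [set f | {within Omega, continuous f} /\ forall x, ~ Omega x -> f x = 0].

Definition subspace_of (R : realType) (V : lmodType R) (E X : set V) : Prop :=
  [/\ X `<=` E, X 0 & forall (a : R) (f g : V), X f -> X g -> X (a *: f + g)].

Definition is_basis (R : realType) (V : lmodType R) (X : set V) (k : nat)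
    (b : 'I_k -> V) : Prop :=
  [/\ forall i, X (b i),
      forall c : 'I_k -> R, \sum_(i < k) c i *: b i = 0 -> forall i, c i = 0
    & forall f, X f -> exists c : 'I_k -> R, f = \sum_(i < k) c i *: b i].

Definition dim_le (R : realType) (V : lmodType R) (X : set V) (n : nat) : Prop :=
  exists (k : nat) (b : 'I_k -> V), (k <= n)%N /\ is_basis X b.

(* For f in C(Omega) with Omega compact and nonempty this supremum is a max. *)
Definition supnorm (R : realType) (d : nat) (Omega : set 'rV[R]_d)
    (f : 'rV[R]_d -> R) : R :=
  sup [set `|f x| | x in Omega].

(* mu is meant to be carried by Omega and f to vanish outside Omega, so that
   the integral over R^d below is the integral over Omega. *)
Definition Lpnorm (R : realType) (d : nat) (mu : probability (borel_rV R d) R)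
    (q : R) (f : 'rV[R]_d -> R) : \bar R :=
  'N[mu]_(q%:E)[EFin \o f]%E.

Definition nikolskii (R : realType) (d : nat) (Omega : set 'rV[R]_d)
    (mu : probability (borel_rV R d) R) (X : set ('rV[R]_d -> R)) (n : nat)
    (K : R) : Prop :=
  forall f, X f ->
    ((supnorm Omega f)%:E <= (Num.sqrt (K * n%:R))%:E * Lpnorm mu 2 f)%E.

Definition discretizes (R : realType) (d : nat)
    (mu : probability (borel_rV R d) R) (X : set ('rV[R]_d -> R)) (q eps : R)
    (m : nat) (xi : 'I_m -> 'rV[R]_d) : Prop :=
  forall f, X f ->
    let S := m%:R^-1 * \sum_(j < m) `|f (xi j)| `^ q in
    ((1 - eps)%:E * (Lpnorm mu q f) `^ q <= S%:E)%E /\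
    (S%:E <= (1 + eps)%:E * (Lpnorm mu q f) `^ q)%E.

(* log t, read as log 3 when t < 3: with t = K n the iterated logarithm
   log (log t) is negative or undefined for t < e, and a bound on m such as
   (log (1/eps) + log (log t))^2 can then be 0 (or tend to 0 as eps -> 1). *)
Definition logge3 (R : realType) (t : R) : R := ln (Num.max t 3).

Definition points_bound (R : realType) (C K : R) (n : nat) (eps : R) : R :=
  C * eps ^- 2 * (K * n%:R) * (logge3 (K * n%:R) + ln (eps^-1))
    * (ln (eps^-1) + ln (logge3 (K * n%:R))) ^+ 2.

(* Main.v *)
Require Import Defs.
From HB Require Import structures.
From mathcomp Require Import all_boot all_order all_algebra.
From mathcomp Require Import all_classical all_reals all_analysis.
From mathcomp Require Import measurable_realfun ring lra zify.

Import Order.TTheory GRing.Theory Num.Theory.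
Import numFieldNormedType.Exports.

Local Open Scope classical_set_scope.
Local Open Scope ring_scope.

(* Put D = K n.  The measure is replaced by the uniform measure on N = m 2^J
   points, one or several for each cell of a fine grid in the range of an
   orthonormal basis.  Then the points are halved J times: they are paired, and
   one point of each pair is kept according to signs for which the signed sums
   of |f|^p and f^2 are small for all f in X at once.  The relative error of a
   halving is of order sqrt (D log N / N), so that the errors add up to eps as
   soon as m is of order eps^-2 D log (D / eps); the squared factor of the bound
   enters only through its lower bound (ln (ln 3))^2.
   For f^2 good signs come from the moment method for random matrices.
   For |f|^p they come from a chaining argument over dyadic scales t.  A function
   within t of f in the sup norm is replaced by an almost minimizer of the L_p
   energy on a sup-norm ball of radius 2 t.  By strong convexity of |x|^p on
   [-t, t], the L_2 distance h between consecutive minimizers satisfies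
   h^2 <= C t^(2-p) (increment of the energy + t^p mu (|f| > t)), and the
   parenthesis sums over t to a constant.  The entropy of the L_2 ball in the sup
   norm is D h^2 log N / t^2, and the variance of the increment of the chain is
   controlled by t^p mu (|f| > t) up to geometric tails: the Cauchy-Schwarz
   inequality over the scales then loses no logarithm. *)

Set Implicit Arguments.
Unset Strict Implicit.
Unset Printing Implicit Defensive.

(** * Convexity of powers *)

(** With finitely many points, the signs, the codes of the chain and all averages in a halving are
    finite sums. The price is a factor log N, N the current number of points, in each squared error.
    As N falls geometrically, the errors still sum to a constant times [halving_error D m], so the
    initial grid may be as fine as desired. The entropy bound needs the L_2 norm on the current
    points to stay comparable with that of the measure. Hence f^2 and |f|^p are halved with the same
    signs, and the total relative error is kept below 1/2. Common signs exist because each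
    requirement has a certificate G >= 0 of mean at most 1, and the sum of three such cannot exceed
    4 for all signs. In the chaining, the union bound runs over codes, so the starting point of
    every correction has to be computable from the code alone, while its target may depend on f. The
    start is therefore an almost minimizer over a ball around the previous approximation, the target
    one over a small ball around f. Nearly minimal energy makes the two close in L_2, and the costs
    of all scales are paid by one telescoping energy. *)

Lemma sq_le_powR (R : realType) (p w M : R) : p <= 2 -> 0 <= w <= M ->
  w ^+ 2 <= M `^ (2 - p) * w `^ p.
Proof.
move=> p2 /andP[w0 wM].
have [->|wn0] := eqVneq w 0; first by rewrite expr0n/= mulr_ge0// powR_ge0.
have -> : w ^+ 2 = w `^ (2 - p) * w `^ p.
  by rewrite -powRD ?wn0 ?implybT// subrK powR_mulrn.
by rewrite ler_wpM2r ?powR_ge0// ge0_ler_powR// ?nnegrE ?subr_ge0//; exact: le_trans wM.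
Qed.

Lemma powR_sub1 (R : realType) (p x : R) : 0 < p -> 0 <= x ->
  x `^ p = x * x `^ (p - 1).
Proof. by move=> p0 x0; rewrite mulr_powRB1. Qed.

(** No derivative is used: for r = b / a <= 1, r <= r^(p-1) gives b^p >= a^(p-1) b^2 / a, and a -
    b^2 / a = (a - b)(a + b) / a is at most 2 (a - b). *)
Lemma powR_lip_ord (R : realType) (p a b : R) : 1 < p <= 2 -> 0 <= b <= a ->
  0 <= a `^ p - b `^ p <= 2 * a `^ (p - 1) * (a - b).
Proof.
move=> /andP[p1 p2] /andP[b0 ba].
have p0 : 0 < p by lra.
have a0 : 0 <= a by lra.
apply/andP; split.
  by rewrite subr_ge0 ge0_ler_powR ?nnegrE//; lra.
rewrite !(powR_sub1 p0)//.
have [->|bn0] := eqVneq b 0.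
  by rewrite mul0r !subr0 mulrAC; have := mulr_ge0 a0 (powR_ge0 a (p-1)); lra.
have b1 : 0 < b by rewrite lt_neqAle eq_sym bn0.
have a1 : 0 < a by lra.
have ar : 0 <= b / a by rewrite divr_ge0.
have br : b / a <= 1 by rewrite ler_pdivrMr// mul1r.
have h : b / a <= (b / a) `^ (p - 1).
  by apply: ger1_powR; rewrite ?divr_gt0 ?br//; lra.
have e : b `^ (p - 1) = a `^ (p - 1) * (b / a) `^ (p - 1).
  by rewrite -powRM// mulrCA divff ?mulr1// gt_eqF.
set A := a `^ (p - 1) in e *.
have A0 : 0 <= A by exact: powR_ge0.
have h2 : A * (b / a) <= b `^ (p - 1) by rewrite e ler_wpM2l.
have h3 : A * b <= a * b `^ (p - 1).
  by move: h2; rewrite mulrA ler_pdivrMr// [X in _ -> _ <= X]mulrC.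
have h4 : b * (A * (b / a)) <= b * b `^ (p - 1) by rewrite ler_wpM2l.
have h5 : A * b - b * (A * (b / a)) <= A * (a - b).
  rewrite [X in X <= _](_ : _ = A * (a - b) * (b / a)); last by field; rewrite gt_eqF.
  by rewrite ler_piMr// mulr_ge0//; lra.
nra.
Qed.

Lemma powR_lip (R : realType) (p a b M : R) : 1 < p <= 2 ->
  0 <= a <= M -> 0 <= b <= M ->
  `|a `^ p - b `^ p| <= 2 * M `^ (p - 1) * `|a - b|.
Proof.
move=> hp; wlog ba : a b / b <= a => [hw|].
  case: (leP b a) => [|/ltW] ba ha hb; first exact: hw.
  by rewrite distrC [X in _ * X]distrC; exact: hw.
move=> /andP[a0 aM] /andP[b0 bM].
have hb : 0 <= b <= a by rewrite b0.
have /andP[h1 h2] := powR_lip_ord hp hb.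
rewrite (ger0_norm h1) (ger0_norm (_ : 0 <= a - b)) ?subr_ge0//.
apply: (le_trans h2).
rewrite ler_wpM2r ?subr_ge0// ler_wpM2l//.
by case/andP: hp => *; rewrite ge0_ler_powR ?nnegrE//; lra.
Qed.

(** With u = sqrt r, the bounds r^s >= 1 + s ln r and ln r >= 2 (1 - 1/u) turn the right side into
    at least s (1 - u)^2, and (1 - r)^2 <= 4 (1 - u)^2. *)
Lemma powR_tangent_le1 (R : realType) (s r : R) : 0 < s < 1 -> 0 <= r <= 1 ->
  s / 16 * (1 - r) ^+ 2 <= r `^ (1 + s) - 1 - (1 + s) * (r - 1).
Proof.
move=> /andP[s0 s1] /andP[r0 r1].
have [->|rn0] := eqVneq r 0; first by rewrite powR0 ?gt_eqF//; lra.
have rp : 0 < r by rewrite lt_neqAle eq_sym rn0.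
set u := Num.sqrt r.
have u2 : u ^+ 2 = r by rewrite sqr_sqrtr.
have up : 0 < u by rewrite sqrtr_gt0.
have u1 : u <= 1 by rewrite -sqrtr1 ler_wsqrtr.
have lnu : ln u^-1 <= u^-1 - 1.
  have := @le_ln1Dx _ (u^-1 - 1); rewrite (addrC 1) subrK; apply.
  by rewrite -subr_gt0 opprK subrK invr_gt0.
have lnr : - ln r <= 2 * (u^-1 - 1).
  by move: lnu; rewrite lnV// -u2 lnXn// -[_ *+ 2]mulr_natl; lra.
have e1 : 1 + s * ln r <= r `^ s.
  by rewrite /powR gt_eqF// expR_ge1Dx.
have e2 : r * (1 + s * ln r) <= r `^ (1 + s).
  rewrite powR_sub1//; last lra.
  by rewrite addrAC subrr add0r ler_wpM2l// ltW.
have e3 : r * (s * (2 * (1 - u^-1))) <= r * (s * ln r).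
  by rewrite ler_pM2l// ler_pM2l//; lra.
have e4 : r * u^-1 = u by rewrite -u2 expr2 mulfK// gt_eqF.
have e5 : (1 - r) ^+ 2 <= 4 * (1 - u) ^+ 2.
  rewrite -u2 [X in X <= _](_ : _ = (1 + u) ^+ 2 * (1 - u) ^+ 2); last by ring.
  by rewrite ler_wpM2r ?sqr_ge0//; nra.
have e6 : r * (s * (2 * (1 - u^-1))) = 2 * s * r - 2 * s * u.
  by rewrite -[in RHS]e4; ring.
have e7 : s / 16 * (1 - r) ^+ 2 <= s * (1 - u) ^+ 2.
  apply: (@le_trans _ _ (s / 16 * (4 * (1 - u) ^+ 2))).
    by rewrite ler_wpM2l//; lra.
  by have := mulr_ge0 (ltW s0) (sqr_ge0 (1-u)); lra.
apply: (le_trans e7); have -> : s * (1 - u) ^+ 2 = s - 2 * s * u + s * r.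
  by rewrite -u2; ring.
lra.
Qed.

(** With d = 1 - q, the bound -ln q >= 2 (1 - sqrt q) >= d + d^2/4 gives Q (1 + s (d + d^2/4)) <= 1
    for Q = q^s, so the right side is at least Q s d^2/4. This suffices if Q > 1/4, whence the 16;
    if Q <= 1/4 the right side is at least 1/2. *)
Lemma powR_tangent_ge1 (R : realType) (s q : R) : 0 < s < 1 -> 0 <= q <= 1 ->
  s / 16 * (1 - q) ^+ 2 <= 1 - q `^ (1 + s) - (1 + s) * q `^ s * (1 - q).
Proof.
move=> /andP[s0 s1] /andP[q0 q1].
have [->|qn0] := eqVneq q 0; first by rewrite !powR0 ?gt_eqF//; lra.
have qp : 0 < q by rewrite lt_neqAle eq_sym qn0.
rewrite powR_sub1//; last lra.
have -> : 1 + s - 1 = s by ring.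
set d := 1 - q; have d0 : 0 <= d by rewrite /d; lra.
have d1 : d <= 1 by rewrite /d; lra.
set u := Num.sqrt q.
have u2 : u ^+ 2 = q by rewrite sqr_sqrtr.
have up : 0 < u by rewrite sqrtr_gt0.
have u1 : u <= 1 by rewrite -sqrtr1 ler_wsqrtr.
have lnu : ln u <= u - 1.
  have := @le_ln1Dx _ (u - 1); rewrite (addrC 1) subrK; apply.
  by rewrite -subr_gt0 opprK subrK.
have lnq : d + d ^+ 2 / 4 <= - ln q.
  have : 2 * (1 - u) <= - ln q by rewrite -u2 lnXn// -[_ *+ 2]mulr_natl; lra.
  apply: le_trans.
  have : d ^+ 2 <= 4 * (1 - u) ^+ 2.
    rewrite /d -u2 [X in X <= _](_ : _ = (1 + u) ^+ 2 * (1 - u) ^+ 2); last by ring.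
    by rewrite ler_wpM2r ?sqr_ge0//; nra.
  have -> : d = 1 - u ^+ 2 by rewrite u2.
  nra.
have h1 : 1 + s * (d + d ^+ 2 / 4) <= q `^ (- s).
  rewrite /powR gt_eqF//; apply: le_trans (expR_ge1Dx _).
  by rewrite lerD2l mulNr -mulrN ler_pM2l.
set Q := q `^ s; have Q0 : 0 < Q by exact: powR_gt0.
have h2 : Q * (1 + s * (d + d ^+ 2 / 4)) <= 1.
  move: h1; rewrite powRN -/Q => h1.
  by have := ler_wpM2l (ltW Q0) h1; rewrite divff// gt_eqF.
have -> : 1 - q * Q - (1 + s) * Q * d = 1 - Q * (1 + s * d) by rewrite /d; ring.
have Q1 : 1 <= q `^ (-s) by apply: le_trans h1; nra.
have h3 : s / 16 * d ^+ 2 <= Q * (s * (d ^+ 2 / 4)) \/ Q <= 4^-1.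
  case: (leP Q 4^-1) => [|hQ]; [by right|left].
  have := mulr_ge0 (ltW s0) (sqr_ge0 d); set X := s * d ^+ 2 => X0.
  have -> : s / 16 * d ^+ 2 = X / 16 by rewrite /X; ring.
  have -> : Q * (s * (d ^+ 2 / 4)) = Q * X / 4 by rewrite /X; ring.
  nra.
case: h3 => h3; first by nra.
have : d ^+ 2 <= 1 by nra.
have : Q * (1 + s * d) <= 4^-1 * 2 by apply: ler_pM => //; nra.
nra.
Qed.

(** For y >= 0, dividing by the larger of x and y reduces to the two preceding lemmas, and
    [sq_le_powR] exchanges its square for its p-th power at the cost of M^(2-p). For y < 0 the terms
    have favourable signs. *)
Lemma powR_tangent (R : realType) (p x y M : R) : 1 < p < 2 ->
  0 < x <= M -> `|y| <= M ->
  (p - 1) / 16 * (y - x) ^+ 2 <=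
    M `^ (2 - p) * (`|y| `^ p - x `^ p - p * x `^ (p - 1) * (y - x)).
Proof.
move=> /andP[p1 p2] /andP[x0 xM] yM.
have M0 : 0 < M by lra.
have p0 : 0 < p by lra.
have p21 : p <= 2 by lra.
have hs : 0 < p - 1 < 1 by lra.
have key z G : 0 < z <= M -> 0 <= G ->
    z ^+ 2 * G <= M `^ (2 - p) * (z `^ p * G).
  move=> /andP[z0 zM] G0; rewrite mulrA ler_wpM2r//.
  by apply: sq_le_powR => //; rewrite ltW.
case: (leP 0 y) => y0; last first.
  set w := - y; have w0 : 0 < w by rewrite /w; lra.
  have yw : y = - w by rewrite /w opprK.
  rewrite yw normrN (gtr0_norm w0).
  have wM : w <= M by rewrite -(gtr0_norm w0) -normrN -yw.
  have hx : x ^+ 2 <= M `^ (2 - p) * x `^ p by apply: sq_le_powR => //; rewrite ltW.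
  have hw : w ^+ 2 <= M `^ (2 - p) * w `^ p by apply: sq_le_powR => //; rewrite ltW.
  have hd : x `^ p = x * x `^ (p - 1) by rewrite powR_sub1// ltW.
  have A0 : 0 <= M `^ (2 - p) by exact: powR_ge0.
  have B0 : 0 <= x `^ (p - 1) by exact: powR_ge0.
  have C0 : 0 <= w `^ p by exact: powR_ge0.
  have E0 : 0 <= x `^ p by exact: powR_ge0.
  have h1 : (p - 1) * (w `^ p + x `^ p) <=
      w `^ p - x `^ p - p * x `^ (p - 1) * (- w - x).
    have -> : p * x `^ (p - 1) * (- w - x) =
      - (p * (x `^ (p - 1) * w)) - p * x `^ p by rewrite hd; ring.
    have : 0 <= p * (x `^ (p-1) * w) by rewrite !mulr_ge0// ltW.
    have : 0 <= (2 - p) * w `^ p by rewrite mulr_ge0//; lra.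
    lra.
  have h2 := ler_wpM2l A0 h1.
  apply: le_trans h2.
  have h3 : (p - 1) * (w ^+ 2 + x ^+ 2) <=
      (p - 1) * (M `^ (2 - p) * w `^ p + M `^ (2 - p) * x `^ p).
    by rewrite ler_wpM2l; lra.
  have h4 : M `^ (2 - p) * ((p - 1) * (w `^ p + x `^ p)) =
    (p - 1) * (M `^ (2 - p) * w `^ p + M `^ (2 - p) * x `^ p) by ring.
  rewrite h4; apply: le_trans h3.
  have -> : (- w - x) ^+ 2 = (w + x) ^+ 2 by ring.
  have : 0 <= (p - 1) * (w - x) ^+ 2 by rewrite mulr_ge0 ?sqr_ge0//; lra.
  have : 0 <= (p - 1) * (w + x) ^+ 2 by rewrite mulr_ge0 ?sqr_ge0//; lra.
  have -> : (p - 1) * (w ^+ 2 + x ^+ 2) =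
    ((p - 1) * (w - x) ^+ 2 + (p - 1) * (w + x) ^+ 2) / 2 by field.
  lra.
rewrite (ger0_norm y0) in yM *.
case: (leP y x) => yx.
  have hr : 0 <= y / x <= 1.
    apply/andP; split; first by rewrite divr_ge0// ltW.
    by rewrite ler_pdivrMr// mul1r.
  have := powR_tangent_le1 hs hr.
  have -> : 1 + (p - 1) = p by ring.
  set G := _ - 1 - _ => hG.
  have G0 : 0 <= G by apply: le_trans hG; rewrite mulr_ge0 ?sqr_ge0//; lra.
  have xi : x != 0 by rewrite gt_eqF.
  have -> : y `^ p - x `^ p - p * x `^ (p - 1) * (y - x) = x `^ p * G.
    have -> : y `^ p = x `^ p * (y / x) `^ p.
      rewrite -powRM//; [by rewrite mulrCA divff ?mulr1|by rewrite ltW|by case/andP: hr].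
    by rewrite /G [x `^ p]powR_sub1 ?(ltW x0)//; field.
  have hxM : 0 < x <= M by rewrite x0.
  apply: le_trans (key _ _ hxM G0).
  have -> : (p - 1) / 16 * (y - x) ^+ 2 =
    x ^+ 2 * ((p - 1) / 16 * (1 - y / x) ^+ 2) by field.
  by rewrite ler_pM2l// exprn_gt0.
have yp : 0 < y by lra.
have hr : 0 <= x / y <= 1.
  apply/andP; split; first by rewrite divr_ge0// ltW.
  by rewrite ler_pdivrMr// mul1r ltW.
have := powR_tangent_ge1 hs hr.
have -> : 1 + (p - 1) = p by ring.
set G := _ - _ - _ => hG.
have G0 : 0 <= G by apply: le_trans hG; rewrite mulr_ge0 ?sqr_ge0//; lra.
have yi : y != 0 by rewrite gt_eqF.
have -> : y `^ p - x `^ p - p * x `^ (p - 1) * (y - x) = y `^ p * G.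
  have e1 r : x `^ r = y `^ r * (x / y) `^ r.
    rewrite -powRM//; [by rewrite mulrCA divff ?mulr1|by case/andP: hr].
  rewrite /G (e1 p) (e1 (p-1)) [y `^ p]powR_sub1//; field.
  done.
have hyM : 0 < y <= M by rewrite yp.
apply: le_trans (key _ _ hyM G0).
have -> : (p - 1) / 16 * (y - x) ^+ 2 =
  y ^+ 2 * ((p - 1) / 16 * (1 - x / y) ^+ 2) by field.
by rewrite ler_pM2l// exprn_gt0.
Qed.

(** The tangent at the midpoint is used at both ends, so that the linear terms cancel. A midpoint 0,
    where [powR_tangent] does not apply, is treated directly. *)
Lemma powR_strong_convex (R : realType) (p a b M : R) : 1 < p < 2 -> 0 < M ->
  `|a| <= M -> `|b| <= M ->
  (p - 1) / 32 * (a - b) ^+ 2 <=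
    M `^ (2 - p) * (`|a| `^ p + `|b| `^ p - 2 * `|(a + b) / 2| `^ p).
Proof.
move=> hp M0 aM bM.
have main a' b' : `|a'| <= M -> `|b'| <= M -> 0 < a' + b' ->
  (p - 1) / 32 * (a' - b') ^+ 2 <=
    M `^ (2 - p) * (`|a'| `^ p + `|b'| `^ p - 2 * `|(a' + b') / 2| `^ p).
  move=> ha hb hab; have m0 : 0 < (a' + b') / 2 by lra.
  rewrite (gtr0_norm m0); set m := _ / 2 in m0 *.
  have hm : 0 < m <= M.
    rewrite m0/= /m; have := ler_norm a'; have := ler_norm b'; lra.
  have h1 := powR_tangent hp hm ha.
  have h2 := powR_tangent hp hm hb.
  have h3 := lerD h1 h2.
  have e1 : (p - 1) / 16 * (a' - m) ^+ 2 + (p - 1) / 16 * (b' - m) ^+ 2 =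
    (p - 1) / 32 * (a' - b') ^+ 2 by rewrite /m; field.
  rewrite e1 -mulrDr in h3; apply: (le_trans h3).
  rewrite le_eqVlt; apply/orP; left; apply/eqP; congr (_ * _).
  by rewrite /m; field.
case: (ltgtP 0 (a + b)) => hab.
- exact: main.
- have := main (- a) (- b); rewrite !normrN => /(_ aM bM).
  have -> : (- a + - b) / 2 = - ((a + b) / 2) by field.
  have -> : (- a - - b) ^+ 2 = (a - b) ^+ 2 by ring.
  by rewrite normrN; apply; lra.
- have hb : b = - a by lra.
  rewrite hb subrr mul0r normr0 powR0 ?mulr0 ?subr0; last first.
    by case/andP: hp => *; rewrite gt_eqF//; lra.
  rewrite normrN opprK.
  have := @sq_le_powR _ p `|a| M; rewrite real_normK ?num_real// normr_ge0 aM.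
  case/andP: hp => p1 p2 /(_ (ltW p2) isT).
  have := sqr_ge0 a.
  have -> : (a + a) ^+ 2 = 4 * a ^+ 2 by ring.
  rewrite mulrDr; nra.
Qed.

(** * Random signs: exponential moments *)

(** For 0 <= x <= 1/2, exp(x) <= 1/(1 - x) and exp(-x) <= 1/(1 + x) suffice; beyond 1/2, x <= 2
    x^2. *)
Lemma expR_cosh_le (R : realType) (x : R) :
  expR x + expR (- x) <= 2 * expR (2 * x ^+ 2).
Proof.
wlog x0 : x / 0 <= x => [hw|].
  case: (leP 0 x) => [|/ltW] hx; first exact: hw.
  by rewrite addrC -[X in _ + expR X]opprK -sqrrN; apply: hw; rewrite oppr_ge0.
have hN : expR (- x) <= (1 + x)^-1.
  by rewrite expRN lef_pV2 ?posrE ?expR_gt0 ?expR_ge1Dx//; lra.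
have h2 : 1 + 2 * x ^+ 2 <= expR (2 * x ^+ 2) by exact: expR_ge1Dx.
case: (leP x 2^-1) => hx.
  have hP : expR x <= (1 - x)^-1.
    rewrite -[x in expR x]opprK expRN lef_pV2 ?posrE ?expR_gt0 ?expR_ge1Dx//.
    lra.
  have e : (1 - x)^-1 + (1 + x)^-1 = 2 * (1 + x ^+ 2 / (1 - x ^+ 2)).
    by field; rewrite !gt_eqF//; nra.
  have : x ^+ 2 / (1 - x ^+ 2) <= 2 * x ^+ 2.
    have : x ^+ 2 <= 4^-1 by nra.
    have := sqr_ge0 x; set y := x ^+ 2 => y0 y1.
    rewrite ler_pdivrMr; last by lra.
    nra.
  lra.
have : expR x <= expR (2 * x ^+ 2) by rewrite ler_expR; nra.
have : expR (- x) <= expR (2 * x ^+ 2) by rewrite ler_expR; nra.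
lra.
Qed.

Lemma sum_signs_prod (R : comPzRingType) (T : finType) (F : T -> bool -> R) :
  \sum_(s : {ffun T -> bool}) \prod_i F i (s i) = \prod_i (F i true + F i false).
Proof.
rewrite -bigA_distr_bigA; apply: eq_bigr => i _.
by rewrite big_bool.
Qed.

Lemma sum_expR_signs (R : realType) (T : finType) (x : T -> R) (l : R) :
  \sum_(s : {ffun T -> bool}) expR (l * \sum_i (-1) ^+ s i * x i) <=
  2 ^+ #|T| * expR (2 * l ^+ 2 * \sum_i x i ^+ 2).
Proof.
rewrite (eq_bigr (fun s : {ffun T -> bool} =>
  \prod_i expR (l * ((-1) ^+ s i * x i)))); last first.
  by move=> s _; rewrite mulr_sumr expR_sum.
rewrite (sum_signs_prod (fun i b => expR (l * ((-1) ^+ b * x i)))).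
apply: (@le_trans _ _ (\prod_(i : T) (2 * expR (2 * l ^+ 2 * x i ^+ 2)))).
  apply: ler_prod => i _; rewrite addr_ge0 ?expR_ge0//=.
  rewrite expr1 expr0 mul1r mulN1r mulrN addrC.
  by apply: le_trans (expR_cosh_le _) _; rewrite exprMn mulrA.
by rewrite big_split/= prodr_const -expR_sum -mulr_sumr.
Qed.

(* Exponential moments in place of tail bounds: a small value of [G] certifies
   all deviations at once, and such certificates can be added. *)
Lemma sign_union (R : realType) (W T : finType) (x : W -> T -> R) (u : W -> R) :
  (forall w, 1 <= u w) -> \sum_w expR (- u w) <= 1 ->
  exists G : {ffun T -> bool} -> R,
    [/\ forall s, 0 <= G s, \sum_s G s <= 2 ^+ #|T|
      & forall s, G s <= 4 -> forall w,
          (\sum_i (-1) ^+ s i * x w i) ^+ 2 <= 36 * u w * \sum_i x w i ^+ 2].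
Proof.
move=> u1 usum.
pose Q w := \sum_i x w i ^+ 2.
(* The Chernoff parameter for a deviation of order sqrt (u Q): the exponential moment exp(2 l^2 Q)
   is then at most exp(2 u). If Q = 0, division by zero gives l = 0. *)
pose l w := Num.sqrt (u w / Q w).
pose S (s : {ffun T -> bool}) w := \sum_i (-1) ^+ s i * x w i.
(* The weight exp(-3 u) absorbs the moment exp(2 u) and leaves the summable exp(-u). *)
pose g s w := expR (- (3 * u w)) * ((expR (l w * S s w) + expR (- l w * S s w)) / 2).
have Q0 w : 0 <= Q w by apply: sumr_ge0 => i _; exact: sqr_ge0.
have g0 s w : 0 <= g s w by rewrite mulr_ge0 ?expR_ge0// divr_ge0// addr_ge0 ?expR_ge0.
have lQ w : l w ^+ 2 * Q w <= u w.
  rewrite sqr_sqrtr ?divr_ge0//; last by have := u1 w; lra.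
  have [->|q0] := eqVneq (Q w) 0; first by rewrite mulr0; have := u1 w; lra.
  by rewrite divfK.
exists (fun s => \sum_w g s w); split.
- by move=> s; apply: sumr_ge0.
- rewrite exchange_big/=.
  apply: (@le_trans _ _ (\sum_w 2 ^+ #|T| * expR (- u w))); last first.
    by rewrite -mulr_sumr ler_piMr// exprn_ge0.
  apply: ler_sum => w _.
  rewrite /g -mulr_sumr -mulr_suml big_split/=.
  have h1 := sum_expR_signs (x w) (l w).
  have h2 := sum_expR_signs (x w) (- l w).
  rewrite sqrrN in h2.
  have e1 : expR (2 * l w ^+ 2 * \sum_i x w i ^+ 2) <= expR (2 * u w).
    by rewrite ler_expR -mulrA ler_pM2l//; exact: lQ.
  have e2 : 2 ^+ #|T| * expR (2 * l w ^+ 2 * \sum_i x w i ^+ 2) <=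
     2 ^+ #|T| * expR (2 * u w) by rewrite ler_wpM2l// exprn_ge0.
  have e3 : expR (- u w) = expR (- (3 * u w)) * expR (2 * u w).
    by rewrite -expRD; congr expR; ring.
  rewrite e3 [X in _ <= X]mulrCA ler_wpM2l ?expR_ge0//.
  rewrite /S; lra.
- move=> s Gs w.
  have gw : g s w <= 4.
    apply: le_trans Gs; rewrite (bigD1 w)//= lerDl; apply: sumr_ge0 => *; exact: g0.
  have h8 : (8 : R) <= expR 3.
    have h2 : 2 <= expR 1 :> R by have := expR_ge1Dx (1 : R); lra.
    have -> : expR 3 = expR 1 ^+ 3 :> R by rewrite -expRM_natl mulr1.
    have -> : (8 : R) = 2 ^+ 3 by ring.
    by rewrite lerXn2r// nnegrE// expR_ge0.
  have hh : expR (l w * S s w) + expR (- l w * S s w) <= expR (6 * u w).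
    move: gw; rewrite /g expRN -ler_pdivlMl ?invr_gt0 ?expR_gt0// invrK.
    have : expR (3 * u w) * 8 <= expR (6 * u w).
      have -> : 6 * u w = 3 * u w + 3 * u w by ring.
      rewrite expRD ler_pM2l ?expR_gt0//; apply: (le_trans h8).
      by rewrite ler_expR; have := u1 w; lra.
    lra.
  have hS : `|l w * S s w| <= 6 * u w.
    rewrite ler_norml; apply/andP; split.
      rewrite lerNl -mulNr -ler_expR; apply: le_trans hh.
      by rewrite lerDr expR_ge0.
    by rewrite -ler_expR; apply: le_trans hh; rewrite lerDl expR_ge0.
  have h36 : (l w) ^+ 2 * S s w ^+ 2 <= 36 * u w ^+ 2.
    have : `|l w * S s w| ^+ 2 <= (6 * u w) ^+ 2.
      by rewrite lerXn2r// nnegrE; have := u1 w; lra.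
    by rewrite real_normK ?num_real// !exprMn; lra.
  have [q0|q0] := eqVneq (Q w) 0.
    have xz i : x w i = 0.
      move/eqP: q0; rewrite psumr_eq0; last by move=> *; exact: sqr_ge0.
      by move=> /allP/(_ i); rewrite mem_index_enum sqrf_eq0 => /(_ isT)/eqP.
    rewrite big1 ?expr0n/=; last by move=> i _; rewrite xz mulr0.
    by rewrite -/(Q w) q0 mulr0.
  have qp : 0 < Q w by rewrite lt_neqAle eq_sym q0 Q0.
  have uw := u1 w.
  move: h36; rewrite /l sqr_sqrtr ?divr_ge0//; last lra.
  have up : 0 < u w by lra.
  rewrite -[_ * S s w ^+ 2]mulrAC ler_pdivrMr//.
  have -> : 36 * u w ^+ 2 * Q w = u w * (36 * u w * Q w) by ring.
  by rewrite ler_pM2l.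
Qed.

(** * Random signs: quadratic forms *)

Definition dot (R : realType) (n : nat) (u w : 'rV[R]_n) : R :=
  \sum_i u 0 i * w 0 i.

Section Dot.
Variables (R : realType) (n : nat).
Implicit Types u w c : 'rV[R]_n.

Lemma dotC u w : dot u w = dot w u.
Proof. by apply: eq_bigr => i _; rewrite mulrC. Qed.

Lemma dotDl u1 u2 w : dot (u1 + u2) w = dot u1 w + dot u2 w.
Proof. by rewrite -big_split/=; apply: eq_bigr => i _; rewrite mxE mulrDl. Qed.

Lemma dotZl a u w : dot (a *: u) w = a * dot u w.
Proof. by rewrite mulr_sumr; apply: eq_bigr => i _; rewrite mxE mulrA. Qed.

Lemma dotBl u1 u2 w : dot (u1 - u2) w = dot u1 w - dot u2 w.
Proof. by rewrite -scaleN1r dotDl dotZl mulN1r. Qed.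

Lemma dot0l w : dot 0 w = 0.
Proof. by rewrite -(scale0r w) dotZl mul0r. Qed.

Lemma dotZr a u w : dot u (a *: w) = a * dot u w.
Proof. by rewrite ![dot u _]dotC dotZl. Qed.

Lemma dotBr u w1 w2 : dot u (w1 - w2) = dot u w1 - dot u w2.
Proof. by rewrite ![dot u _]dotC dotBl. Qed.

Lemma dot_mx u w : dot u w = (u *m w^T) 0 0.
Proof. by rewrite mxE; apply: eq_bigr => i _; rewrite mxE. Qed.

Lemma dot_ge0 u : 0 <= dot u u.
Proof. by apply: sumr_ge0 => i _; rewrite -expr2 sqr_ge0. Qed.

Lemma dot_eq0 u : dot u u = 0 -> u = 0.
Proof.
move/eqP; rewrite psumr_eq0; last by move=> i _; rewrite -expr2 sqr_ge0.
move=> /allP h; apply/rowP => i; have := h i; rewrite mem_index_enum => /(_ isT).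
by rewrite -expr2 sqrf_eq0 mxE => /eqP.
Qed.

Lemma dot_CS u w : dot u w ^+ 2 <= dot u u * dot w w.
Proof.
have [w0|w0] := eqVneq (dot w w) 0.
  by rewrite (dot_eq0 w0) dotC !dot0l expr0n/= mulr0.
have wp : 0 < dot w w by rewrite lt_neqAle eq_sym w0 dot_ge0.
have := dot_ge0 (dot w w *: u - dot u w *: w).
have -> : dot (dot w w *: u - dot u w *: w) (dot w w *: u - dot u w *: w) =
    dot w w * (dot u u * dot w w - dot u w ^+ 2).
  by rewrite !(dotBl, dotBr, dotZl, dotZr) (dotC w u); ring.
by rewrite pmulr_rge0// subr_ge0.
Qed.

End Dot.

(** A maximum principle: if the maximum is positive and attained inside, log-convexity forces the
    left neighbour to attain it as well, and so on down to 0. *)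
Lemma logconvex_le_ends (R : realType) (x : nat -> R) (K : nat) :
  (forall j, (j <= K)%N -> 0 <= x j) ->
  (forall j, (0 < j < K)%N -> x j ^+ 2 <= x j.-1 * x j.+1) ->
  forall j, (j <= K)%N -> x j <= x 0%N + x K.
Proof.
move=> x0 xx.
have [j0 _ hj0] := @arg_maxP _ R 'I_K.+1 ord0 predT (fun i => x i) isT.
have bound : x j0 <= x 0%N + x K -> forall j, (j <= K)%N -> x j <= x 0%N + x K.
  move=> h j jK; apply: le_trans h.
  exact: (hj0 (Ordinal (jK : (j < K.+1)%N)) isT).
apply: bound.
have first_max : forall k, (k <= K)%N -> x k = x j0 -> x j0 <= x 0%N + x K.
  elim=> [|k IH] kK xk; first by rewrite -xk lerDl x0.
  have [kK'|kK'] := eqVneq k.+1 K; first by rewrite -xk kK' lerDr x0.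
  have kltK : (k.+1 < K)%N by rewrite ltn_neqAle kK'.
  have := xx k.+1; rewrite kltK => /(_ isT) /=; rewrite xk.
  have h1 : x k <= x j0 by exact: (hj0 (Ordinal (ltnW kK : (k < K.+1)%N)) isT).
  have h2 : x k.+2 <= x j0 by exact: (hj0 (Ordinal (kltK : (k.+2 < K.+1)%N)) isT).
  have p1 : 0 <= x k by rewrite x0// ltnW.
  have p2 : 0 <= x k.+2 by rewrite x0.
  move=> h3.
  have [z|z] := eqVneq (x j0) 0; first by rewrite z addr_ge0 ?x0.
  have zp : 0 < x j0 by rewrite lt_neqAle eq_sym z x0// -ltnS.
  apply: IH; first exact: ltnW.
  by apply/eqP; rewrite eq_le h1/=; nra.
by apply: (first_max j0) => //; rewrite -ltnS.
Qed.

Section Moments.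
Variables (R : realType) (n : nat).
Implicit Types (X Y : 'M[R]_n) (v : 'rV[R]_n).

Definition moment X v q : R := dot (v *m X ^+ q) v.

Lemma trmx_exp X q : X^T = X -> (X ^+ q)^T = X ^+ q.
Proof.
move=> sX; elim: q => [|q IH]; first by rewrite !expr0 trmx1.
by rewrite exprS -mulmxE trmx_mul IH sX mulmxE -exprSr exprS.
Qed.

Lemma moment_dot X v a b : X^T = X ->
  moment X v (a + b) = dot (v *m X ^+ a) (v *m X ^+ b).
Proof.
move=> sX; rewrite /moment !dot_mx trmx_mul trmx_exp//.
by rewrite exprD -mulmxE !mulmxA.
Qed.

Lemma moment_even_ge0 X v q : X^T = X -> 0 <= moment X v q.*2.
Proof. by move=> sX; rewrite -addnn moment_dot// dot_ge0. Qed.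

Lemma moment_CS X v a b : X^T = X ->
  moment X v (a + b) ^+ 2 <= moment X v a.*2 * moment X v b.*2.
Proof. by move=> sX; rewrite -!addnn !moment_dot//; exact: dot_CS. Qed.

Lemma moment0 X v : moment X v 0 = dot v v.
Proof. by rewrite /moment expr0 mulmx1. Qed.

(** The products of even moments are log-convex in the exponent, so the two ends dominate. An odd
    moment is at most the geometric mean of its even neighbours by Cauchy-Schwarz. *)
Lemma moment_prod_le X Y v r q : X^T = X -> Y^T = Y -> (q <= r.*2)%N ->
  `|moment X v q * moment Y v (r.*2 - q)| <=
  dot v v * (moment X v r.*2 + moment Y v r.*2).
Proof.
move=> sX sY qr.
pose x j := moment X v j.*2 * moment Y v (r - j).*2.
have x0 j : (j <= r)%N -> 0 <= x j.
  by move=> _; rewrite mulr_ge0 ?moment_even_ge0.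
have xx j : (0 < j < r)%N -> x j ^+ 2 <= x j.-1 * x j.+1.
  case: j => // j /andP[_ jr] /=.
  rewrite /x exprMn [X in _ <= X]mulrACA; apply: ler_pM; rewrite ?sqr_ge0//.
    have -> : j.+1.*2 = (j + j.+2)%N by rewrite -addnn; lia.
    exact: moment_CS.
  have -> : (r - j.+1).*2 = ((r - j) + (r - j.+2))%N by lia.
  exact: moment_CS.
have x_ends j : (j <= r)%N -> x j <= dot v v * (moment X v r.*2 + moment Y v r.*2).
  move=> jr; apply: (le_trans (logconvex_le_ends x0 xx jr)).
  by rewrite /x subn0 subnn double0 !moment0 mulrDr addrC [moment X _ _ * _]mulrC.
have e0 : 0 <= dot v v * (moment X v r.*2 + moment Y v r.*2).
  by rewrite mulr_ge0 ?dot_ge0// addr_ge0// moment_even_ge0.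
have [oq|eq] := boolP (odd q); last first.
  have -> : q = q./2.*2 by rewrite -[LHS]odd_double_half (negbTE eq).
  rewrite -doubleB ger0_norm; first by apply: x_ends; lia.
  by rewrite mulr_ge0 ?moment_even_ge0.
have qe : q = (q./2 + q./2.+1)%N by rewrite -[LHS]odd_double_half oq -addnn; lia.
have re : (r.*2 - q)%N = ((r - q./2) + (r - q./2.+1))%N by lia.
have h1 : moment X v q ^+ 2 <= moment X v q./2.*2 * moment X v q./2.+1.*2.
  by rewrite {1}qe; exact: moment_CS.
have h2 : moment Y v (r.*2 - q) ^+ 2 <=
    moment Y v (r - q./2).*2 * moment Y v (r - q./2.+1).*2.
  by rewrite re; exact: moment_CS.
rewrite -(ler_pXn2r (_ : (0 < 2)%N)) ?nnegrE//.
rewrite real_normK ?num_real// exprMn.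
apply: (@le_trans _ _ (x q./2 * x q./2.+1)).
  by rewrite /x [X in _ <= X]mulrACA; apply: ler_pM; rewrite ?sqr_ge0.
rewrite expr2; apply: ler_pM; rewrite ?x0 ?x_ends//; lia.
Qed.

Lemma exprB_telescope X Y m :
  X ^+ m.+1 - Y ^+ m.+1 = \sum_(q < m.+1) X ^+ q * (X - Y) * Y ^+ (m - q).
Proof.
elim: m => [|m IH]; first by rewrite big_ord1 subnn !expr0 mul1r mulr1 !expr1.
rewrite big_ord_recr/= subnn expr0 mulr1.
rewrite (eq_bigr (fun q : 'I_m.+1 => X ^+ q * (X - Y) * Y ^+ (m - q) * Y)); last first.
  by move=> q _; rewrite subSn ?exprSr ?mulrA// -ltnS.
rewrite -mulr_suml -IH mulrBl -!exprSr mulrBr -exprSr.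
by rewrite addrC addrA subrK.
Qed.

(** In the telescoped difference of powers every term contains the rank-one matrix X - Y, which
    splits it into a product of two moments. *)
Lemma moment_diff X Y v t m : X - Y = t *: (v^T *m v) ->
  moment X v m.+1 - moment Y v m.+1 =
  t * \sum_(q < m.+1) moment X v q * moment Y v (m - q).
Proof.
move=> XY; rewrite /moment -dotBl -mulmxBr exprB_telescope mulmx_sumr.
rewrite dot_mx mulmx_suml summxE mulr_sumr; apply: eq_bigr => q _.
rewrite XY -!mulmxE -scalemxAr -scalemxAl -scalemxAr -scalemxAl mxE; congr (_ * _).
rewrite !dot_mx; set P := v *m _; set Q := v *m _.
have <- : (P *m v^T) *m (Q *m v^T) = v *m (X ^+ q *m (v^T *m v) *m Y ^+ (m - q)) *m v^T.
  by rewrite /P /Q !mulmxA.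
by rewrite mxE big_ord1.
Qed.

End Moments.

Definition flip (T : finType) (i : T) (s : {ffun T -> bool}) : {ffun T -> bool} :=
  [ffun j => s j (+) (j == i)].

Lemma flipK (T : finType) (i : T) : involutive (flip i).
Proof.
by move=> s; apply/ffunP => j; rewrite !ffunE -addbA addbb addbF.
Qed.

Section QuadSigns.
Variables (R : realType) (n : nat) (T : finType) (v : T -> 'rV[R]_n).
Variables (D A : R).
Hypothesis D_gt0 : 0 < D.
Hypothesis A_gt0 : 0 < A.
Hypothesis vD : forall i, dot (v i) (v i) <= D.
Hypothesis vA : forall c, \sum_i dot c (v i) ^+ 2 <= A * dot c c.

Let X (s : {ffun T -> bool}) : 'M[R]_n :=
  \sum_i (-1) ^+ s i *: ((v i)^T *m v i).

Let trX s : (X s)^T = X s.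
Proof.
rewrite /X raddf_sum; apply: eq_bigr => i _.
by rewrite /= linearZ/= trmx_mul trmxK.
Qed.

Let tr_even_dot s q : \tr (X s ^+ q.*2) =
  \sum_e dot (row e (X s ^+ q)) (row e (X s ^+ q)).
Proof.
rewrite -addnn exprD -mulmxE /mxtrace; apply: eq_bigr => e _.
rewrite mxE; apply: eq_bigr => k _; rewrite !mxE; congr (_ * _).
by rewrite -[in LHS](trmx_exp q (trX s)) mxE.
Qed.

Let tr_even_ge0 s q : 0 <= \tr (X s ^+ q.*2).
Proof. by rewrite tr_even_dot; apply: sumr_ge0 => e _; exact: dot_ge0. Qed.

(** By symmetry of X, the squared norm of v_i X^q collects the squared products of v_i with the rows
    of X^q; the frame bound [vA] is applied to each row. *)
Let sum_moment_le s q :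
  \sum_i moment (X s) (v i) q.*2 <= A * \tr (X s ^+ q.*2).
Proof.
rewrite tr_even_dot mulr_sumr.
apply: (@le_trans _ _ (\sum_e \sum_i dot (row e (X s ^+ q)) (v i) ^+ 2)).
  rewrite [X in _ <= X]exchange_big/= le_eqVlt; apply/orP; left; apply/eqP.
  apply: eq_bigr => i _; rewrite -addnn moment_dot// /dot.
  apply: eq_bigr => e _; rewrite -expr2; congr (_ ^+ 2).
  rewrite mxE; apply: eq_bigr => k _; rewrite !mxE mulrC; congr (_ * _).
  by rewrite -[in LHS](trmx_exp q (trX s)) mxE.
by apply: ler_sum => e _; exact: vA.
Qed.

Let trace_sum s q :
  \tr (X s ^+ q.+1) = \sum_i (-1) ^+ s i * moment (X s) (v i) q.
Proof.
rewrite exprSr -mulmxE {2}/X mulmx_sumr raddf_sum; apply: eq_bigr => i _.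
rewrite /= -scalemxAr linearZ/= mulmxA mxtrace_mulC; congr (_ * _).
by rewrite /moment dot_mx mulmxA /mxtrace big_ord1.
Qed.

(** Flipping sign i changes X by 2 (v i)^T (v i) up to sign, so an odd moment, which carries the
    sign, leaves only a sum of 2 q + 1 products of total degree 2 q. This trades two powers of X for
    the factor D. *)
Let pair_le (s : {ffun T -> bool}) (i : T) (q : nat) :
  (-1) ^+ s i * moment (X s) (v i) q.*2.+1 +
  (-1) ^+ flip i s i * moment (X (flip i s)) (v i) q.*2.+1 <=
  2 * q.*2.+1%:R * D * (moment (X s) (v i) q.*2 + moment (X (flip i s)) (v i) q.*2).
Proof.
set s' := flip i s.
have s'i : (-1) ^+ s' i = - (-1) ^+ s i :> R.
  by rewrite ffunE eqxx addbT; case: (s i); rewrite /= ?expr0 ?expr1 ?opprK.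
have XX : X s - X s' = (2 * (-1) ^+ s i) *: ((v i)^T *m v i).
  rewrite /X -sumrB (bigD1 i)//= big1 ?addr0.
    by rewrite s'i -scalerBl opprK; congr (_ *: _); ring.
  by move=> j ji; rewrite ffunE (negbTE ji) addbF subrr.
rewrite s'i mulNr -mulrBr (moment_diff _ XX).
rewrite mulrA mulrCA -signr_odd oddb -expr2 sqrr_sign mulr1 -!mulrA ler_pM2l//.
apply: (le_trans (ler_norm _)); apply: (le_trans (ler_norm_sum _ _ _)).
rewrite mulr_natl -[X in _ *+ X]card_ord -sumr_const.
apply: ler_sum => k _.
have kq : (k <= q.*2)%N by rewrite -ltnS.
apply: (le_trans (moment_prod_le _ (trX _) (trX _) kq)).
by rewrite ler_wpM2r// addr_ge0// moment_even_ge0.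
Qed.

(** One factor X of the trace is written as the signed sum of rank-one matrices; for each i the
    average over s is taken over the pairs s, [flip i s]. *)
Let trace_rec q :
  \sum_s \tr (X s ^+ q.+1.*2) <=
  2 * q.*2.+1%:R * D * A * \sum_s \tr (X s ^+ q.*2).
Proof.
have step i : \sum_s (-1) ^+ (s : {ffun T -> bool}) i * moment (X s) (v i) q.*2.+1 <=
    2 * q.*2.+1%:R * D * \sum_s moment (X s) (v i) q.*2.
  have re (F : {ffun T -> bool} -> R) : \sum_s F s = 2^-1 * \sum_s (F s + F (flip i s)).
    have e : \sum_s F (flip i s) = \sum_s F s.
      by rewrite [RHS](reindex_inj (inv_inj (@flipK T i))).
    by rewrite big_split/= e; field.
  rewrite (re (fun s => _ * _)) (re (fun s => moment (X s) (v i) q.*2)).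
  rewrite mulrCA ler_pM2l// mulr_sumr.
  by apply: ler_sum => s _; exact: pair_le.
rewrite (eq_bigr (fun s : {ffun T -> bool} => \sum_i (-1) ^+ s i * moment (X s) (v i) q.*2.+1)); last first.
  by move=> s _; rewrite doubleS trace_sum.
rewrite exchange_big/=.
apply: (le_trans (ler_sum _ (fun i _ => step i))).
rewrite -mulr_sumr exchange_big/= -!mulrA !ler_pM2l//.
by rewrite mulr_sumr; apply: ler_sum => s _; exact: sum_moment_le.
Qed.

Let trace_bound K q : (q <= K)%N ->
  \sum_s \tr (X s ^+ q.*2) <= (4 * K%:R * D * A) ^+ q * (n%:R * 2 ^+ #|T|).
Proof.
elim: q => [|q IH] qK.
  rewrite expr0 mul1r (eq_bigr (fun=> n%:R)); last first.
    by move=> s _; rewrite expr0 mxtrace1.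
  by rewrite sumr_const card_ffun card_bool -[_ *+ _]mulr_natr natrX.
apply: (le_trans (trace_rec q)); rewrite exprS -[X in _ <= X]mulrA.
apply: ler_pM.
- by rewrite !mulr_ge0// ltW.
- by apply: sumr_ge0 => s _; exact: tr_even_ge0.
- rewrite !ler_pM2r// (_ : 4 = 2 * 2 :> R); last by ring.
  by rewrite -mulrA ler_pM2l// -natrM ler_nat; lia.
- by apply: IH; exact: ltnW.
Qed.

Let quad_dot (s : {ffun T -> bool}) (c : 'rV[R]_n) : \sum_i (-1) ^+ s i * dot c (v i) ^+ 2 = moment (X s) c 1.
Proof.
rewrite /moment expr1 /X mulmx_sumr dot_mx mulmx_suml summxE.
apply: eq_bigr => i _; rewrite -scalemxAr -scalemxAl mxE; congr (_ * _).
have -> : dot c (v i) ^+ 2 = dot c (v i) * dot (v i) c by rewrite expr2 [dot (v i) c]dotC.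
rewrite !dot_mx.
have <- : (c *m (v i)^T) *m (v i *m c^T) = c *m ((v i)^T *m v i) *m c^T.
  by rewrite !mulmxA.
by rewrite [RHS]mxE big_ord1.
Qed.

(** Jensen's inequality for the spectral measure of X at c, obtained without a spectral theorem:
    log-convexity makes the ratios of consecutive even moments increase. *)
Let moment_pow s c q : dot c c * moment (X s) c 2 ^+ q.+1 <=
  dot c c ^+ q.+1 * moment (X s) c q.+1.*2.
Proof.
pose x j := moment (X s) c j.*2.
have x0 j : 0 <= x j by exact: moment_even_ge0.
have xx j : x j.+1 ^+ 2 <= x j * x j.+2.
  rewrite /x (_ : j.+1.*2 = j + j.+2)%N; last by lia.
  exact: moment_CS.
have xS j : x 1%N * x j <= x 0%N * x j.+1.
  elim: j => [|j IH]; first by rewrite mulrC.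
  have [z|z] := eqVneq (x j.+1) 0; first by rewrite z mulr0 mulr_ge0.
  have xp : 0 < x j.+1 by rewrite lt_neqAle eq_sym z x0.
  have h1 := ler_wpM2l (x0 1%N) (xx j).
  have h2 := ler_wpM2r (x0 j.+2) IH.
  rewrite -(ler_pM2r xp).
  apply: (le_trans _ (le_trans h2 _)); last by rewrite mulrAC.
  by rewrite -mulrA -expr2 -mulrA.
have e0 : x 0%N = dot c c by rewrite /x double0 moment0.
rewrite -e0 -/(x 1%N) -/(x q.+1).
elim: q => [|q IH]; first by rewrite !expr1.
have h1 := ler_wpM2r (x0 1%N) IH.
rewrite exprSr mulrA; apply: (le_trans h1).
rewrite [x 0%N ^+ q.+2]exprSr -!mulrA ler_wpM2l ?exprn_ge0//.
by rewrite mulrC; exact: xS.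
Qed.

Let moment_le_tr s c q : moment (X s) c q.*2 <= dot c c * \tr (X s ^+ q.*2).
Proof.
rewrite -addnn moment_dot// addnn tr_even_dot mulr_sumr; apply: ler_sum => e _.
rewrite -expr2; apply: le_trans (dot_CS _ _).
rewrite le_eqVlt; apply/orP; left; apply/eqP; congr (_ ^+ 2).
rewrite mxE; apply: eq_bigr => k _; rewrite !mxE; congr (_ * _).
by rewrite -[in LHS](trmx_exp q (trX s)) mxE.
Qed.

(* The moment method for [\sum_i +-(v i)^T (v i)]: integrating out one sign at a
   time bounds the average trace of its even powers (noncommutative Khintchine). *)
Lemma quad_signs (K : nat) : (0 < K)%N -> (4 * n.+1 <= 4 ^ K)%N ->
  exists G : {ffun T -> bool} -> R,
    [/\ forall s, 0 <= G s, \sum_s G s <= 2 ^+ #|T|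
      & forall s, G s <= 4 -> forall c,
          (\sum_i (-1) ^+ s i * dot c (v i) ^+ 2) ^+ 2 <=
          16 * K%:R * D * A * dot c c ^+ 2].
Proof.
move=> K0 nK.
pose B := 4 * K%:R * D * A.
have B0 : 0 < B by rewrite !mulr_gt0// ltr0n.
have BK0 : 0 < n.+1%:R * B ^+ K by rewrite mulr_gt0 ?ltr0n// exprn_gt0.
(* Normalized by the trace bound, with n + 1 in place of n so that n = 0 causes no division by zero.
   If G <= 4, the hypothesis 4 (n + 1) <= 4^K lets the K-th root absorb the dimension. *)
exists (fun s => \tr (X s ^+ K.*2) / (n.+1%:R * B ^+ K)); split.
- by move=> s; rewrite divr_ge0 ?tr_even_ge0// ltW.
- rewrite -mulr_suml ler_pdivrMr//; apply: (le_trans (trace_bound (leqnn K))).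
  rewrite -/B mulrCA mulrA [X in _ <= X]mulrC ler_wpM2r ?exprn_ge0//.
  by rewrite ler_wpM2r ?ler_nat// exprn_ge0// ltW.
- move=> s; rewrite ler_pdivrMr// => hs c.
  have cc0 := dot_ge0 c.
  have [z|z] := eqVneq (dot c c) 0.
    rewrite (dot_eq0 z) big1 ?expr0n/= ?dot0l ?expr0n ?mulr0//.
    by move=> i _; rewrite dot0l expr0n/= mulr0.
  have cp : 0 < dot c c by rewrite lt_neqAle eq_sym z.
  rewrite quad_dot.
  have h1 : moment (X s) c 1 ^+ 2 <= dot c c * moment (X s) c 2.
    by rewrite -(moment0 (X s) c); have := moment_CS c 0 1 (trX s); rewrite add0n.
  have h2 : dot c c * moment (X s) c 2 ^+ K <= dot c c ^+ K * moment (X s) c K.*2.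
    by case: K K0 {nK B B0 BK0 hs} => // k _; exact: moment_pow.
  have h3 := moment_le_tr s c K.
  have h4 : moment (X s) c 2 ^+ K <= dot c c ^+ K * (4 ^+ K * B ^+ K).
    rewrite -(ler_pM2l cp); apply: (le_trans h2).
    rewrite mulrCA ler_wpM2l ?exprn_ge0//; apply: (le_trans h3).
    rewrite ler_wpM2l//; apply: (le_trans hs).
    have n4 : 4 * n.+1%:R <= 4 ^+ K :> R by rewrite -natrM -natrX ler_nat.
    by rewrite mulrA ler_wpM2r// exprn_ge0// ltW.
  have m0 : 0 <= moment (X s) c 2 by exact: (moment_even_ge0 c 1).
  have h5 : moment (X s) c 2 <= dot c c * (4 * B).
    have b0 : 0 <= dot c c * (4 * B) by rewrite mulr_ge0// mulr_ge0// ltW.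
    rewrite -(ler_pXn2r K0) ?nnegrE//.
    by rewrite !exprMn; move: h4; rewrite /B !exprMn.
  apply: (le_trans h1); apply: (le_trans (ler_wpM2l cc0 h5)).
  by rewrite /B le_eqVlt; apply/orP; left; apply/eqP; ring.
Qed.

End QuadSigns.

(** * Sup-norm approximation *)

Lemma near_min (R : realType) (V : Type) (S : set V) (F : V -> R) (d : R) :
  0 < d -> S !=set0 -> (forall g, S g -> 0 <= F g) ->
  exists g, S g /\ forall g', S g' -> F g <= F g' + d.
Proof.
move=> d0 [g0 Sg0] F0.
have hi : has_inf (F @` S).
  split; first by exists (F g0); exists g0.
  by exists 0 => _ [g Sg <-]; exact: F0.
have [_ [g Sg <-] hg] := inf_adherent d0 hi.
exists g; split => // g' Sg'; apply: (le_trans (ltW hg)).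
rewrite lerD2r; apply: ge_inf; first exact: hi.2.
by exists g'.
Qed.

(** Terms not below B are dropped; from the first term below B on, the series is geometric. *)
Lemma geometric_sum_below (R : realType) (q a B : R) (J : nat) :
  0 < q < 1 -> 0 <= a -> 0 <= B ->
  \sum_(j < J) (if a * q ^+ j < B then a * q ^+ j else 0) <= B / (1 - q).
Proof.
move=> /andP[q0 q1] a0 B0.
have q1' : 0 < 1 - q by rewrite subr_gt0.
elim: J a a0 => [|J IH] a a0; first by rewrite big_ord0 divr_ge0// ltW.
have [aB|Ba] := ltP a B.
  apply: (@le_trans _ _ (\sum_(j < J.+1) a * q ^+ j)).
    by apply: ler_sum => j _; case: ifP => // _; rewrite mulr_ge0// exprn_ge0// ltW.
  have -> : \sum_(j < J.+1) a * q ^+ j = a * (1 - q ^+ J.+1) / (1 - q).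
    have := subrX1 q J.+1; rewrite -mulr_sumr => h.
    have -> : 1 - q ^+ J.+1 = (1 - q) * (\sum_(i < J.+1) q ^+ i).
      by rewrite -opprB h; ring.
    by field; rewrite gt_eqF.
  rewrite ler_pM2r ?invr_gt0//; apply: le_trans (ltW aB).
  by rewrite ler_piMr// gerBl exprn_ge0// ltW.
rewrite big_ord_recl/= expr0 mulr1 ltNge Ba/= add0r.
apply: le_trans (IH (a * q) _); last by rewrite mulr_ge0// ltW.
by apply: ler_sum => j _; rewrite /bump/= add1n exprS mulrA.
Qed.

Section Perceptron.
Variables (R : realType) (n : nat) (U : finType) (v : U -> 'rV[R]_n).

Definition pstep (eta : R) (g : 'rV[R]_n) (a : U * bool) : 'rV[R]_n :=
  g + ((-1) ^+ a.2 * eta) *: v a.1.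

(* Sup-norm entropy without Gaussian measures: each perceptron correction
   decreases [D * dot (h - g) (h - g)] by [r ^ 2], so few of them are made. *)
Lemma perceptron (D r : R) (h g : 'rV[R]_n) : 0 < D -> 0 < r ->
  (forall u, dot (v u) (v u) <= D) ->
  exists ws : seq (U * bool),
    (size ws)%:R * r ^+ 2 <= D * dot (h - g) (h - g) /\
    forall u, `|dot (h - foldl (pstep (r / D)) g ws) (v u)| <= r.
Proof.
move=> D0 r0 vD.
have r20 : 0 < r ^+ 2 by rewrite exprn_gt0.
have [k hk] : exists k : nat, D * dot (h - g) (h - g) < k.+1%:R * r ^+ 2.
  exists (Num.trunc (D * dot (h - g) (h - g) / r ^+ 2)).
  rewrite -ltr_pdivrMr//; apply: truncnS_gt.
elim: k g hk => [|k IH] g hk.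
  have [/forallP hu|] := boolP [forall u, `|dot (h - g) (v u)| <= r].
    by exists [::]; rewrite mul0r mulr_ge0 ?dot_ge0// ltW.
  rewrite negb_forall => /existsP[u]; rewrite -ltNge => hu; exfalso.
  have h1 := dot_CS (h - g) (v u).
  have h2 : r ^+ 2 < `|dot (h - g) (v u)| ^+ 2 by rewrite ltrXn2r// ltW.
  rewrite real_normK ?num_real// in h2.
  have h3 : dot (h - g) (h - g) * dot (v u) (v u) <= dot (h - g) (h - g) * D.
    by rewrite ler_wpM2l// dot_ge0.
  rewrite mul1r in hk; lra.
have [/forallP hu|] := boolP [forall u, `|dot (h - g) (v u)| <= r].
  by exists [::]; rewrite mul0r mulr_ge0 ?dot_ge0// ltW.
rewrite negb_forall => /existsP[u]; rewrite -ltNge => hu.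
set x := dot (h - g) (v u) in hu.
pose a := (u, x < 0).
pose g' := pstep (r / D) g a.
have dec : D * dot (h - g') (h - g') <= D * dot (h - g) (h - g) - r ^+ 2.
  have -> : h - g' = (h - g) - ((-1) ^+ (x < 0)%R * (r / D)) *: v u.
    by rewrite /g' /pstep opprD addrA.
  set e := _ * (r / D).
  have -> : dot (h - g - e *: v u) (h - g - e *: v u) =
      dot (h - g) (h - g) - 2 * e * x + e ^+ 2 * dot (v u) (v u).
    rewrite [LHS]dotBl ![dot _ (h - g - _)]dotBr !dotZl !dotZr.
    by rewrite (dotC (v u) (h - g)) -/x; ring.
  have ex : e * x = r / D * `|x|.
    by rewrite /e [in RHS]normrEsign mulrAC mulrC.
  have e2 : e ^+ 2 = (r / D) ^+ 2 by rewrite /e exprMn sqrr_sign mul1r.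
  rewrite -mulrA ex e2.
  have h1 : (r / D) ^+ 2 * dot (v u) (v u) <= (r / D) ^+ 2 * D.
    by rewrite ler_wpM2l// sqr_ge0.
  have h2 : r / D * r <= r / D * `|x| by rewrite ler_wpM2l ?(ltW hu)// divr_ge0// ltW.
  have h3 : dot (h - g) (h - g) - 2 * (r / D * `|x|) + (r / D) ^+ 2 * dot (v u) (v u)
     <= dot (h - g) (h - g) - 2 * (r / D * r) + (r / D) ^+ 2 * D by lra.
  apply: (le_trans (ler_wpM2l (ltW D0) h3)).
  rewrite le_eqVlt; apply/orP; left; apply/eqP; field.
  by rewrite gt_eqF.
have hk' : D * dot (h - g') (h - g') < k.+1%:R * r ^+ 2.
  apply: (le_lt_trans dec); rewrite ltrBlDr; apply: (lt_le_trans hk).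
  by rewrite -[X in _ <= _ + X]mul1r -mulrDl -natr1.
have [ws [h1 h2]] := IH g' hk'.
exists (a :: ws); split; last exact: h2.
rewrite /= -natr1 mulrDl mul1r; lra.
Qed.

End Perceptron.

(* Up to geometric tails over dyadic [t], [wgt p t x] is [t `^ p] on [t < `|x|];
   it bounds both the entropy and the variance at scale [t]. *)
Definition wgt (R : realType) (p t x : R) : R :=
  if t / 2 < `|x| then t `^ (2 - p) * `|x| `^ (2 * p - 2) else 0.

(** The part of |x|^p above height 2 t. Refining t to t / 2 leaves it unchanged, at 0, wherever |x|
    is small against t, so increments along a chain live on the large values of the function
    only. *)
Definition cut (R : realType) (p t x : R) : R :=
  Num.max `|x| (2 * t) `^ p - (2 * t) `^ p.

Section Pointwise.
Variables (R : realType) (p : R).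
Hypotheses (p_gt1 : 1 < p) (p_lt2 : p < 2).

Let hp : 1 < p < 2. Proof. by rewrite p_gt1. Qed.
Let p_lip : 1 < p <= 2. Proof. by rewrite p_gt1 ltW. Qed.

Lemma wgt_ge0 t x : 0 <= wgt p t x.
Proof. by rewrite /wgt; case: ifP => // _; rewrite mulr_ge0// powR_ge0. Qed.

Lemma powR_le_lin (a x r : R) : 0 <= r <= 1 -> 1 <= a -> 0 <= x ->
  (a * x) `^ r <= a * x `^ r.
Proof.
move=> /andP[r0 r1] a1 x0; rewrite powRM//; last lra.
by rewrite ler_wpM2r ?powR_ge0// ler1_powR.
Qed.

(** If |x| <= t/2, both a and z are bounded by 4 t and strong convexity applies. Otherwise (a - z)^2
    <= 16 t^2 is already of the order of t^(2-p) times the weight. The resulting constants are not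
    optimized. *)
Lemma sqr_dev_le t x a z : 0 < t -> `|x - a| <= t / 4 -> `|x - z| <= 3 * t ->
  (a - z) ^+ 2 <= 128 / (p - 1) * t `^ (2 - p) *
    (`|a| `^ p + `|z| `^ p - 2 * `|(a + z) / 2| `^ p + wgt p t x).
Proof.
have [p1 p2] := (p_gt1, p_lt2).
move=> t0 xa xz.
have t4 : 0 < 4 * t by lra.
have p10 : 0 < p - 1 by lra.
have c4 : (4 * t) `^ (2 - p) <= 4 * t `^ (2 - p).
  by apply: powR_le_lin => //; lra.
have pt0 : 0 < t `^ (2 - p) by exact: powR_gt0.
have def0 : 0 <= `|a| `^ p + `|z| `^ p - 2 * `|(a + z) / 2| `^ p.
  have m0 : 0 < `|a| + `|z| + 1 by have := normr_ge0 a; have := normr_ge0 z; lra.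
  have za := normr_ge0 a; have zz := normr_ge0 z.
  have h1 : `|a| <= `|a| + `|z| + 1 by lra.
  have h2 : `|z| <= `|a| + `|z| + 1 by lra.
  have h3 := powR_strong_convex hp m0 h1 h2.
  have : 0 <= (p - 1) / 32 * (a - z) ^+ 2 by rewrite mulr_ge0 ?sqr_ge0//; lra.
  by move=> /le_trans /(_ h3); rewrite pmulr_rge0// powR_gt0.
set def := (X in X + wgt _ _ _).
rewrite -/def in def0.
rewrite /wgt; case: ltP => hx; last first.
  have ha : `|a| <= 4 * t.
    have : `|a| <= `|x| + `|x - a| by rewrite -[X in `|X| <= _](subKr x) ler_normB.
    lra.
  have hz : `|z| <= 4 * t.
    have : `|z| <= `|x| + `|x - z| by rewrite -[X in `|X| <= _](subKr x) ler_normB.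
    lra.
  have h1 := powR_strong_convex hp t4 ha hz.
  rewrite -/def addr0 in h1 *.
  have h2 : (4 * t) `^ (2 - p) * def <= 4 * t `^ (2 - p) * def by rewrite ler_wpM2r.
  have h3 := le_trans h1 h2.
  have pp : 0 < (p - 1) / 32 by lra.
  rewrite -(ler_pM2l pp).
  apply: (le_trans h3); rewrite le_eqVlt; apply/orP; left; apply/eqP; field.
  by rewrite gt_eqF.
have haz : `|a - z| <= 4 * t.
  have : `|a - z| <= `|x - z| + `|x - a|.
    by rewrite [a - z](_ : _ = (x - z) - (x - a)) ?ler_normB//; ring.
  lra.
have h1 : (a - z) ^+ 2 <= 16 * t ^+ 2.
  by rewrite -real_normK ?num_real//; have := normr_ge0 (a - z); nra.
have et : t ^+ 2 = t `^ (2 - p) * t `^ (2 - p) * t `^ (2 * p - 2).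
  rewrite -!powRD ?(gt_eqF t0) ?implybT//.
  by rewrite -powR_mulrn ?ltW//; congr (_ `^ _); ring.
have h2 : t `^ (2 * p - 2) <= 4 * `|x| `^ (2 * p - 2).
  apply: (@le_trans _ _ ((2 * `|x|) `^ (2 * p - 2))).
    rewrite ge0_ler_powR ?nnegrE//; lra.
  rewrite powRM// ler_wpM2r ?powR_ge0//.
  apply: (@le_trans _ _ (2 `^ 2)); first by rewrite ler_powR; lra.
  by rewrite powR_mulrn// le_eqVlt; apply/orP; left; apply/eqP; ring.
have h3 : 16 * t ^+ 2 <= 64 * t `^ (2 - p) * (t `^ (2 - p) * `|x| `^ (2 * p - 2)).
  rewrite et; set Q := t `^ (2 - p) in pt0 *.
  have : Q * Q * t `^ (2 * p - 2) <= Q * Q * (4 * `|x| `^ (2 * p - 2)).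
    by rewrite ler_wpM2l// mulr_ge0// ltW.
  lra.
apply: (le_trans h1); apply: (le_trans h3).
have w0 : 0 <= t `^ (2 - p) * `|x| `^ (2 * p - 2) by rewrite mulr_ge0// powR_ge0.
apply: (@le_trans _ _ (128 / (p - 1) * t `^ (2 - p) * (t `^ (2 - p) * `|x| `^ (2 * p - 2)))).
  rewrite ler_wpM2r// ler_wpM2r ?powR_ge0// ler_pdivlMr//; lra.
have c0 : 0 <= 128 / (p - 1) by rewrite divr_ge0// ltW.
by rewrite ler_wpM2l ?lerDr// mulr_ge0// powR_ge0.
Qed.

(** For |x| <= t/2 both cuts vanish. Otherwise the Lipschitz bound of |x|^p makes the increment at
    most 33 t |x|^(p-1), whose square is 33^2 = 1089 times t^p times the weight. *)
Lemma cut_incr_le t x y g : 0 < t -> `|x - y| <= t -> `|x - g| <= t / 2 ->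
  (cut p (t / 2) g - cut p t y) ^+ 2 <= 1089 * (t `^ p * wgt p t x).
Proof.
have [p1 p2] := (p_gt1, p_lt2).
move=> t0 xy xg.
have hy : `|y| <= `|x| + `|x - y| by rewrite -[X in `|X| <= _](subKr x) ler_normB.
have hg : `|g| <= `|x| + `|x - g| by rewrite -[X in `|X| <= _](subKr x) ler_normB.
have e2 : 2 * (t / 2) = t by field.
rewrite /cut e2 /wgt; case: ltP => hx; last first.
  rewrite !max_r; [|lra|lra].
  by rewrite !subrr expr0n/= !mulr0.
set P := Num.max `|g| t; set Q := Num.max `|y| (2 * t).
have P0 : 0 <= P <= 5 * `|x|.
  rewrite /P le_max normr_ge0/= ge_max; apply/andP; split; lra.
have Q0 : 0 <= Q <= 5 * `|x|.
  rewrite /Q le_max normr_ge0/= ge_max; apply/andP; split; lra.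
have PQ : `|P - Q| <= 5 / 2 * t.
  have h1 : `|y| - `|g| <= 3 / 2 * t.
    apply: le_trans (lerB_dist _ _) _.
    rewrite [y - g](_ : _ = (x - g) - (x - y)); last by ring.
    by apply: (le_trans (ler_normB _ _)); lra.
  have h2 : `|g| - `|y| <= 3 / 2 * t.
    apply: le_trans (lerB_dist _ _) _.
    rewrite [g - y](_ : _ = (x - y) - (x - g)); last by ring.
    by apply: (le_trans (ler_normB _ _)); lra.
  rewrite ler_norml /P /Q.
  by case: (leP `|g| t) => ?; case: (leP `|y| (2 * t)) => ?; lra.
have h1 := powR_lip p_lip P0 Q0.
have T1 : 0 <= t <= 5 * `|x| by lra.
have T2 : 0 <= 2 * t <= 5 * `|x| by lra.
have h2 := powR_lip p_lip T2 T1.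
set X := `|x| `^ (p - 1).
have X0 : 0 <= X by exact: powR_ge0.
have h5 : (5 * `|x|) `^ (p - 1) <= 5 * X.
  by apply: powR_le_lin => //; lra.
have e3 : `|2 * t - t| = t by rewrite ger0_norm; lra.
have T4 : 0 <= 2 * t <= 4 * `|x| by lra.
have h6 : 0 <= (2 * t) `^ p - t `^ p <= 8 * X * t.
  have tt : 0 <= t <= 2 * t by lra.
  have /andP[-> h] := powR_lip_ord p_lip tt.
  apply: (le_trans h); have -> : 2 * t - t = t by ring.
  rewrite ler_pM2r//.
  have : (2 * t) `^ (p - 1) <= (4 * `|x|) `^ (p - 1).
    have [T40 T41] := andP T4.
    by rewrite ge0_ler_powR ?nnegrE ?subr_ge0 ?(ltW p1)// (le_trans T40).
  have : (4 * `|x|) `^ (p - 1) <= 4 * X by apply: powR_le_lin => //; lra.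
  lra.
have h7 : `|P `^ p - Q `^ p| <= 25 * X * t.
  apply: (le_trans h1).
  apply: (@le_trans _ _ (2 * (5 * X) * (5 / 2 * t))); last by lra.
  by apply: ler_pM; rewrite ?normr_ge0 ?mulr_ge0 ?powR_ge0 ?ler_wpM2l.
have h8 : `|P `^ p - t `^ p - (Q `^ p - (2 * t) `^ p)| <= 33 * (X * t).
  have -> : P `^ p - t `^ p - (Q `^ p - (2 * t) `^ p) =
     (P `^ p - Q `^ p) + ((2 * t) `^ p - t `^ p) by ring.
  case/andP: h6 => h6 h6'.
  apply: (le_trans (ler_normD _ _)); rewrite (ger0_norm h6); lra.
have e4 : t `^ p * (t `^ (2 - p) * `|x| `^ (2 * p - 2)) = (X * t) ^+ 2.
  rewrite mulrA -powRD ?(gt_eqF t0) ?implybT// addrC subrK powR_mulrn ?ltW//.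
  rewrite exprMn mulrC; congr (_ * _).
  by rewrite /X -powR_mulrn ?powR_ge0// -powRrM; congr (_ `^ _); ring.
rewrite e4 -real_normK ?num_real//.
apply: (@le_trans _ _ ((33 * (X * t)) ^+ 2)).
  by rewrite lerXn2r// nnegrE// !mulr_ge0// ltW.
by rewrite le_eqVlt; apply/orP; left; apply/eqP; ring.
Qed.

(** The truncation error at the last scale of a chain. The factor |x| + 3 dominates (|x| + 3)^(p-1)
    and is integrable against the energy. *)
Lemma cut_approx t x g : 0 < t <= 1 -> `|x - g| <= t ->
  `|cut p t g - `|x| `^ p| <= 8 * t * (`|x| + 3).
Proof.
have [p1 p2] := (p_gt1, p_lt2).
move=> /andP[t0 t1] xg.
have hg : `|g| <= `|x| + `|x - g| by rewrite -[X in `|X| <= _](subKr x) ler_normB.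
rewrite /cut; set P := Num.max `|g| (2 * t).
have x0 := normr_ge0 x.
have P0 : 0 <= P <= `|x| + 3.
  rewrite /P le_max normr_ge0/= ge_max; apply/andP; split; lra.
have X0 : 0 <= `|x| <= `|x| + 3 by lra.
have PX : `|P - `|x| | <= 3 * t.
  have h1 : `|x| - `|g| <= t by apply: le_trans (lerB_dist _ _) _.
  rewrite ler_norml /P; case: (leP `|g| (2 * t)) => ?; lra.
have h1 := powR_lip p_lip P0 X0.
have M1 : (`|x| + 3) `^ (p - 1) <= `|x| + 3 by apply: ler1_powR; lra.
have M0 : 0 <= (`|x| + 3) `^ (p - 1) by exact: powR_ge0.
have h2 : (2 * t) `^ p <= 2 * t * (`|x| + 3).
  rewrite powR_sub1; [|lra|lra].
  rewrite ler_wpM2l//; first lra.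
  apply: le_trans M1; rewrite ge0_ler_powR ?nnegrE//; lra.
have h3 : `|P `^ p - `|x| `^ p| <= 6 * t * (`|x| + 3).
  apply: (le_trans h1).
  apply: (@le_trans _ _ (2 * (`|x| + 3) * (3 * t))); last by lra.
  by apply: ler_pM; rewrite ?normr_ge0 ?mulr_ge0 ?ler_wpM2l.
have h4 : 0 <= (2 * t) `^ p by exact: powR_ge0.
rewrite addrAC; apply: (le_trans (ler_normB _ _)).
rewrite (ger0_norm h4); lra.
Qed.

Lemma cut0 t : 0 <= t -> cut p t 0 = 0.
Proof.
have [p1 p2] := (p_gt1, p_lt2).
by move=> t0; rewrite /cut normr0 max_r ?subrr//; lra.
Qed.

(** As p < 2, the factor t^(2-p) decreases geometrically over dyadic t, and only t < 2 |x|
    contribute; the sum is of the order of its largest term. *)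
Lemma sum_wgt_le (t0 x : R) (J : nat) : 0 < t0 ->
  \sum_(j < J) wgt p (t0 / 2 ^+ j) x <= 2 / (1 - 2 `^ (p - 2)) * `|x| `^ p.
Proof.
have [p1 p2] := (p_gt1, p_lt2).
move=> t00; set q := 2 `^ (p - 2).
have q1 : q < 1.
  have -> : q = (2 `^ (2 - p))^-1 by rewrite /q -powRN opprB.
  rewrite invf_lt1 ?powR_gt0//.
  rewrite -[X in X < _](powRr0 2) /powR pnatr_eq0/= ltr_expR.
  rewrite mul0r mulr_gt0 ?ln_gt0//; lra.
have q0 : 0 < q by rewrite powR_gt0.
have [x0|x0] := eqVneq x 0.
  have cq : 0 <= 2 / (1 - q) by rewrite divr_ge0// subr_ge0 ltW.
  rewrite big1; first by rewrite mulr_ge0// powR_ge0.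
  move=> j _; rewrite /wgt x0 normr0 ltNge.
  by have -> : 0 <= t0 / 2 ^+ j / 2 by rewrite !divr_ge0 ?exprn_ge0 ?ltW.
have xp : 0 < `|x| by rewrite normr_gt0.
have tq j : (t0 / 2 ^+ j) `^ (2 - p) = t0 `^ (2 - p) * q ^+ j.
  have i0 : 0 <= (2 ^+ j)^-1 :> R by rewrite invr_ge0 exprn_ge0.
  rewrite powRM ?(ltW t00)//; congr (_ * _).
  rewrite -powR_invn// -powRrM -(powR_mulrn j (ltW q0)) /q -powRrM.
  by congr (_ `^ _); ring.
have e j : wgt p (t0 / 2 ^+ j) x = `|x| `^ (2 * p - 2) *
   (if t0 `^ (2 - p) * q ^+ j < (2 * `|x|) `^ (2 - p) then t0 `^ (2 - p) * q ^+ j else 0).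
  rewrite /wgt -tq.
  have tj0 : 0 < t0 / 2 ^+ j by rewrite divr_gt0// exprn_gt0.
  have -> : (t0 / 2 ^+ j / 2 < `|x|) = ((t0 / 2 ^+ j) `^ (2 - p) < (2 * `|x|) `^ (2 - p)).
    rewrite ltr_pdivrMr// [_ * 2]mulrC; apply/idP/idP => h.
      by apply: gt0_ltr_powR; rewrite ?nnegrE ?subr_gt0 ?(ltW tj0)// mulr_ge0.
    rewrite ltNge; apply/negP => h'; move: h; apply/negP; rewrite -leNgt.
    by apply: ge0_ler_powR; rewrite ?nnegrE ?subr_ge0 ?(ltW tj0) ?(ltW p2)// mulr_ge0.
  by case: ifP => _; rewrite ?mulr0// mulrC.
rewrite (eq_bigr _ (fun (j : 'I_J) _ => e j)) -mulr_sumr.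
have q01 : 0 < q < 1 by rewrite q0.
have h := geometric_sum_below J q01 (powR_ge0 t0 (2 - p)) (powR_ge0 (2 * `|x|) (2 - p)).
apply: (le_trans (ler_wpM2l (powR_ge0 _ _) h)).
have h2 : (2 * `|x|) `^ (2 - p) <= 2 * `|x| `^ (2 - p) by apply: powR_le_lin => //; lra.
have e2 : `|x| `^ p = `|x| `^ (2 * p - 2) * `|x| `^ (2 - p).
  by rewrite -powRD ?(gt_eqF xp) ?implybT//; congr (_ `^ _); ring.
rewrite e2.
have -> : 2 / (1 - q) * (`|x| `^ (2 * p - 2) * `|x| `^ (2 - p)) =
  `|x| `^ (2 * p - 2) * (2 * `|x| `^ (2 - p) / (1 - q)) by ring.
rewrite ler_wpM2l ?powR_ge0// ler_wpM2r// invr_ge0; lra.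
Qed.

End Pointwise.

(** * Chaining *)

Definition avg (R : realType) (U : finType) (F : U -> R) : R :=
  #|U|%:R^-1 * \sum_u F u.

Section Avg.
Variables (R : realType) (U : finType).
Implicit Types F G : U -> R.

Lemma ler_avg F G : (forall u, F u <= G u) -> avg F <= avg G.
Proof. by move=> FG; rewrite ler_wpM2l ?invr_ge0// ler_sum. Qed.

Lemma avg_ge0 F : (forall u, 0 <= F u) -> 0 <= avg F.
Proof. by move=> F0; rewrite mulr_ge0 ?invr_ge0// sumr_ge0. Qed.

Lemma avgD F G : avg (fun u => F u + G u) = avg F + avg G.
Proof. by rewrite /avg big_split mulrDr. Qed.

Lemma avgZ a F : avg (fun u => a * F u) = a * avg F.
Proof. by rewrite /avg -mulr_sumr mulrCA. Qed.

Lemma avg_sum (J : nat) (F : 'I_J -> U -> R) :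
  avg (fun u => \sum_j F j u) = \sum_j avg (F j).
Proof. by rewrite /avg exchange_big/= mulr_sumr. Qed.

Lemma avg_cst (a : R) : (0 < #|U|)%N -> avg (fun _ : U => a) = a.
Proof.
move=> U0; rewrite /avg sumr_const -[a *+ _]mulr_natl mulKf//.
by rewrite pnatr_eq0 -lt0n.
Qed.

Lemma sum_avg F : (0 < #|U|)%N -> \sum_u F u = #|U|%:R * avg F.
Proof. by move=> U0; rewrite /avg mulVKf// pnatr_eq0 -lt0n. Qed.

End Avg.

Lemma sum_shift4_le (R : realType) (b : nat -> R) (J : nat) :
  (forall j, 0 <= b j) -> (forall j, b j <= 2) ->
  \sum_(j < J) (b j.+4 - b j) <= 8.
Proof.
move=> b0 b2.
have tel : \sum_(j < J) (b j.+4 - b j) = (b J + b J.+1 + b J.+2 + b J.+3) -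
    (b 0%N + b 1%N + b 2 + b 3).
  elim: J => [|J IH]; first by rewrite big_ord0 subrr.
  by rewrite big_ord_recr/= IH; ring.
rewrite tel.
have := (b2 J, b2 J.+1, b2 J.+2, b2 J.+3, b0 0%N, b0 1%N, b0 2%N, b0 3%N).
by move=> [[[[[[[]]]]]]]; lra.
Qed.

Section Chain.
Variables (R : realType) (p : R) (n : nat) (T : finType).
Variables (v : T * bool -> 'rV[R]_n) (D d : R).
Hypotheses (p_gt1 : 1 < p) (p_lt2 : p < 2) (D_ge1 : 1 <= D) (d_gt0 : 0 < d).
Hypothesis T_gt0 : (0 < #|T|)%N.
Hypothesis vD : forall u, dot (v u) (v u) <= D.
Hypothesis v_lower : forall c, dot c c <= 2 * avg (fun u => dot c (v u) ^+ 2).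

Local Notation U := (T * bool)%type.
Local Notation N := (#|{: T * bool}|%:R : R).

Let U_gt0 : (0 < #|{: U}|)%N.
Proof. by rewrite card_prod card_bool muln2 double_gt0. Qed.
Let D_gt0 : 0 < D. Proof. by apply: lt_le_trans D_ge1. Qed.

Definition energy (c : 'rV[R]_n) : R := avg (fun u => `|dot c (v u)| `^ p).

(** The initial value is the sup-norm bound of [sup_le_scale] for functions of energy at most 1. *)
Definition scale (j : nat) : R := (2 * D) `^ p^-1 / 2 ^+ j.

Definition close (r : R) (y g : 'rV[R]_n) : Prop :=
  forall u, `|dot y (v u) - dot g (v u)| <= r.

(** A fixed choice, so that it is a function of [r] and [y] alone and can be reproduced from a code.
    The slack [d] spares a compactness argument for the existence of a minimizer; the default 0 is
    never met for r >= 0, by [centerP]. *)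
Definition center (r : R) (y : 'rV[R]_n) : 'rV[R]_n :=
  xget 0 [set g | close r y g /\
                  forall g', close r y g' -> energy g <= energy g' + d].

(* A word encodes a chain of approximations.  In the state [(j, y, g)] the
   function is within [scale j] of [y], and [g] is being corrected towards the
   approximation at [scale j.+1]; the letter [None] passes to the next scale. *)
Definition chain_step (st : nat * 'rV[R]_n * 'rV[R]_n) (a : option (U * bool)) :=
  let: (j, y, g) := st in
  if a is Some b then (j, y, pstep v (scale j / 4 / D) g b)
  else (j.+1, g, center (2 * scale j.+1) g).

Definition run : seq (option (U * bool)) -> nat * 'rV[R]_n * 'rV[R]_n :=
  foldl chain_step (0%N, 0, center (2 * scale 0) 0).

Definition chain_incr (st : nat * 'rV[R]_n * 'rV[R]_n) (u : U) : R :=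
  let: (j, y, g) := st in
  cut p (scale j.+1) (dot g (v u)) - cut p (scale j) (dot y (v u)).

Lemma energy_ge0 c : 0 <= energy c.
Proof. by apply: avg_ge0 => u; exact: powR_ge0. Qed.

Lemma scale_gt0 j : 0 < scale j.
Proof. by rewrite divr_gt0 ?exprn_gt0// powR_gt0// mulr_gt0. Qed.

Lemma scaleS j : scale j.+1 = scale j / 2.
Proof. by rewrite /scale exprSr invfM mulrA. Qed.

Lemma centerP r y : 0 <= r -> close r y (center r y) /\
  forall g', close r y g' -> energy (center r y) <= energy g' + d.
Proof.
move=> r0.
apply: (@xgetPex _ 0 [set g | close r y g /\
                  forall g', close r y g' -> energy g <= energy g' + d]).
apply: (@near_min R _ (close r y : set _) energy d) => //.
  by exists y => u; rewrite subrr normr0.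
by move=> g _; exact: energy_ge0.
Qed.

Lemma scale_powS j : scale j.+1 `^ p <= 2^-1 * scale j `^ p.
Proof.
rewrite scaleS mulrC powRM ?invr_ge0 ?(ltW (scale_gt0 j))//.
rewrite ler_wpM2r ?powR_ge0//; apply: ge1r_powR; last exact: ltW.
by rewrite invr_gt0 ltr0n invf_le1// ler1n.
Qed.

Lemma scale_pow_le j : scale j `^ p <= 2 * D * 2^-1 ^+ j.
Proof.
elim: j => [|j IH].
  rewrite /scale expr0 divr1 mulr1 -powRrM mulVf ?powRr1//.
    by rewrite mulr_ge0// ltW.
  by rewrite gt_eqF//; apply: lt_trans p_gt1.
apply: (le_trans (scale_powS j)).
by rewrite exprS mulrCA ler_wpM2l.
Qed.

(** For the maximum M of |f| over the points, M^2 <= D |c|^2 <= 2 D avg f^2 <= 2 D M^(2-p) energy,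
    hence M^p <= 2 D. *)
Lemma sup_le_scale c u : energy c <= 1 -> `|dot c (v u)| <= scale 0.
Proof.
move=> ec.
have [u1 _ hu1] := @arg_maxP _ R U u predT (fun u => `|dot c (v u)|) isT.
apply: (le_trans (hu1 u isT)); set M := `|dot c (v u1)|.
have p0 : 0 < p by apply: lt_trans p_gt1.
have [M0|M0] := eqVneq M 0; first by rewrite M0 ltW// scale_gt0.
have Mp : 0 < M by rewrite lt_neqAle eq_sym M0 normr_ge0.
have h1 : M ^+ 2 <= D * dot c c.
  rewrite /M real_normK ?num_real//; apply: (le_trans (dot_CS _ _)).
  by rewrite mulrC ler_wpM2r// dot_ge0.
have h2 : avg (fun u => dot c (v u) ^+ 2) <= M `^ (2 - p) * energy c.
  rewrite -avgZ; apply: ler_avg => w; rewrite -real_normK ?num_real//.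
  by apply: sq_le_powR; rewrite ?(ltW p_lt2)// normr_ge0; exact: (hu1 w isT).
have Q0 : 0 < M `^ (2 - p) by exact: powR_gt0.
have h3 : M `^ (2 - p) * energy c <= M `^ (2 - p) by rewrite ler_piMr// ltW.
have h4 : M ^+ 2 <= 2 * D * M `^ (2 - p).
  apply: (le_trans h1); rewrite [2 * D]mulrC -mulrA ler_pM2l//.
  by apply: (le_trans (v_lower c)); rewrite ler_pM2l//; apply: le_trans h3.
have e : M ^+ 2 = M `^ p * M `^ (2 - p).
  by rewrite -powRD ?(gt_eqF Mp) ?implybT// addrC subrK powR_mulrn// ltW.
rewrite e ler_pM2r// in h4.
have -> : M = (M `^ p) `^ p^-1 by rewrite -powRrM divff ?gt_eqF// powRr1// ltW.
rewrite /scale expr0 divr1 ge0_ler_powR ?nnegrE ?invr_ge0 ?powR_ge0 ?(ltW p0)//.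
by rewrite mulr_ge0// ltW.
Qed.

Definition heavy c j : R := avg (fun u => wgt p (scale j) (dot c (v u))).

(** The budget of scale j for the squared distance between target and start. The target lives on the
    ball of radius 4 [scale j.+4] = [scale j] / 4 around c, so the energy difference telescopes with
    a shift of four scales. The slack 3 d comes from three uses of almost minimality. *)
Definition gain c j : R :=
  energy (center (4 * scale j.+4) c) - energy (center (4 * scale j) c) +
  3 * d + heavy c j.

(* The midpoint of the two centers lies in the ball around [y], so its energy is
   almost minimal and strong convexity bounds the distance of the centers. *)
Lemma dist_center_le c y j a z : close (scale j) c y ->
  a = center (4 * scale j.+4) c -> z = center (2 * scale j) y ->
  dot (a - z) (a - z) <= 256 / (p - 1) * scale j `^ (2 - p) * gain c j.
Proof.
move=> cy ea ez.
have t0 := scale_gt0 j; set t := scale j in t0 cy *.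
have e4 : 4 * scale j.+4 = t / 4 by rewrite !scaleS -/t; field.
have t40 : 0 <= 4 * scale j.+4 by rewrite mulr_ge0// ltW// scale_gt0.
have t20 : 0 <= 2 * t by rewrite mulr_ge0// ltW.
have t4 : 0 <= 4 * t by rewrite mulr_ge0// ltW.
have [ca _] := centerP c t40; rewrite -ea e4 in ca.
have [yz zmin] := centerP y t20; rewrite -ez in yz zmin.
have [_ bmin] := centerP c t4; rewrite -/t in bmin.
have cz : close (3 * t) c z.
  move=> u; have h1 := cy u; have h2 := yz u.
  rewrite [_ - _](_ : _ = (dot c (v u) - dot y (v u)) + (dot y (v u) - dot z (v u))).
    apply: (le_trans (ler_normD _ _)); lra.
  ring.
have c4z : close (4 * t) c z by move=> u; apply: (le_trans (cz u)); lra.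
have ym : close (2 * t) y (2^-1 *: (a + z)).
  move=> u; rewrite dotZl dotDl.
  have h1 := cy u; have h2 := yz u; have h3 := ca u.
  rewrite [_ - _](_ : _ = 2^-1 * ((dot y (v u) - dot z (v u)) +
    ((dot c (v u) - dot a (v u)) - (dot c (v u) - dot y (v u))))); last by field.
  rewrite normrM ger0_norm ?invr_ge0//.
  have := ler_normD (dot y (v u) - dot z (v u))
    ((dot c (v u) - dot a (v u)) - (dot c (v u) - dot y (v u))).
  have := ler_normB (dot c (v u) - dot a (v u)) (dot c (v u) - dot y (v u)).
  lra.
have hz := zmin _ ym.
have hb := bmin _ c4z.
pose K := 128 / (p - 1) * t `^ (2 - p).
have K0 : 0 <= K.
  by rewrite /K mulr_ge0 ?powR_ge0// divr_ge0// subr_ge0 ltW.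
have h1 : avg (fun u => dot (a - z) (v u) ^+ 2) <=
    K * (energy a + energy z - 2 * energy (2^-1 *: (a + z)) + heavy c j).
  rewrite /energy -mulNr -avgZ -!avgD -avgZ; apply: ler_avg => u.
  rewrite dotBl dotZl dotDl mulNr [2^-1 * _]mulrC.
  by apply: sqr_dev_le.
apply: (le_trans (v_lower _)).
have -> : 256 / (p - 1) * t `^ (2 - p) * gain c j = 2 * (K * gain c j).
  by rewrite /K; field; rewrite subr_eq0 gt_eqF.
rewrite ler_pM2l//; apply: (le_trans h1); rewrite ler_wpM2l//.
rewrite /gain lerD2r -ea -/t; lra.
Qed.

(** The target is within [scale j] / 4 of c, and the perceptron stops within [scale j] / 4 of the
    target; together this is [scale j.+1]. The target depends on c, but only the start and the
    corrections enter the code. The constant is 16 times the 256 of [dist_center_le]. *)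
Lemma chain_refine c y j : close (scale j) c y ->
  exists ws, (size ws)%:R * scale j `^ p <= 4096 / (p - 1) * D * gain c j /\
    close (scale j.+1) c
      (foldl (pstep v (scale j / 4 / D)) (center (2 * scale j) y) ws).
Proof.
move=> cy.
have t0 := scale_gt0 j.
have h := dist_center_le cy erefl erefl.
set a := center (4 * _) c in h.
set z := center (2 * scale j) y in h *.
have r0 : 0 < scale j / 4 by rewrite divr_gt0.
have [ws [h1 h2]] := perceptron a z D_gt0 r0 vD.
exists ws; split.
  have e : scale j ^+ 2 = scale j `^ (2 - p) * scale j `^ p.
    by rewrite -powRD ?(gt_eqF t0) ?implybT// subrK powR_mulrn// ltW.
  have Q0 : 0 < scale j `^ (2 - p) by exact: powR_gt0.
  have h3 := le_trans h1 (ler_wpM2l (ltW D_gt0) h).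
  rewrite -(ler_pM2l Q0) mulrCA -e.
  have -> : (size ws)%:R * scale j ^+ 2 = 16 * ((size ws)%:R * (scale j / 4) ^+ 2) by field.
  have -> : scale j `^ (2 - p) * (4096 / (p - 1) * D * gain c j) =
    16 * (D * (256 / (p - 1) * scale j `^ (2 - p) * gain c j)).
    by field; rewrite subr_eq0 gt_eqF.
  by rewrite ler_pM2l.
have t40 : 0 <= 4 * scale j.+4 by rewrite mulr_ge0// ltW// scale_gt0.
have e4 : 4 * scale j.+4 = scale j / 4 by rewrite !scaleS; field.
have [ca _] := centerP c t40; rewrite -/a e4 in ca.
move=> u; rewrite scaleS; set g := foldl _ _ _ in h2 *.
have := h2 u; have := ca u; rewrite dotBl.
have := ler_normD (dot c (v u) - dot a (v u)) (dot a (v u) - dot g (v u)).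
rewrite [_ + _](_ : _ = dot c (v u) - dot g (v u)); last by ring.
by lra.
Qed.

Lemma run_cat w ws j y g : run w = (j, y, g) ->
  run (w ++ map Some ws) = (j, y, foldl (pstep v (scale j / 4 / D)) g ws).
Proof.
rewrite /run foldl_cat => ->.
by elim: ws g => //= a ws IH g.
Qed.

Lemma run_next w j y g : run w = (j, y, g) ->
  run (rcons w None) = (j.+1, g, center (2 * scale j.+1) g).
Proof. by rewrite /run -cats1 foldl_cat => ->. Qed.

Lemma sum_heavy_le c J : energy c <= 1 ->
  \sum_(j < J) heavy c j <= 2 / (1 - 2 `^ (p - 2)).
Proof.
move=> ec; rewrite -avg_sum.
have h u := sum_wgt_le p_gt1 p_lt2 (dot c (v u)) J (scale_gt0 0).
have C0 : 0 <= 2 / (1 - 2 `^ (p - 2)).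
  rewrite divr_ge0// subr_ge0 -[X in _ <= X](powRr0 (2 : R)) ler_powR ?ler1n//.
  by rewrite subr_le0 ltW.
apply: (@le_trans _ _ (2 / (1 - 2 `^ (p - 2)) * energy c)); last by rewrite ler_piMr.
rewrite -avgZ; apply: ler_avg => u.
apply: le_trans (h u); rewrite le_eqVlt; apply/orP; left; apply/eqP.
by apply: eq_bigr => j _; rewrite /scale expr0 divr1.
Qed.

(** All center energies lie between 0 and energy c + d <= 2, so the telescoping sum with shift four
    is at most 8 whatever the number of scales. *)
Lemma sum_gain_le c J : energy c <= 1 -> d <= 1 ->
  \sum_(j < J) gain c j <= 8 + 3 * d * J%:R + 2 / (1 - 2 `^ (p - 2)).
Proof.
move=> ec d1; rewrite big_split/= big_split/=.
have h := sum_heavy_le J ec.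
rewrite sumr_const card_ord -[(3 * d) *+ _]mulr_natr.
pose b j := energy (center (4 * scale j) c).
have b2 j : b j <= 2.
  have t4 : 0 <= 4 * scale j by rewrite mulr_ge0// ltW// scale_gt0.
  have [_ m] := centerP c t4.
  have : close (4 * scale j) c c by move=> u; rewrite subrr normr0.
  by move=> /m; rewrite -/(b j); lra.
have b0 j : 0 <= b j by exact: energy_ge0.
suff : \sum_(j < J) (b j.+4 - b j) <= 8.
  by rewrite /b => h8; have := lerD (lerD h8 (lexx (3 * d * J%:R))) h.
exact: sum_shift4_le.
Qed.

End Chain.

Section Signed.
Variables (R : realType) (T : finType).
Implicit Types (s : {ffun T -> bool}) (F G : T * bool -> R).

(** The sign is + when s i is false, that is, when the point (i, false) is the one kept: this sum is
    the change caused by the selection, see [avg_select]. *)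
Definition signed s F : R :=
  \sum_i (-1) ^+ s i * (F (i, false) - F (i, true)).

Lemma sum_pair_bool F : \sum_u F u = \sum_i (F (i, false) + F (i, true)).
Proof.
rewrite (eq_bigr (fun u => F (u.1, u.2))); last by case.
rewrite -(pair_big predT predT (fun i b => F (i, b)))/=.
by apply: eq_bigr => i _; rewrite big_bool addrC.
Qed.

Lemma signedD s F G : signed s (fun u => F u + G u) = signed s F + signed s G.
Proof. by rewrite -big_split/=; apply: eq_bigr => i _; ring. Qed.

Lemma eq_signed s F G : F =1 G -> signed s F = signed s G.
Proof. by move=> FG; apply: eq_bigr => i _; rewrite !FG. Qed.

Lemma signed_le s F : `|signed s F| <= \sum_u `|F u|.
Proof.
rewrite sum_pair_bool; apply: (le_trans (ler_norm_sum _ _ _)).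
apply: ler_sum => i _; rewrite normrM normrX normrN1 expr1n mul1r.
exact: ler_normB.
Qed.

Lemma sum_diff_sqr_le F :
  \sum_i (F (i, false) - F (i, true)) ^+ 2 <= 2 * \sum_u F u ^+ 2.
Proof.
rewrite (sum_pair_bool (fun u => F u ^+ 2)) mulr_sumr; apply: ler_sum => i _.
have := sqr_ge0 (F (i, false) + F (i, true)).
by rewrite sqrrD sqrrB; lra.
Qed.

End Signed.

Lemma ler_norm_of_sqr (R : realType) (x y : R) : 0 <= y -> x ^+ 2 <= y ^+ 2 ->
  `|x| <= y.
Proof.
by move=> y0 h; rewrite -(ler_pXn2r (_ : (0 < 2)%N)) ?nnegrE// real_normK ?num_real.
Qed.

Section Process.
Variables (R : realType) (p : R) (n : nat) (T : finType).
Variables (v : T * bool -> 'rV[R]_n) (D d : R).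
Hypotheses (p_gt1 : 1 < p) (p_lt2 : p < 2) (D_ge1 : 1 <= D).
Hypothesis d_gt0 : 0 < d.
Hypothesis T_gt0 : (0 < #|T|)%N.
Hypothesis vD : forall u, dot (v u) (v u) <= D.
Hypothesis v_lower : forall c, dot c c <= 2 * avg (fun u => dot c (v u) ^+ 2).

Local Notation U := (T * bool)%type.
Local Notation N := (#|{: T * bool}|%:R : R).
Local Notation sc := (scale p D).
Local Notation rn := (run p v D d).
Variables C4 K1 : R.
Hypotheses (C4E : C4 = 4096 / (p - 1)) (K1E : K1 = 36 * (2 * 1089)).

Let U_gt0 : (0 < #|{: U}|)%N.
Proof. by rewrite card_prod card_bool muln2 double_gt0. Qed.
Let N_gt0 : 0 < N. Proof. by rewrite ltr0n. Qed.
Let D_gt0 : 0 < D. Proof. by apply: lt_le_trans D_ge1. Qed.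
Let C4_ge2 : 2 <= C4.
Proof.
have [p1 p2] := (p_gt1, p_lt2).
by rewrite C4E ler_pdivlMr; lra.
Qed.
Let CD0 : 0 < C4 * D.
Proof. by rewrite mulr_gt0//; apply: lt_le_trans C4_ge2. Qed.
Let K1_ge0 : 0 <= K1. Proof. by rewrite K1E -!natrM ler0n. Qed.

Variables (L beta : R) (s : {ffun T -> bool}) (B : nat).
Hypotheses (L_ge0 : 0 <= L) (beta_ge0 : 0 <= beta).
Hypothesis betaE : beta ^+ 2 = K1 * C4 * N * D * L.
Hypothesis s_good : forall w : seq (option (U * bool)), (size w <= B)%N ->
  signed s (chain_incr p v D (rn w)) ^+ 2 <=
  36 * ((size w).+1%:R * L) *
    \sum_i (chain_incr p v D (rn w) (i, false) - chain_incr p v D (rn w) (i, true)) ^+ 2.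

(** Code length and variance carry opposite powers of the scale: the length is at most C4 D e / t^p
    and the variance is of order t^p N [heavy]. Their product is free of t, and sqrt (e h) <= e + h
    leaves two quantities that can be summed over the scales. *)
Let incr_bound c w j y g e : rn w = (j, y, g) -> (size w <= B)%N ->
  close v (sc j) c y -> close v (sc j.+1) c g ->
  (size w).+1%:R * sc j `^ p <= C4 * D * e ->
  `|signed s (chain_incr p v D (rn w))| <= beta * (e + heavy p v D c j).
Proof.
move=> rw wB cy cg he.
have h0 : 0 <= heavy p v D c j by apply: avg_ge0 => u; exact: wgt_ge0.
have e0 : 0 <= e.
  rewrite -(pmulr_rge0 _ CD0); apply: le_trans he.
  by rewrite mulr_ge0// powR_ge0.
have h1 := s_good wB.
have h2 := sum_diff_sqr_le (chain_incr p v D (rn w)).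
have h3 : \sum_u chain_incr p v D (rn w) u ^+ 2 <=
    1089 * (sc j `^ p * (N * heavy p v D c j)).
  rewrite rw /heavy -sum_avg// !mulr_sumr; apply: ler_sum => u _ /=.
  rewrite scaleS; apply: cut_incr_le => //; [exact: scale_gt0|].
  by rewrite -scaleS; exact: cg.
have h4 : \sum_i (chain_incr p v D (rn w) (i, false) - chain_incr p v D (rn w) (i, true)) ^+ 2
    <= 2 * (1089 * (sc j `^ p * (N * heavy p v D c j))).
  by apply: (le_trans h2); rewrite ler_pM2l.
have a0 : 0 <= 36 * ((size w).+1%:R * L) by rewrite mulr_ge0 ?ler0n// mulr_ge0.
have h5 := le_trans h1 (ler_wpM2l a0 h4).
apply: ler_norm_of_sqr; first by rewrite mulr_ge0// addr_ge0.
apply: (le_trans h5).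
set h := heavy p v D c j in h0 *.
have b0 : 0 <= K1 * L * N * h by rewrite mulr_ge0// mulr_ge0// mulr_ge0.
have h6 := ler_wpM2l b0 he.
have -> : 36 * ((size w).+1%:R * L) * (2 * (1089 * (sc j `^ p * (N * h)))) =
  K1 * L * N * h * ((size w).+1%:R * sc j `^ p) by rewrite K1E; ring.
apply: (le_trans h6).
have -> : K1 * L * N * h * (C4 * D * e) = beta ^+ 2 * (e * h).
  by rewrite betaE; ring.
rewrite exprMn ler_wpM2l ?sqr_ge0//.
have := mulr_ge0 e0 e0; have := mulr_ge0 h0 h0; have := mulr_ge0 e0 h0.
rewrite expr2; lra.
Qed.

Variables (J : nat) (K : R) (c : 'rV[R]_n).
Hypothesis energy_c : energy p v c <= 1.
Hypothesis sumK : forall j, (j < J)%N ->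
  \sum_(i < j.+1) (2^-1 ^+ i + gain p v D d c i) <= K.
Hypothesis BK : C4 * D * (2 * K) <= B%:R * sc J `^ p.

Let scale_le i j : (i <= j)%N -> sc j <= sc i.
Proof.
move=> ij; rewrite ler_pM2l ?powR_gt0 ?mulr_gt0// lef_pV2 ?posrE ?exprn_gt0//.
by rewrite ler_weXn2l// ler1n.
Qed.

(** All codes met on the way have length at most B, so the union over words is finite. B does not
    enter the final estimate. *)
Let size_bound (w : seq (option (U * bool))) j E e : (j < J)%N -> 0 <= E ->
  (size w).+1%:R * sc j `^ p <= C4 * D * e ->
  E + e <= 2 * \sum_(i < j.+1) (2^-1 ^+ i + gain p v D d c i) ->
  (size w <= B)%N.
Proof.
move=> jJ E0 h1 h2.
have h3 : e <= 2 * K.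
  by have := sumK jJ; lra.
have h4 : (size w).+1%:R * sc J `^ p <= B%:R * sc J `^ p.
  apply: le_trans BK; apply: le_trans (_ : C4 * D * e <= _); last by rewrite ler_pM2l.
  apply: le_trans h1; rewrite ler_wpM2l// ge0_ler_powR ?nnegrE//.
  - by rewrite ltW// (lt_trans _ p_gt1).
  - by rewrite ltW// scale_gt0.
  - by rewrite ltW// scale_gt0.
  - by apply: scale_le; exact: ltnW.
rewrite ler_pM2r ?powR_gt0 ?scale_gt0// ler_nat in h4.
exact: ltnW.
Qed.

(** Here e is the code length so far in units of C4 D / t^p, and E is the sum of these costs over
    the scales passed. The potential E + e increases at each scale by just twice the new budget. *)
Let chain_bound j : (j < J)%N -> exists w y g E e,
  [/\ rn w = (j, y, g), close v (sc j) c y & close v (sc j.+1) c g] /\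
  [/\ (size w).+1%:R * sc j `^ p <= C4 * D * e, 0 <= E,
     E + e <= 2 * \sum_(i < j.+1) (2^-1 ^+ i + gain p v D d c i) &
     `|signed s (fun u => cut p (sc j.+1) (dot g (v u)))| <=
       beta * (E + \sum_(i < j.+1) heavy p v D c i)].
Proof.
have sizeD i : sc i `^ p <= C4 * D * 2^-1 ^+ i.
  apply: (le_trans (scale_pow_le p_gt1 D_ge1 i)).
  by rewrite ler_wpM2r ?exprn_ge0// ler_pM2r ?D_gt0 ?C4_ge2.
elim: j => [|j IH] jJ.
  have c0 : close v (sc 0) c 0.
    by move=> u; rewrite dot0l subr0; exact: sup_le_scale.
  have [ws [h1 h2]] := chain_refine p_gt1 p_lt2 D_ge1 d_gt0 vD v_lower c0; rewrite -C4E in h1.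
  set g := foldl _ _ _ in h2.
  have rw : rn (map Some ws) = (0%N, 0, g) by exact: (@run_cat _ _ _ _ _ _ _ [::]).
  (* The summand 1 pays for the successor in (size w).+1. *)
  pose e := 1 + gain p v D d c 0.
  have he : (size (map Some ws)).+1%:R * sc 0 `^ p <= C4 * D * e.
    rewrite size_map -natr1 mulrDl mul1r mulrDr mulr1.
    by have := sizeD 0%N; rewrite expr0 mulr1; lra.
  have e0 : 0 <= e.
    rewrite -(pmulr_rge0 _ CD0); apply: le_trans he.
    by rewrite mulr_ge0// powR_ge0.
  have hE : e + e <= 2 * \sum_(i < 1) (2^-1 ^+ i + gain p v D d c i).
    by rewrite big_ord1 expr0 -/e; lra.
  have wB := size_bound jJ e0 he hE.
  exists (map Some ws), 0, g, e, e; split; split => //.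
  rewrite big_ord1; apply: le_trans (incr_bound rw wB c0 h2 he).
  rewrite rw le_eqVlt; apply/orP; left; apply/eqP; congr (`|_|).
  by apply: eq_signed => u /=; rewrite dot0l [cut _ (sc 0) 0]cut0 ?subr0// ltW// scale_gt0.
have [w [y [g [E [e [[rw cy cg] [hs E0 hE hb]]]]]]] := IH (ltnW jJ).
have [ws [h1 h2]] := chain_refine p_gt1 p_lt2 D_ge1 d_gt0 vD v_lower cg; rewrite -C4E in h1.
set g' := foldl _ _ _ in h2.
have rw' : rn (rcons w None ++ map Some ws) = (j.+1, g, g').
  exact: run_cat (run_next rw).
set w' := _ ++ _ in rw'.
(* Since t^p at least halves from one scale to the next, so does the cost of the old letters. The
   term 2^-(j+1) pays for the letter [None], and the gain for the new corrections. *)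
pose e' := e / 2 + (2^-1 ^+ j.+1 + gain p v D d c j.+1).
have he' : (size w').+1%:R * sc j.+1 `^ p <= C4 * D * e'.
  rewrite /w' size_cat size_rcons size_map.
  have -> : ((size w).+1 + size ws).+1%:R = (size w).+1%:R + 1 + (size ws)%:R :> R.
    by rewrite -addSn natrD natr1.
  rewrite !mulrDl mul1r.
  have -> : C4 * D * e' = 2^-1 * (C4 * D * e) +
      (C4 * D * 2^-1 ^+ j.+1 + C4 * D * gain p v D d c j.+1) by rewrite /e'; ring.
  have k1 := sizeD j.+1.
  have k2 := ler_wpM2l (ler0n R (size w).+1) (scale_powS p_gt1 D_ge1 j).
  rewrite mulrCA in k2.
  move: hs h1 k1 k2.
  move: (C4 * D * e) (C4 * D * gain p v D d c j.+1) (C4 * D * 2^-1 ^+ j.+1).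
  move: ((size w).+1%:R * sc j `^ p) ((size ws)%:R * sc j.+1 `^ p).
  move: ((size w).+1%:R * sc j.+1 `^ p) => X; move: (sc j.+1 `^ p).
  by move=> *; lra.
have e'0 : 0 <= e'.
  rewrite -(pmulr_rge0 _ CD0); apply: le_trans he'.
  by rewrite mulr_ge0// powR_ge0.
have hE' : (E + e') + e' <= 2 * \sum_(i < j.+2) (2^-1 ^+ i + gain p v D d c i).
  by rewrite big_ord_recr/= mulrDr /e'; lra.
have E'0 : 0 <= E + e' by rewrite addr_ge0.
have wB := size_bound jJ E'0 he' hE'.
exists w', g, g', (E + e'), e'; split; split => //.
have hi := incr_bound rw' wB cg h2 he'.
rewrite big_ord_recr/=.
have -> : signed s (fun u => cut p (sc j.+2) (dot g' (v u))) =
   signed s (fun u => cut p (sc j.+1) (dot g (v u))) + signed s (chain_incr p v D (rn w')).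
  by rewrite -signedD; apply: eq_signed => u; rewrite rw' /= addrC subrK.
apply: (le_trans (ler_normD _ _)); apply: (le_trans (lerD hb hi)).
by rewrite -mulrDr; apply: ler_wpM2l => //; lra.
Qed.

(** |f|^p is replaced by its cut at the last scale. The remainder averages to at most 8 t (energy +
    4) <= 40 t. *)
Lemma process_bound : (0 < J)%N -> sc J <= 1 ->
  `|signed s (fun u => `|dot c (v u)| `^ p)| <=
  beta * (2 * K + 2 / (1 - 2 `^ (p - 2))) + 40 * N * sc J.
Proof.
case: J sumK BK chain_bound => // j hK _ hc _ sJ.
have [w [y [g [E [e [[rw cy cg] [hs E0 hE hb]]]]]]] := hc j (leqnn _).
have -> : signed s (fun u => `|dot c (v u)| `^ p) =
  signed s (fun u => cut p (sc j.+1) (dot g (v u))) +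
  signed s (fun u => `|dot c (v u)| `^ p - cut p (sc j.+1) (dot g (v u))).
  by rewrite -signedD; apply: eq_signed => u; rewrite addrC subrK.
apply: (le_trans (ler_normD _ _)); apply: lerD.
  apply: (le_trans hb); rewrite ler_wpM2l//.
    have e0 : 0 <= e.
    rewrite -(pmulr_rge0 _ CD0); apply: le_trans hs.
    by rewrite mulr_ge0// powR_ge0.
  have := hK j (leqnn _).
  have := sum_heavy_le p_gt1 p_lt2 D_ge1 j.+1 energy_c.
  lra.
apply: (le_trans (signed_le _ _)).
rewrite sum_avg// [40 * N]mulrC -mulrA ler_wpM2l ?(ltW N_gt0)//.
have s0 := scale_gt0 p D_ge1 j.+1.
apply: (@le_trans _ _ (avg (fun u => 8 * sc j.+1 * (`|dot c (v u)| `^ p + 4)))).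
  apply: ler_avg => u; rewrite distrC.
  have st : 0 < sc j.+1 <= 1 by rewrite s0.
  apply: (le_trans (cut_approx p_gt1 p_lt2 st (cg u))).
  rewrite ler_pM2l; last by rewrite mulr_gt0.
  have [x1|x1] := leP `|dot c (v u)| 1.
    by have := powR_ge0 `|dot c (v u)| p; lra.
  have := le1r_powR (ltW x1) (ltW p_gt1); lra.
rewrite avgZ avgD avg_cst// -/(energy p v c) mulrAC ler_pM2r//.
have := energy_c; lra.
Qed.

End Process.

Lemma expR_half_le2 (R : realType) : expR 2^-1 <= 2 :> R.
Proof.
have := expR_ge1Dx (- 2^-1 : R); rewrite expRN => h.
have h' : 2^-1 <= (expR 2^-1)^-1 :> R by lra.
by rewrite lef_pV2 ?posrE ?expR_gt0 in h'.
Qed.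

Lemma expR1_le4 (R : realType) : expR 1 <= 4 :> R.
Proof.
have := expR_half_le2 R.
have -> : expR 1 = expR 2^-1 * expR 2^-1 :> R by rewrite -expRD; congr expR; field.
by have := expR_ge0 (2^-1 : R); nra.
Qed.

Lemma sum_half_pow_le (R : realType) (m : nat) : \sum_(i < m) 2^-1 ^+ i <= 2 :> R.
Proof.
suff -> : \sum_(i < m) 2^-1 ^+ i = 2 - 2 * 2^-1 ^+ m :> R.
  by rewrite gerBl mulr_ge0// exprn_ge0.
elim: m => [|m IH]; first by rewrite big_ord0 expr0 mulr1 subrr.
by rewrite big_ord_recr/= IH exprS; field.
Qed.

(* Words of length [l] over [A] get weight [(2 * #|A|) ^- l.+1]. *)
Lemma sum_words_le1 (R : realType) (A : finType) (B : nat) : (0 < #|A|)%N ->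
  \sum_(w : {l : 'I_B & l.-tuple A})
    expR (- ((tag w).+1%:R * ln (2 * #|A|%:R))) <= 1 :> R.
Proof.
move=> A0.
have a0 : 0 < 2 * #|A|%:R :> R by rewrite mulr_gt0// ltr0n.
have -> : \sum_(w : {l : 'I_B & l.-tuple A})
    expR (- ((tag w).+1%:R * ln (2 * #|A|%:R))) =
    \sum_(l < B) \sum_(t : l.-tuple A) expR (- (l.+1%:R * ln (2 * #|A|%:R))) :> R.
  by rewrite (sig_big_dep xpredT (fun l : 'I_B => (xpredT : pred (l.-tuple A)))
    (fun (l : 'I_B) (_ : l.-tuple A) => expR (- (l.+1%:R * ln (2 * #|A|%:R))))).
apply: (@le_trans _ _ (\sum_(l < B) 2^-1 * 2^-1 ^+ l)).
  apply: ler_sum => l _.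
  rewrite sumr_const card_tuple -[expR _ *+ _]mulr_natl natrX.
  rewrite expRN expRM_natl lnK ?posrE// exprS exprMn.
  have b0 : (#|A|%:R : R) ^+ l != 0 by rewrite expf_neq0// pnatr_eq0 -lt0n.
  have b1 : 1 <= #|A|%:R :> R by rewrite ler1n.
  have b2 : (2 : R) ^+ l != 0 by rewrite expf_neq0.
  have b3 : (#|A|%:R : R) != 0 by rewrite gt_eqF// (lt_le_trans _ b1).
  rewrite [X in X <= _](_ : _ = #|A|%:R^-1 * (2^-1 * 2^-1 ^+ l)).
    by rewrite ler_piMl ?mulr_ge0 ?exprn_ge0// invf_le1// (lt_le_trans _ b1).
  rewrite exprVn; move: b0 b2 b3.
  move: (#|A|%:R : R) ((#|A|%:R : R) ^+ l) ((2 : R) ^+ l) => x y z *.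
  by field; repeat (apply/andP; split).
rewrite -mulr_sumr; have := sum_half_pow_le R B; lra.
Qed.

Lemma power_signs (R : realType) (p : R) : 1 < p -> p < 2 ->
  exists C : R, 0 < C /\
  forall (n : nat) (T : finType) (v : T * bool -> 'rV[R]_n) (D : R),
    1 <= D -> (0 < #|T|)%N -> (forall u, dot (v u) (v u) <= D) ->
    (forall c, dot c c <= 2 * avg (fun u => dot c (v u) ^+ 2)) ->
    exists G : {ffun T -> bool} -> R,
      [/\ forall s, 0 <= G s, \sum_s G s <= 2 ^+ #|T|
        & forall s, G s <= 4 -> forall c,
            `|signed s (fun u => `|dot c (v u)| `^ p)| <=
            C * Num.sqrt (#|{: T * bool}|%:R * D *
                   ln (2 * (2 * #|{: T * bool}|%:R + 1))) * energy p v c].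
Proof.
move=> p1 p2.
have [K1 K1E] : exists K1 : R, K1 = 36 * (2 * 1089) by exists (36 * (2 * 1089)).
have [C4 C4E] : exists C4 : R, C4 = 4096 / (p - 1) by exists (4096 / (p - 1)).
pose CW : R := 2 / (1 - 2 `^ (p - 2)).
have CW0 : 0 <= CW.
  rewrite divr_ge0// subr_ge0 -[X in _ <= X](powRr0 (2 : R)) ler_powR ?ler1n//.
  by rewrite subr_le0 ltW.
have K1_ge0 : 0 <= K1 by rewrite K1E -!natrM ler0n.
have C4_ge0 : 0 <= C4 by rewrite C4E divr_ge0 ?ler0n// subr_ge0 ltW.
(* 13 = 2 + 8 + 3: the powers of 1/2, the telescoped energies, and the slack 3 d J with d J = 1. *)
pose K := 13 + CW.
exists (Num.sqrt (K1 * C4) * (2 * K + CW) + 40); split.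
  rewrite ltr_pwDr ?ltr0n// mulr_ge0 ?sqrtr_ge0//.
  by rewrite addr_ge0// mulr_ge0// addr_ge0.
move=> n T v D D1 T0 vD vlow.
set N : R := #|{: T * bool}|%:R.
have N1 : 1 <= N by rewrite ler1n card_prod card_bool muln2 double_gt0.
pose L := ln (2 * (2 * N + 1)).
have L1 : 1 <= L.
  rewrite -ler_expR lnK ?posrE; last by lra.
  by apply: (le_trans (expR1_le4 R)); lra.
have D0 : 0 < D by lra.
have L0 : 0 <= L by lra.
have NDL1 : 1 <= N * D * L by rewrite -[1]mulr1 -{1}[1]mulr1 !ler_pM// mulr_ge0//; lra.
pose x := scale p D 0 * N.
(* So many scales that N [scale J] <= 1; the truncation error is then at most 40, which is below 40
   sqrt (N D L). *)
have [J [J0 xJ]] : exists J, (0 < J)%N /\ x <= 2 ^+ J.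
  exists (Num.trunc x).+1; split => //.
  apply: ltW; apply: (lt_le_trans (truncnS_gt x)).
  by rewrite -natrX ler_nat ltnW// ltn_expl.
have sJ : scale p D J * N <= 1.
  rewrite /scale mulrAC ler_pdivrMr ?exprn_gt0// mul1r.
  by move: xJ; rewrite /x /scale expr0 divr1.
have sJ1 : scale p D J <= 1.
  apply: le_trans sJ; rewrite ler_peMr// ltW//; exact: scale_gt0.
have [d [d0 d1 dJ]] : exists d : R, [/\ 0 < d, d <= 1 & d * J%:R = 1].
  exists J%:R^-1; split; [by rewrite invr_gt0 ltr0n|by rewrite invf_le1 ?ltr0n// ler1n|].
  by rewrite mulVf// pnatr_eq0 -lt0n.
have sp0 : 0 < scale p D J `^ p by rewrite powR_gt0// scale_gt0.
have [B BK] : exists B : nat, C4 * D * (2 * K) <= B%:R * scale p D J `^ p.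
  exists (Num.trunc (C4 * D * (2 * K) / scale p D J `^ p)).+1.
  by rewrite -ler_pdivrMr// ltW// truncnS_gt.
pose A := option (T * bool * bool).
have cA : #|{: A}|%:R = 2 * N + 1 :> R.
  by rewrite card_option -natr1 card_prod card_bool natrM mulrC.
pose W := {l : 'I_B.+1 & l.-tuple A}.
pose inc (w : seq A) i := chain_incr p v D (run p v D d w) (i, false) -
  chain_incr p v D (run p v D d w) (i, true).
have u1 (w : W) : 1 <= (tag w).+1%:R * L.
  have h : 1 <= (tag w).+1%:R :> R by rewrite ler1n.
  by apply: le_trans h _; rewrite ler_peMr.
have us : \sum_(w : W) expR (- ((tag w).+1%:R * L)) <= 1.
  have := @sum_words_le1 R A B.+1; rewrite cA; apply.
  by rewrite card_option.
have [G [G0 G1 G2]] := sign_union (fun w : W => inc (tagged w)) u1 us.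
exists G; split => // s /G2 hs c.
have s_good (w : seq A) : (size w <= B)%N -> signed s (chain_incr p v D (run p v D d w)) ^+ 2 <=
    36 * ((size w).+1%:R * L) * \sum_i inc w i ^+ 2.
  move=> wB.
  exact: (hs (Tagged (fun l : 'I_B.+1 => l.-tuple A)
     (in_tuple w : (Ordinal (wB : (size w < B.+1)%N)).-tuple A))).
pose beta := Num.sqrt (K1 * C4) * Num.sqrt (N * D * L).
have beta0 : 0 <= beta by rewrite mulr_ge0 ?sqrtr_ge0.
have betaE : beta ^+ 2 = K1 * C4 * N * D * L.
  have k0 : 0 <= K1 * C4 by rewrite mulr_ge0.
  have k1 : 0 <= N * D * L by apply: le_trans NDL1.
  by rewrite /beta exprMn (sqr_sqrtr k0) (sqr_sqrtr k1) !mulrA.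
have main c' : energy p v c' <= 1 -> `|signed s (fun u => `|dot c' (v u)| `^ p)| <=
    (Num.sqrt (K1 * C4) * (2 * K + CW) + 40) * Num.sqrt (N * D * L).
  move=> ec.
  have sumK j : (j < J)%N ->
      \sum_(i < j.+1) (2^-1 ^+ i + gain p v D d c' i) <= K.
    move=> jJ; rewrite big_split/=.
    have h1 := sum_half_pow_le R j.+1.
    have h2 := sum_gain_le p1 p2 D1 d0 j.+1 ec d1.
    have h3 : d * j.+1%:R <= 1.
      by rewrite -[X in _ <= X]dJ ler_pM2l// ler_nat.
    rewrite -/CW -mulrA in h2; apply: (le_trans (lerD h1 h2)).
    by rewrite /K; move: (d * _) h3 => ? ?; lra.
  have := process_bound p1 p2 D1 d0 T0 vD vlow C4E K1E L0 beta0 betaE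
    s_good ec sumK BK J0 sJ1.
  move=> /le_trans; apply.
  rewrite -/CW [X in _ <= X]mulrDl; apply: lerD; first by rewrite /beta mulrAC.
  rewrite -mulrA [_ * scale _ _ _]mulrC ler_pM2l ?ltr0n//.
  by apply: (le_trans sJ); rewrite -[X in X <= _]sqrtr1 ler_wsqrtr.
have [e0|e0] := eqVneq (energy p v c) 0.
  have z u : `|dot c (v u)| `^ p = 0.
    move/eqP: e0; rewrite /energy /avg mulf_eq0 invr_eq0 (gt_eqF (lt_le_trans ltr01 N1))/=.
    rewrite psumr_eq0; last by move=> *; exact: powR_ge0.
    by move=> /allP/(_ u); rewrite mem_index_enum => /(_ isT)/eqP.
  by rewrite e0 mulr0 /signed big1 ?normr0// => i _; rewrite !z subrr mulr0.
have ep : 0 < energy p v c by rewrite lt_neqAle eq_sym e0 energy_ge0.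
(* Both sides are homogeneous of degree p, so c may be scaled to energy 1. *)
pose r := energy p v c `^ (- p^-1).
have r0 : 0 <= r by exact: powR_ge0.
have rp : r `^ p = (energy p v c)^-1.
  rewrite /r -powRrM mulNr mulVf ?gt_eqF//; last exact: lt_trans p1.
  by rewrite powR_inv1// ltW.
have sc u : `|dot (r *: c) (v u)| `^ p = (energy p v c)^-1 * `|dot c (v u)| `^ p.
  by rewrite dotZl normrM (ger0_norm r0) powRM// rp.
have er : energy p v (r *: c) = 1.
  rewrite /energy (_ : (fun u => _) = fun u => (energy p v c)^-1 * `|dot c (v u)| `^ p).
    by rewrite avgZ -/(energy p v c) mulVf.
  by apply/funext.
have := main (r *: c); rewrite er lexx => /(_ isT).
have -> : signed s (fun u => `|dot (r *: c) (v u)| `^ p) =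
    (energy p v c)^-1 * signed s (fun u => `|dot c (v u)| `^ p).
  rewrite /signed mulr_sumr; apply: eq_bigr => i _; rewrite !sc.
  by rewrite -mulrBr mulrCA.
rewrite normrM ger0_norm ?invr_ge0 ?energy_ge0//.
by rewrite ler_pdivrMl// mulrC.
Qed.

(** * Halving *)

(** The cost of one letter of a code: for N points there are 2 N + 1 letters (a point and a sign, or
    [None]), and the further factor 2 makes the weights of all words summable. *)
Definition logN (R : realType) (N : nat) : R := ln (2 * (2 * N%:R + 1)).

Lemma logN_ge1 (R : realType) (N : nat) : (0 < N)%N -> 1 <= logN R N.
Proof.
move=> N0; have N1 : 1 <= N%:R :> R by rewrite ler1n.
rewrite -ler_expR lnK ?posrE; last by lra.
by apply: (le_trans (expR1_le4 R)); lra.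
Qed.

Lemma log2_le (R : realType) (N : nat) : (0 < N)%N ->
  (trunc_log 2 N)%:R <= 2 * logN R N :> R.
Proof.
move=> N0; have N1 : 1 <= N%:R :> R by rewrite ler1n.
have h2 : 2^-1 <= ln 2 :> R.
  by rewrite -ler_expR lnK ?posrE// expR_half_le2.
have h : (trunc_log 2 N)%:R * ln 2 <= ln N%:R :> R.
  rewrite mulr_natl -lnXn// ler_ln ?posrE ?exprn_gt0//; last by lra.
  by rewrite -natrX ler_nat trunc_logP.
have h3 : ln N%:R <= logN R N by rewrite ler_ln ?posrE; lra.
have : (trunc_log 2 N)%:R * 2^-1 <= (trunc_log 2 N)%:R * ln 2 :> R.
  by rewrite ler_wpM2l.
lra.
Qed.

Lemma avg_select (R : realType) (T : finType) (F : T * bool -> R)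
    (s : {ffun T -> bool}) : (0 < #|T|)%N ->
  avg (fun i => F (i, s i)) = avg F + #|{: T * bool}|%:R^-1 * signed s F.
Proof.
move=> T0.
have t0 : #|T|%:R != 0 :> R by rewrite pnatr_eq0 -lt0n.
rewrite /avg sum_pair_bool card_prod card_bool natrM -mulrDr /signed -big_split/=.
rewrite invfM -[RHS]mulrA [X in _ = _ * X]mulr_sumr; congr (_ * _); apply: eq_bigr => i _.
by case: (s i); rewrite ?expr0 ?expr1; field.
Qed.

(** One choice of signs serves both |f|^p, through [power_signs], and f^2, through [quad_signs]. In
    the latter the difference of two rank-one matrices of a pair is split, and each half is treated
    with the same signs. *)
Lemma halve (R : realType) (p : R) : 1 < p -> p < 2 ->
  exists C : R, 0 < C /\
  forall (n : nat) (T : finType) (v : T * bool -> 'rV[R]_n) (D : R),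
    1 <= D -> (0 < #|T|)%N -> (n <= #|{: T * bool}|)%N ->
    (forall u, dot (v u) (v u) <= D) ->
    (forall c, dot c c <= 2 * avg (fun u => dot c (v u) ^+ 2)) ->
    (forall c, avg (fun u => dot c (v u) ^+ 2) <= 2 * dot c c) ->
    exists s : {ffun T -> bool}, forall c,
      let e := C * Num.sqrt (D * logN R #|{: T * bool}| / #|{: T * bool}|%:R) in
      `|avg (fun i => `|dot c (v (i, s i))| `^ p) - avg (fun u => `|dot c (v u)| `^ p)|
        <= e * avg (fun u => `|dot c (v u)| `^ p) /\
      `|avg (fun i => dot c (v (i, s i)) ^+ 2) - avg (fun u => dot c (v u) ^+ 2)|
        <= e * avg (fun u => dot c (v u) ^+ 2).
Proof.
move=> p1 p2; have [C [C0 hC]] := power_signs p1 p2.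
exists (C + 48); split; first by rewrite addr_gt0.
move=> n T v D D1 T0 nN vD vlow vup.
have [Gp [Gp0 Gp1 Gp2]] := hC n T v D D1 T0 vD vlow.
set Nn := #|{: T * bool}| in nN Gp2 *.
have Nn0 : (0 < Nn)%N by rewrite /Nn card_prod card_bool muln2 double_gt0.
have N0 : 0 < Nn%:R :> R by rewrite ltr0n.
have D0 : 0 < D by lra.
have L1 := logN_ge1 R Nn0; set L := logN R Nn in L1 *.
rewrite -/(logN R Nn) -/L in Gp2.
(* The moment exponent is logarithmic in the number of points, which bounds the dimension n. *)
pose K := (trunc_log 2 Nn).+2.
have nK : (4 * n.+1 <= 4 ^ K)%N.
  rewrite /K expnS leq_pmul2l//.
  apply: (@leq_trans (2 ^ (trunc_log 2 Nn).+1)); last by rewrite leq_exp2r.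
  by apply: (@leq_ltn_trans Nn) => //; exact: trunc_log_ltn.
have KL : K%:R <= 4 * L.
  have := log2_le R Nn0; rewrite -/L /K; move: (trunc_log 2 Nn) => k ?.
  by rewrite -!natr1; lra.
have A0 : 0 < 2 * Nn%:R :> R by rewrite mulr_gt0.
have vA b c : \sum_i dot c (v (i, b)) ^+ 2 <= 2 * Nn%:R * dot c c.
  have h := vup c.
  apply: (@le_trans _ _ (\sum_u dot c (v u) ^+ 2)).
    rewrite (sum_pair_bool (fun u => dot c (v u) ^+ 2)); apply: ler_sum => i _.
    by case: b; rewrite ?lerDl ?lerDr sqr_ge0.
  by rewrite sum_avg// [2 * _]mulrC -mulrA ler_pM2l.
have [G0 [G00 G01 G02]] := quad_signs (v := fun i => v (i, false)) D0 A0
  (fun i => vD _) (vA false) (ltn0Sn _) nK.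
have [G1 [G10 G11 G12]] := quad_signs (v := fun i => v (i, true)) D0 A0
  (fun i => vD _) (vA true) (ltn0Sn _) nK.
(* The three certificates have total mean at most 3, hence their sum is at most 4 somewhere; being
   nonnegative, each is then at most 4. *)
have [s hs] : exists s, Gp s + G0 s + G1 s <= 4.
  apply/not_existsP => h.
  have : \sum_(s : {ffun T -> bool}) 4 <= \sum_s (Gp s + G0 s + G1 s).
    by apply: ler_sum => s _; rewrite leNgt; apply/negP => /ltW; exact: h.
  have -> : \sum_s (Gp s + G0 s + G1 s) = \sum_s Gp s + \sum_s G0 s + \sum_s G1 s.
    by rewrite !big_split.
  rewrite sumr_const card_ffun card_bool -[(4 : R) *+ _]mulr_natl natrX.
  have : 0 < 2 ^+ #|T| :> R by rewrite exprn_gt0.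
  lra.
have hsp : Gp s <= 4 by have := G00 s; have := G10 s; lra.
have hs0 : G0 s <= 4 by have := Gp0 s; have := G10 s; lra.
have hs1 : G1 s <= 4 by have := Gp0 s; have := G00 s; lra.
exists s => c /=.
have sqE : Nn%:R^-1 * Num.sqrt (Nn%:R * D * L) = Num.sqrt (D * L / Nn%:R).
  have nn : Nn%:R^-1 = Num.sqrt (Nn%:R^-1 ^+ 2) :> R by rewrite sqrtr_sqr ger0_norm.
  rewrite {1}nn -sqrtrM ?sqr_ge0//.
  by congr Num.sqrt; field; rewrite gt_eqF.
have sq0 : 0 <= Num.sqrt (D * L / Nn%:R) by exact: sqrtr_ge0.
have sel (F : T * bool -> R) :
    `|avg (fun i => F (i, s i)) - avg F| = Nn%:R^-1 * `|signed s F|.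
  by rewrite avg_select// addrAC subrr add0r normrM ger0_norm// invr_ge0.
split.
  rewrite (sel (fun u => `|dot c (v u)| `^ p)).
  have h := Gp2 s hsp c.
  apply: (le_trans (ler_wpM2l _ h)); first by rewrite invr_ge0.
  rewrite [_^-1 * _]mulrA [_^-1 * (C * _)]mulrCA sqE.
  apply: ler_wpM2r; first exact: energy_ge0.
  by apply: ler_wpM2r => //; rewrite lerDl.
rewrite (sel (fun u => dot c (v u) ^+ 2)).
have L0 : 0 <= L by apply: le_trans L1.
have NDL0 : 0 <= Nn%:R * D * L by rewrite mulr_ge0// mulr_ge0// ltW.
have bnd x : x ^+ 2 <= 16 * K%:R * D * (2 * Nn%:R) * dot c c ^+ 2 ->
    `|x| <= 12 * Num.sqrt (Nn%:R * D * L) * dot c c.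
  move=> hx; apply: ler_norm_of_sqr.
    by rewrite mulr_ge0 ?dot_ge0// mulr_ge0 ?sqrtr_ge0.
  apply: (le_trans hx); rewrite !exprMn sqr_sqrtr//.
  rewrite ler_wpM2r ?sqr_ge0//.
  have h : D * Nn%:R * K%:R <= D * Nn%:R * (4 * L) by rewrite ler_wpM2l// mulr_ge0// ltW.
  have h' : 0 <= D * Nn%:R * L by rewrite mulr_ge0// mulr_ge0// ltW.
  lra.
have b0 := bnd _ (G02 s hs0 c).
have b1 := bnd _ (G12 s hs1 c).
have e : signed s (fun u => dot c (v u) ^+ 2) =
  \sum_i (-1) ^+ s i * dot c (v (i, false)) ^+ 2 -
  \sum_i (-1) ^+ s i * dot c (v (i, true)) ^+ 2.
  by rewrite /signed -sumrB; apply: eq_bigr => i _; rewrite mulrBr.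
have b2 : `|signed s (fun u => dot c (v u) ^+ 2)| <=
    48 * Num.sqrt (Nn%:R * D * L) * avg (fun u => dot c (v u) ^+ 2).
  rewrite e; apply: (le_trans (ler_normB _ _)); apply: (le_trans (lerD b0 b1)).
  have := ler_wpM2l (sqrtr_ge0 (Nn%:R * D * L)) (vlow c); lra.
apply: (le_trans (ler_wpM2l _ b2)); first by rewrite invr_ge0.
rewrite [_^-1 * _]mulrA [_^-1 * (48 * _)]mulrCA sqE.
apply: ler_wpM2r; first by apply: avg_ge0 => u; exact: sqr_ge0.
by apply: ler_wpM2r => //; rewrite lerDr ltW.
Qed.

(** A product with [bool] at every level, so that a halving is literally a map from [dbl m J] to
    [bool]. *)
Fixpoint dbl (m J : nat) : finType :=
  if J is J'.+1 then (dbl m J' * bool)%type : finType else 'I_m : finType.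

Lemma card_dbl m J : #|dbl m J| = (m * 2 ^ J)%N.
Proof.
elim: J => [|J IH] /=; first by rewrite card_ord expn0 muln1.
by rewrite card_prod card_bool IH expnS mulnCA mulnC.
Qed.

Lemma near_step (R : realType) (a d x y q : R) : 0 <= a <= 1 -> 0 <= d -> 0 <= q ->
  `|y - q| <= a * q -> `|x - y| <= d * y -> `|x - q| <= (a + 2 * d) * q.
Proof.
move=> /andP[a0 a1] d0 q0 h1 h2.
have -> : x - q = (x - y) + (y - q) by ring.
apply: (le_trans (ler_normD _ _)); apply: (le_trans (lerD h2 h1)).
have hy : y <= 2 * q.
  have := ler_norm (y - q); have : a * q <= 1 * q by rewrite ler_wpM2r.
  lra.
have := ler_wpM2l d0 hy; lra.
Qed.

Definition halving_error (R : realType) (D : R) (N : nat) : R :=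
  Num.sqrt (D * logN R N / N%:R).

(** The errors are measured against the fixed reference Q and [dot c c], not against the previous
    stage. As their total stays below 1/2, every stage satisfies the two-sided frame bounds with
    constant 2 that [halve] requires. *)
Lemma iter_halve (R : realType) (p : R) : 1 < p -> p < 2 ->
  exists C : R, 0 < C /\
  forall (n m J : nat) (v : dbl m J -> 'rV[R]_n) (D a : R) (Q : 'rV[R]_n -> R),
    1 <= D -> (0 < m)%N -> (n <= m)%N -> (forall u, dot (v u) (v u) <= D) ->
    (forall c, 0 <= Q c) -> 0 <= a ->
    a + \sum_(k < J) 2 * (C * halving_error D (m * 2 ^ k.+1)) <= 2^-1 ->
    (forall c, `|avg (fun u => `|dot c (v u)| `^ p) - Q c| <= a * Q c) ->
    (forall c, `|avg (fun u => dot c (v u) ^+ 2) - dot c c| <= a * dot c c) ->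
    exists sel : 'I_m -> dbl m J, forall c,
      let b := a + \sum_(k < J) 2 * (C * halving_error D (m * 2 ^ k.+1)) in
      `|avg (fun i => `|dot c (v (sel i))| `^ p) - Q c| <= b * Q c /\
      `|avg (fun i => dot c (v (sel i)) ^+ 2) - dot c c| <= b * dot c c.
Proof.
move=> p1 p2; have [C [C0 hC]] := halve p1 p2.
exists C; split => // n m J v D a Q D1 m0 nm vD Q0.
have e0 k : 0 <= C * halving_error D (m * 2 ^ k) by rewrite mulr_ge0 ?sqrtr_ge0// ltW.
elim: J v a vD => [|J IH] v a vD a0 ha hp h2.
  exists id => c /=; rewrite big_ord0 addr0; split; [exact: hp|exact: h2].
rewrite big_ord_recr/= in ha.
set d := C * halving_error D (m * 2 ^ J.+1) in ha.
have S0 : 0 <= \sum_(k < J) 2 * (C * halving_error D (m * 2 ^ k.+1)).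
  by apply: sumr_ge0 => k _; rewrite mulr_ge0.
have d0 : 0 <= d by exact: e0.
have a2 : a <= 2^-1 by lra.
have T0 : (0 < #|dbl m J|)%N by rewrite card_dbl muln_gt0 m0 expn_gt0.
have cU : #|{: dbl m J * bool}| = (m * 2 ^ J.+1)%N.
  by rewrite -[RHS]card_dbl.
have nU : (n <= #|{: dbl m J * bool}|)%N.
  by rewrite cU; apply: (leq_trans nm); rewrite leq_pmulr// expn_gt0.
have vlow c : dot c c <= 2 * avg (fun u => dot c (v u) ^+ 2).
  have := h2 c; have := dot_ge0 c; rewrite ler_norml => h3 /andP[h4 _].
  have : a * dot c c <= 2^-1 * dot c c by rewrite ler_wpM2r.
  lra.
have vup c : avg (fun u => dot c (v u) ^+ 2) <= 2 * dot c c.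
  have := h2 c; have := dot_ge0 c; rewrite ler_norml => h3 /andP[_ h4].
  have : a * dot c c <= 2^-1 * dot c c by rewrite ler_wpM2r.
  lra.
have [s hs] := hC n (dbl m J) v D D1 T0 nU vD vlow vup.
rewrite cU -/(halving_error D _) -/d in hs.
have a01 : 0 <= a <= 1 by rewrite a0; lra.
have [| | |c|c|sel hsel] := IH (fun i => v (i, s i)) (a + 2 * d).
- by move=> u; exact: vD.
- by rewrite addr_ge0// mulr_ge0.
- by lra.
- by apply: near_step (hp c) (proj1 (hs c)) => //; exact: Q0.
- by apply: near_step (h2 c) (proj2 (hs c)) => //; exact: dot_ge0.
exists (fun i => (sel i, s (sel i))) => c /=.
rewrite big_ord_recr/= -/d [_ + 2 * d]addrC addrA.
exact: hsel.
Qed.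

(** The logarithm grows at most by k + 1 <= 8 (9/8)^k against the gain 2^k; then (9/8)/2 = (3/4)^2
    and 8 <= 3^2. *)
Lemma halving_error_le (R : realType) (D : R) (m k : nat) : 1 <= D -> (0 < m)%N ->
  halving_error D (m * 2 ^ k) <= 3 * (3 / 4) ^+ k * halving_error D m.
Proof.
move=> D1 m0; have D0 : 0 < D by lra.
have m1 : 1 <= m%:R :> R by rewrite ler1n.
have L1 := logN_ge1 R m0.
have k2 : 1 <= 2 ^+ k :> R by rewrite exprn_ege1// ler1n.
have hL : logN R (m * 2 ^ k) <= k.+1%:R * logN R m.
  apply: (@le_trans _ _ (logN R m + k%:R * 1)).
    apply: (@le_trans _ _ (logN R m + k%:R * ln 2)); last first.
      rewrite lerD2l ler_wpM2l//.
      by have := @le_ln1Dx R 1; rewrite -natr1 => -> //; lra.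
    have q1 : 0 < 2 * (2 * m%:R + 1) :> R by lra.
    have q2 : 0 < 2 * (2 * (m * 2 ^ k)%:R + 1) :> R.
      by rewrite mulr_gt0// ltr_wpDl// mulr_ge0.
    have q3 : 0 < 2 ^+ k :> R by rewrite exprn_gt0.
    rewrite mulr_natl -lnXn// /logN -lnM ?posrE// ler_ln ?posrE ?mulr_gt0//.
    by rewrite natrM natrX; nra.
  by rewrite -natr1 mulrDl mul1r addrC lerD2r ler_wpM2l.
have hk : k.+1%:R <= 8 * (9 / 8) ^+ k :> R.
  elim: k {k2 hL} => [|k IH]; first by rewrite expr0 mulr1; lra.
  have h1 : 1 <= (9 / 8) ^+ k :> R by rewrite exprn_ege1//; lra.
  by rewrite -natr1 exprS; lra.
rewrite /halving_error.
have -> : 3 * (3 / 4) ^+ k = Num.sqrt (9 * (9 / 16) ^+ k) :> R.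
  have -> : 9 * (9 / 16) ^+ k = (3 * (3 / 4) ^+ k) ^+ 2 :> R.
    rewrite [RHS]exprMn -[in RHS]exprM [(k * 2)%N]mulnC [in RHS]exprM.
    have -> : (3 / 4) ^+ 2 = 9 / 16 :> R by field.
    by congr (_ * _); ring.
  by rewrite sqrtr_sqr ger0_norm// mulr_ge0// exprn_ge0// divr_ge0.
rewrite -sqrtrM; last by rewrite mulr_ge0// exprn_ge0// divr_ge0.
apply: ler_wsqrtr.
rewrite natrM natrX invfM.
have Dm : 0 <= D / m%:R by rewrite divr_ge0// ltW.
have i0 : 0 < (2 ^+ k)^-1 :> R by rewrite invr_gt0; lra.
have -> : D * logN R (m * 2 ^ k) * (m%:R^-1 * (2 ^+ k)^-1) =
  D / m%:R * (2 ^+ k)^-1 * logN R (m * 2 ^ k) by ring.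
apply: (@le_trans _ _ (D / m%:R * (2 ^+ k)^-1 * (8 * (9 / 8) ^+ k * logN R m))).
  apply: ler_wpM2l; first by apply: mulr_ge0 => //; exact: ltW.
  by apply: (le_trans hL); rewrite ler_wpM2r//; lra.
have -> : (9 / 16) ^+ k = (9 / 8) ^+ k * (2 ^+ k)^-1 :> R.
  by rewrite -exprVn -exprMn; congr (_ ^+ _); field.
have X0 : 0 <= D / m%:R * (2 ^+ k)^-1 * ((9 / 8) ^+ k * logN R m).
  by rewrite mulr_ge0 ?mulr_ge0 ?exprn_ge0 ?divr_ge0//; lra.
lra.
Qed.

(** The factor 18 is 2 from [near_step], 3 from [halving_error_le], and 3 for the sum of the powers
    of 3/4. *)
Lemma halving (R : realType) (p : R) : 1 < p -> p < 2 ->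
  exists C : R, 0 < C /\
  forall (n m J : nat) (v : dbl m J -> 'rV[R]_n) (D a b : R) (Q : 'rV[R]_n -> R),
    1 <= D -> (0 < m)%N -> (n <= m)%N -> (forall u, dot (v u) (v u) <= D) ->
    (forall c, 0 <= Q c) -> 0 <= a ->
    a + C * halving_error D m <= b -> b <= 2^-1 ->
    (forall c, `|avg (fun u => `|dot c (v u)| `^ p) - Q c| <= a * Q c) ->
    (forall c, `|avg (fun u => dot c (v u) ^+ 2) - dot c c| <= a * dot c c) ->
    exists sel : 'I_m -> dbl m J, forall c,
      `|avg (fun i => `|dot c (v (sel i))| `^ p) - Q c| <= b * Q c /\
      `|avg (fun i => dot c (v (sel i)) ^+ 2) - dot c c| <= b * dot c c.
Proof.
move=> p1 p2; have [C [C0 hC]] := iter_halve p1 p2.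
exists (18 * C); split; first by rewrite mulr_gt0.
move=> n m J v D a b Q D1 m0 nm vD Q0 a0 hab b2 hp h2.
have S : \sum_(k < J) 2 * (C * halving_error D (m * 2 ^ k.+1)) <=
    18 * C * halving_error D m.
  have h3 : \sum_(k < J) (3 / 4 : R) ^+ k.+1 <= 3.
    suff -> : \sum_(k < J) (3 / 4 : R) ^+ k.+1 = 3 - 3 * (3 / 4) ^+ J.
      by rewrite gerBl mulr_ge0// exprn_ge0// divr_ge0.
    elim: J {v vD hp h2} => [|J IH]; first by rewrite big_ord0 expr0; ring.
    by rewrite big_ord_recr/= IH exprS; field.
  apply: (@le_trans _ _ (6 * C * halving_error D m * \sum_(k < J) (3 / 4 : R) ^+ k.+1)).
    rewrite mulr_sumr; apply: ler_sum => k _.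
    have := ler_wpM2l (ltW C0) (halving_error_le k.+1 D1 m0).
    lra.
  have := ler_wpM2l (mulr_ge0 (ltW C0) (sqrtr_ge0 _) : 0 <= C * halving_error D m) h3.
  lra.
have [|sel hsel] := hC n m J v D a Q D1 m0 nm vD Q0 a0 _ hp h2; first by lra.
exists sel => c; have [h4 h5] := hsel c; split.
  by apply: (le_trans h4); apply: ler_wpM2r => //; lra.
by apply: (le_trans h5); apply: ler_wpM2r; [exact: dot_ge0|lra].
Qed.

(** * Reduction to finitely many points *)

Section BoundedMeasurable.
Variables (R : realType) (dsp : measure_display) (S : measurableType dsp).
Variable P : probability S R.
Implicit Types f g : S -> R.

Definition bmeas f : Prop :=
  measurable_fun [set: S] f /\ exists M : R, forall x, `|f x| <= M.

Definition mean f : R := \int[P]_x f x.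

Lemma bmeas_integrable f : bmeas f -> P.-integrable [set: S] (EFin \o f).
Proof.
move=> [mf [M hM]]; apply: measurable_bounded_integrable => //.
  exact: le_lt_trans (probability_le1 P measurableT) (ltry _).
exists M; split; first exact: num_real.
by move=> N MN x _ /=; apply: (le_trans (hM x)); exact: ltW.
Qed.

Lemma bmeasD f g : bmeas f -> bmeas g -> bmeas (fun x => f x + g x).
Proof.
move=> [mf [M hM]] [mg [M' hM']]; split; first exact: measurable_funD.
by exists (M + M') => x; apply: (le_trans (ler_normD _ _)); exact: lerD.
Qed.

Lemma bmeasM f g : bmeas f -> bmeas g -> bmeas (fun x => f x * g x).
Proof.
move=> [mf [M hM]] [mg [M' hM']]; split; first exact: measurable_funM.
by exists (M * M') => x; rewrite normrM; exact: ler_pM.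
Qed.

Lemma bmeas_cst a : bmeas (fun=> a).
Proof. by split; [exact: measurable_cst|exists `|a|]. Qed.

Lemma bmeasZ a f : bmeas f -> bmeas (fun x => a * f x).
Proof. exact/bmeasM/bmeas_cst. Qed.

Lemma bmeas_sum (I : finType) (f : I -> S -> R) :
  (forall i, bmeas (f i)) -> bmeas (fun x => \sum_i f i x).
Proof.
move=> hf; split; first by apply: measurable_sum => i; exact: (hf i).1.
have hM i : exists M, forall x, `|f i x| <= M by exact: (hf i).2.
pose M i := projT1 (cid (hM i)).
exists (\sum_i M i) => x; apply: (le_trans (ler_norm_sum _ _ _)).
by apply: ler_sum => i _; exact: (projT2 (cid (hM i))).
Qed.

Lemma bmeas_powR (q : R) f : 0 <= q -> bmeas f -> bmeas (fun x => `|f x| `^ q).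
Proof.
move=> q0 [mf [M hM]]; split.
  apply: (measurableT_comp (measurable_powR q)).
  exact: measurableT_comp.
exists (M `^ q) => x; rewrite ger0_norm ?powR_ge0//.
by rewrite ge0_ler_powR// nnegrE//; exact: le_trans (hM x).
Qed.

Lemma meanD f g : bmeas f -> bmeas g ->
  mean (fun x => f x + g x) = mean f + mean g.
Proof. by move=> hf hg; apply: RintegralD => //; exact: bmeas_integrable. Qed.

Lemma meanZ a f : bmeas f -> mean (fun x => a * f x) = a * mean f.
Proof. by move=> hf; apply: RintegralZl => //; exact: bmeas_integrable. Qed.

Lemma mean_cst a : mean (fun=> a) = a.
Proof.
have P1 : P [set: S] = 1%E by exact: probability_setT.
by rewrite /mean Rintegral_cst//= P1 mulr1.
Qed.

Lemma eq_mean f g : f =1 g -> mean f = mean g.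
Proof. by move=> fg; apply: eq_Rintegral => x _; exact: fg. Qed.

Lemma mean_sum (I : finType) (f : I -> S -> R) : (forall i, bmeas (f i)) ->
  mean (fun x => \sum_i f i x) = \sum_i mean (f i).
Proof.
move=> hf; elim: (index_enum I) => [|i s IH].
  by rewrite big_nil (eq_mean (g := fun=> 0)) ?mean_cst// => x; rewrite big_nil.
rewrite big_cons -IH -meanD//; first by apply: eq_mean => x; rewrite big_cons.
split; first by apply: measurable_sum => j; exact: (hf j).1.
elim: s {IH} => [|j s [M hM]]; first by exists 0 => x; rewrite big_nil normr0.
have [M' hM'] := (hf j).2; exists (M' + M) => x; rewrite big_cons.
by apply: (le_trans (ler_normD _ _)); exact: lerD.
Qed.

Lemma ler_mean f g : bmeas f -> bmeas g -> (forall x, f x <= g x) -> mean f <= mean g.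
Proof.
by move=> hf hg fg; apply: le_Rintegral => //; exact: bmeas_integrable.
Qed.

Lemma mean_ge0 f : (forall x, 0 <= f x) -> 0 <= mean f.
Proof. by move=> f0; exact: Rintegral_ge0. Qed.

Lemma mean_close e f g : bmeas f -> bmeas g -> (forall x, `|f x - g x| <= e) ->
  `|mean f - mean g| <= e.
Proof.
move=> hf hg fg.
have h1 : mean f <= mean g + e.
  rewrite -[X in _ + X](mean_cst e) -meanD//; last exact: bmeas_cst.
  apply: ler_mean => //; first by apply: bmeasD => //; exact: bmeas_cst.
  by move=> x; have := fg x; rewrite ler_norml; lra.
have h2 : mean g <= mean f + e.
  rewrite -[X in _ + X](mean_cst e) -meanD//; last exact: bmeas_cst.
  apply: ler_mean => //; first by apply: bmeasD => //; exact: bmeas_cst.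
  by move=> x; have := fg x; rewrite ler_norml; lra.
by rewrite ler_norml; lra.
Qed.

Lemma bmeas_bool (b : S -> bool) : measurable_fun [set: S] b -> bmeas (fun x => (b x)%:R).
Proof.
move=> mb; split; last by exists 1 => x; case: (b x); rewrite ?normr1 ?normr0.
rewrite (_ : (fun x => (b x)%:R) = \1_(b @^-1` [set true]) :> (S -> R)).
  by apply: measurable_indic; rewrite -[X in measurable X]setTI; exact: mb.
apply/funext => x; rewrite indicE; case E: (b x); first by rewrite mem_set.
by rewrite memNset//= E.
Qed.

End BoundedMeasurable.

(* Largest-remainder rounding of the weights [w] to fibre sizes of [a]. *)
Lemma weights_rounding (R : realType) (G U : finType) (w : G -> R) :
  (0 < #|U|)%N -> (forall g, 0 <= w g) -> \sum_g w g = 1 ->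
  exists a : U -> G, forall (F : G -> R) (M : R), (forall g, 0 <= F g <= M) ->
    `|avg (fun u => F (a u)) - \sum_g w g * F g| <= #|G|%:R / #|U|%:R * M.
Proof.
move=> U0 w0 w1.
have N0 : 0 < #|U|%:R :> R by rewrite ltr0n.
have [g0] : exists g0 : G, True.
  case: (pickP (fun _ : G => true)) => [g _|h]; first by exists g.
  by move: w1; rewrite big_pred0// => /eqP; rewrite eq_sym oner_eq0.
move=> _.
pose k g := Num.trunc (#|U|%:R * w g).
have kle g : (k g)%:R <= #|U|%:R * w g.
  by rewrite truncn_le// mulr_ge0.
have kgt g : #|U|%:R * w g <= (k g)%:R + 1.
  by rewrite natr1 ltW// truncnS_gt.
pose s := flatten [seq nseq (k g) g | g <- enum G].
have sums (F : G -> R) : \sum_(x <- s) F x = \sum_g (k g)%:R * F g.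
  rewrite big_flatten/= big_map big_enum; apply: eq_bigr => g _.
  by rewrite big_nseq iter_addr_0 mulr_natl.
have szs : (size s)%:R = \sum_g (k g)%:R :> R.
  have := sums (fun=> 1); rewrite big_const_seq iter_addr_0 count_predT => ->.
  by apply: eq_bigr => g _; rewrite mulr1.
have sumw : \sum_g #|U|%:R * w g = #|U|%:R by rewrite -mulr_sumr w1 mulr1.
have szle : (size s <= #|U|)%N.
  by rewrite -(ler_nat R) szs -sumw ler_sum.
have szge : #|U|%:R - (size s)%:R <= #|G|%:R :> R.
  rewrite szs -sumw -sumrB -[X in _ <= X](_ : \sum_(g : G) 1 = _).
    by apply: ler_sum => g _; rewrite lerBlDl.
  by rewrite sumr_const.
(* Indices beyond the list fall on the default g0, which thus receives all points left over by
   rounding down; there are at most #|G| of them. *)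
exists (fun u => nth g0 s (enum_rank u)) => F M FM.
have sumU : \sum_(u : U) F (nth g0 s (enum_rank u)) =
    \sum_g (k g)%:R * F g + (#|U|%:R - (size s)%:R) * F g0.
  have -> : \sum_(u : U) F (nth g0 s (enum_rank u)) = \sum_(i < #|U|) F (nth g0 s i).
    by rewrite [RHS](reindex (@enum_rank U))//; apply: onW_bij; exact: enum_rank_bij.
  rewrite -(sums F).
  rewrite -(big_mkord xpredT (fun i => F (nth g0 s i))).
  rewrite (@big_cat_nat _ _ _ (size s))//=; congr (_ + _).
    by rewrite [RHS](big_nth g0).
  rewrite big_nat_cond (eq_bigr (fun=> F g0)); last first.
    by move=> i /andP[/andP[h _] _]; rewrite nth_default.
  rewrite -big_nat_cond sumr_const_nat -natrB// mulr_natl.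
  done.
have M0 g : 0 <= F g by case/andP: (FM g).
have FM' g : F g <= M by case/andP: (FM g).
rewrite /avg sumU.
have -> : \sum_g w g * F g = #|U|%:R^-1 * \sum_g (#|U|%:R * w g) * F g.
  by rewrite mulr_sumr; apply: eq_bigr => g _; field; rewrite gt_eqF.
rewrite -mulrBr normrM ger0_norm ?invr_ge0// [_ / _]mulrC -mulrA ler_pM2l ?invr_gt0//.
have e : \sum_g (#|U|%:R * w g) * F g - \sum_g (k g)%:R * F g =
  \sum_g (#|U|%:R * w g - (k g)%:R) * F g.
  by rewrite -sumrB; apply: eq_bigr => g _; rewrite mulrBl.
have e0 : 0 <= \sum_g (#|U|%:R * w g - (k g)%:R) * F g.
  by apply: sumr_ge0 => g _; rewrite mulr_ge0// subr_ge0.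
have e1 : \sum_g (#|U|%:R * w g - (k g)%:R) * F g <= #|G|%:R * M.
  rewrite [X in _ <= X]mulr_natl -[X in _ <= X]sumr_const; apply: ler_sum => g _.
  rewrite -[X in _ <= X]mul1r; apply: ler_pM => //; first by rewrite subr_ge0.
  by rewrite lerBlDl.
have r0 : 0 <= (#|U|%:R - (size s)%:R) * F g0.
  by rewrite mulr_ge0// subr_ge0 ler_nat.
have r1 : (#|U|%:R - (size s)%:R) * F g0 <= #|G|%:R * M.
  by apply: ler_pM => //; rewrite subr_ge0 ler_nat.
by rewrite ler_norml; lra.
Qed.

Section GramSchmidt.
Variables (R : realType) (V : lmodType R) (X : set V) (B : V -> V -> R).
Hypothesis X0 : X 0.
Hypothesis Xlin : forall a f g, X f -> X g -> X (a *: f + g).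
Hypothesis Bsym : forall f g, X f -> X g -> B f g = B g f.
Hypothesis Blin : forall a f g h, X f -> X g -> X h ->
  B (a *: f + g) h = a * B f h + B g h.
Hypothesis Bpos : forall f, X f -> f != 0 -> 0 < B f f.

Let B0 h : X h -> B 0 h = 0.
Proof.
move=> Xh; have := Blin 1 X0 X0 Xh.
by rewrite scale1r addr0 mul1r => /eqP; rewrite -subr_eq0 opprD addrA subrr sub0r oppr_eq0 => /eqP.
Qed.

Lemma lincomb_closed k (e : 'I_k -> V) (c : 'I_k -> R) :
  (forall i, X (e i)) -> X (\sum_i c i *: e i).
Proof.
move=> Xe; elim: (index_enum _) => [|i s IH]; first by rewrite big_nil.
by rewrite big_cons; exact: Xlin.
Qed.

Lemma bilinear_lincomb k (e : 'I_k -> V) (c : 'I_k -> R) h :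
  (forall i, X (e i)) -> X h -> B (\sum_i c i *: e i) h = \sum_i c i * B (e i) h.
Proof.
move=> Xe Xh.
suff [] : X (\sum_i c i *: e i) /\ B (\sum_i c i *: e i) h = \sum_i c i * B (e i) h by [].
elim: (index_enum _) => [|i s [Xs Bs]].
  by rewrite !big_nil; split => //; exact: B0.
by rewrite !big_cons; split; [exact: Xlin|rewrite Blin// Bs].
Qed.

Lemma gram_schmidt k (b : 'I_k -> V) : (forall i, X (b i)) ->
  exists k' (e : 'I_k' -> V), [/\ (k' <= k)%N, forall i, X (e i),
    forall i j, B (e i) (e j) = (i == j)%:R &
    forall i, exists c : 'I_k' -> R, b i = \sum_j c j *: e j].
Proof.
elim: k b => [|k IH] b Xb.
  by exists 0%N, (fun=> 0); split => // -[].
have [k' [e [k'k Xe eON eb]]] := IH (fun i => b (lift ord_max i)) (fun i => Xb _).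
pose x := b ord_max.
pose y := \sum_j B x (e j) *: e j.
have Xy : X y by exact: lincomb_closed.
have Xx : X x by exact: Xb.
pose r := (-1) *: y + x.
have Xr : X r by exact: Xlin.
have re j : B r (e j) = 0.
  rewrite /r Blin// /y bilinear_lincomb// (bigD1 j)//= big1 => [|i ij].
    by rewrite eON eqxx mulr1 addr0; ring.
  by rewrite eON (negbTE ij) mulr0.
(* A vector in the span of the others is dropped, so linear independence of b is never called for;
   this is why k' may be smaller than k. *)
have [r0|r0] := eqVneq r 0.
  have xy : x = y by apply/eqP; rewrite -subr_eq0 addrC -scaleN1r -/r r0.
  exists k', e; split => //; first exact: leqW.
  move=> i; case: (unliftP ord_max i) => [j|] ->; first exact: eb.
  by exists (fun j => B x (e j)).
have rr := Bpos Xr r0.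
pose u := (Num.sqrt (B r r))^-1 *: r.
have Xu : X u by rewrite /u -[_ *: _]addr0; exact: Xlin.
have Bu h : X h -> B u h = (Num.sqrt (B r r))^-1 * B r h.
  by move=> Xh; rewrite /u -[_ *: _]addr0 Blin// B0// addr0.
have uu : B u u = 1.
  rewrite Bu// Bsym// Bu// mulrA -invfM -expr2 sqr_sqrtr ?ltW//.
  by rewrite mulVf// gt_eqF.
have ue j : B u (e j) = 0 by rewrite Bu// re mulr0.
pose ext T (f : 'I_k' -> T) (z : T) (i : 'I_k'.+1) :=
  if unlift ord_max i is Some j then f j else z.
have extl T (f : 'I_k' -> T) z j : ext T f z (lift ord_max j) = f j.
  by rewrite /ext liftK.
have extm T (f : 'I_k' -> T) z : ext T f z ord_max = z by rewrite /ext unlift_none.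
have sum_ext c z : \sum_i ext _ c z i *: ext _ e u i = \sum_j c j *: e j + z *: u.
  rewrite big_ord_recr/= !extm; congr (_ + _); apply: eq_bigr => j _.
  have -> : widen_ord (leqnSn k') j = lift ord_max j.
    by apply: val_inj; rewrite /= /bump leqNgt ltn_ord.
  by rewrite !extl.
exists k'.+1, (ext _ e u); split => //.
- by move=> i; case: (unliftP ord_max i) => [j|] ->; rewrite ?extl ?extm.
- move=> i j.
  case: (unliftP ord_max i) => [i'|] ->; case: (unliftP ord_max j) => [j'|] ->;
    rewrite ?extl ?extm ?eqxx//.
  + by rewrite eON (inj_eq lift_inj).
  + by rewrite Bsym// ue eq_sym (negbTE (neq_lift _ _)).
  + by rewrite ue (negbTE (neq_lift _ _)).
- move=> i; case: (unliftP ord_max i) => [j|] ->.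
    by have [c ->] := eb j; exists (ext _ c 0); rewrite sum_ext scale0r addr0.
  exists (ext _ (fun j => B x (e j)) (Num.sqrt (B r r))).
  rewrite sum_ext /u scalerA divff ?gt_eqF ?sqrtr_gt0// scale1r /r.
  by rewrite -/y -/x scaleN1r addrA subrr add0r.
Qed.

End GramSchmidt.

Lemma dot_coord_le (R : realType) (n : nat) (c : 'rV[R]_n) (D : R) i :
  1 <= D -> dot c c <= D -> `|c 0 i| <= D.
Proof.
move=> D1 cD; apply: ler_norm_of_sqr; first by lra.
apply: (@le_trans _ _ D); last by nra.
apply: le_trans cD; rewrite /dot (bigD1 i)//= expr2 lerDl.
by apply: sumr_ge0 => j _; rewrite -expr2 sqr_ge0.
Qed.

Section Quantize.
Variables (R : realType) (dsp : measure_display) (S : measurableType dsp).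
Variables (P : probability S R) (A : set S) (k : nat) (v : S -> 'rV[R]_k) (D : R).
Hypothesis mA : measurable A.
Hypothesis PA : P A = 1%E.
Hypothesis mv : forall i, measurable_fun [set: S] (fun x => v x 0 i).
Hypothesis vA : forall x, ~ A x -> v x = 0.
Hypothesis D_ge1 : 1 <= D.
Hypothesis vD : forall x, dot (v x) (v x) <= D.
Hypothesis v_iso : forall c, mean P (fun x => dot c (v x) ^+ 2) = dot c c.

Let bmeas_dot c : bmeas (fun x => dot c (v x)).
Proof.
apply: bmeas_sum => i; apply: bmeasZ; split; first exact: mv.
by exists D => x; exact: dot_coord_le.
Qed.

(** A lower bound for unit c, from f^2 <= D |f|^q. It turns absolute errors into relative ones. *)
Let mean_powR_ge (q : R) c : 1 < q <= 2 -> dot c c = 1 ->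
  D^-1 <= mean P (fun x => `|dot c (v x)| `^ q).
Proof.
move=> /andP[q1 q2] c1.
have D0 : 0 < D by apply: lt_le_trans D_ge1.
have bq : bmeas (fun x => `|dot c (v x)| `^ q).
  by apply: bmeas_powR => //; rewrite ltW// (lt_trans _ q1).
rewrite -[D^-1]mulr1 ler_pdivrMl// -meanZ// -{1}c1 -v_iso.
have b2 : bmeas (fun x => dot c (v x) ^+ 2).
  by apply: (bmeasM (bmeas_dot c) (bmeas_dot c)).
apply: ler_mean => //; first exact: bmeasZ.
move=> x; rewrite -real_normK ?num_real//.
have xD : 0 <= `|dot c (v x)| <= D.
  rewrite normr_ge0/=; apply: ler_norm_of_sqr; first exact: ltW.
  apply: (le_trans (dot_CS _ _)); rewrite c1 mul1r; apply: (le_trans (vD x)).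
  by rewrite expr2 ler_peMr// ltW.
apply: (le_trans (sq_le_powR q2 xD)); rewrite ler_wpM2r ?powR_ge0//.
by apply: ler1_powR => //; lra.
Qed.

(** The range of v is cut into cells of side eta; each cell gets the mass of its part of A, and a
    point of A if there is one. A function that varies by at most e over a cell is integrated up to
    e. *)
Lemma finite_quantization (eta : R) : 0 < eta ->
  exists (G : finType) (pt : G -> S) (w : G -> R),
  [/\ forall g, A (pt g), forall g, 0 <= w g, \sum_g w g = 1 &
    forall (F : S -> R) (e : R), bmeas F -> (forall x, ~ A x -> F x = 0) ->
      (forall x x', A x -> A x' ->
         (forall i, `|v x 0 i - v x' 0 i| <= eta) -> `|F x - F x'| <= e) ->
      0 <= e -> `|\sum_g w g * F (pt g) - mean P F| <= e].
Proof.
move=> eta0.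
have [a0 Aa0] : A !=set0.
  apply/set0P; apply/eqP => A0; move: PA; rewrite A0 measure0 => /eqP.
  by rewrite eq_sym onee_eq0.
pose y i x : R := (v x 0 i + D) / eta.
have vbd x i : - D <= v x 0 i <= D by rewrite -ler_norml; exact: dot_coord_le.
have y0 i x : 0 <= y i x by rewrite divr_ge0 ?(ltW eta0)//; have := vbd x i; lra.
have [H yH] : exists H : nat, forall i x, (Num.trunc (y i x) < H.+1)%N.
  exists (Num.trunc (2 * D / eta)) => i x; rewrite truncn_lt_nat//.
  apply: le_lt_trans (truncnS_gt (2 * D / eta)).
  by rewrite ler_pM2r ?invr_gt0//; have := vbd x i; lra.
pose G : finType := {ffun 'I_k -> 'I_H.+1}.
pose qz x : G := [ffun i => inord (Num.trunc (y i x))].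
pose ind g x : R := (qz x == g)%:R * (x \in A)%:R.
have close x x' : qz x = qz x' -> forall i, `|v x 0 i - v x' 0 i| <= eta.
  move=> qq i; have /ffunP/(_ i) := qq; rewrite !ffunE => /(congr1 val)/=.
  rewrite !inordK// => e.
  have h1 := truncn_itv (y0 i x); have h2 := truncn_itv (y0 i x').
  rewrite -e in h2.
  have -> : v x 0 i - v x' 0 i = eta * (y i x - y i x').
    by rewrite /y; field; rewrite gt_eqF.
  rewrite normrM (gtr0_norm eta0) ler_piMr ?(ltW eta0)//.
  by rewrite ler_norml; move: h1 h2; rewrite -natr1; lra.
have mq g : measurable_fun [set: S] (fun x => qz x == g).
  rewrite (_ : (fun x => _) = fun x => \big[andb/true]_(i < k)
     (((g i)%:R <= y i x) && (y i x < (g i).+1%:R))); last first.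
    apply/funext => x; rewrite big_andE; apply/eqP/forallP => [<- i|h].
      by rewrite ffunE inordK//; exact: truncn_itv.
    apply/ffunP => i; rewrite ffunE; apply: val_inj; rewrite /= inordK//.
    by apply/eqP; rewrite truncn_eq//; exact: h.
  elim: (index_enum _) => [|i s IH].
    by under eq_fun do rewrite big_nil; exact: measurable_cst.
  under eq_fun do rewrite big_cons.
  have my : measurable_fun [set: S] (y i).
    apply: measurable_funM; last exact: measurable_cst.
    by apply: measurable_funD; [exact: mv|exact: measurable_cst].
  apply: measurable_and => //; apply: measurable_and.
    by apply: measurable_fun_ler => //; exact: measurable_cst.
  by apply: measurable_fun_ltr => //; exact: measurable_cst.
have bA : bmeas (fun x => (x \in A)%:R : R).
  apply: bmeas_bool; apply: (measurable_fun_bool true).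
  by rewrite setTI preimage_mem_true.
have bind g : bmeas (ind g) by apply: bmeasM => //; exact: bmeas_bool.
pose w g := mean P (ind g).
have ind0 g x : 0 <= ind g x by rewrite mulr_ge0.
(* A cell that misses A has weight 0; its point is an arbitrary one of A. *)
pose pt g := if pselect (exists x, A x /\ qz x = g) is left h then projT1 (cid h) else a0.
have Apt g : A (pt g).
  by rewrite /pt; case: pselect => // h; case: cid => x [].
have qpt x : A x -> qz (pt (qz x)) = qz x.
  rewrite /pt => Ax; case: pselect => [h|[]]; last by exists x.
  by case: cid => z [].
have sum_ind (F : S -> R) x : \sum_g F (pt g) * ind g x = F (pt (qz x)) * (x \in A)%:R.
  rewrite (bigD1 (qz x))//= /ind eqxx mul1r big1 ?addr0// => g gx.
  by rewrite eq_sym (negbTE gx) mul0r mulr0.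
exists G, pt, w; split => //.
- by move=> g; exact: mean_ge0.
- rewrite /w -mean_sum//.
  rewrite (eq_mean P (g := fun x => (x \in A)%:R)); last first.
    by move=> x; have := sum_ind (fun=> 1) x; rewrite mul1r => <-; apply: eq_bigr => g _; rewrite mul1r.
  rewrite /mean /Rintegral.
  rewrite (eq_integral (EFin \o \1_A)); last by move=> x _; rewrite /= indicE.
  by rewrite integral_indic// setIT -[1]/(fine 1%E); congr fine; exact: PA.
- move=> F e bF FA Fe e0.
  have -> : \sum_g w g * F (pt g) = mean P (fun x => \sum_g F (pt g) * ind g x).
    rewrite mean_sum; first by apply: eq_bigr => g _; rewrite meanZ// mulrC.
    by move=> g; exact: bmeasZ.
  apply: mean_close => //; first by apply: bmeas_sum => g; exact: bmeasZ.
  move=> x; rewrite sum_ind; have [Ax|nAx] := pselect (A x).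
    rewrite mem_set// mulr1; apply: Fe => //.
    by apply: close; exact: qpt.
  by rewrite memNset// mulr0 FA// subrr normr0.
Qed.

(** The same points serve all c and all q, since N0 depends on neither: homogeneity reduces to unit
    c, where functions are uniformly bounded and Lipschitz in v. *)
Lemma discretize_measure (eps : R) : 0 < eps -> exists N0 : nat,
  forall U : finType, (N0 <= #|U|)%N -> exists x : U -> S, (forall u, A (x u)) /\
    forall (q : R) c, 1 < q <= 2 ->
    `|avg (fun u => `|dot c (v (x u))| `^ q) - mean P (fun y => `|dot c (v y)| `^ q)|
      <= eps * mean P (fun y => `|dot c (v y)| `^ q).
Proof.
move=> eps0.
have D1 := D_ge1.
have D0 : 0 < D by lra.
(* Makes the oscillation 2 D k eta over a cell at most eps / (2 D). Rounding the weights costs as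
   much, and eps / D is at most eps times the mean. *)
pose eta := eps / (4 * D ^+ 2 * (k%:R + 1)).
have k0 : 0 < k%:R + 1 :> R by rewrite ltr_wpDl.
have eta0 : 0 < eta by rewrite divr_gt0// !mulr_gt0// exprn_gt0.
have [G [pt [w [Apt w0 w1 hw]]]] := finite_quantization eta0.
have [N0 hN0] : exists N0 : nat, #|G|%:R * (2 * D ^+ 3) / eps < N0%:R.
  by exists (Num.trunc (#|G|%:R * (2 * D ^+ 3) / eps)).+1; exact: truncnS_gt.
have x0 : 0 <= #|G|%:R * (2 * D ^+ 3) / eps.
  by rewrite divr_ge0 ?(ltW eps0)// mulr_ge0// mulr_ge0// exprn_ge0// ltW.
exists N0 => U hU.
have NU : (N0%:R : R) <= #|U|%:R by rewrite ler_nat.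
have U0 : 0 < #|U|%:R :> R by lra.
have U0' : (0 < #|U|)%N by rewrite -(ltr_nat R).
have [a ha] := weights_rounding U0' w0 w1.
exists (fun u => pt (a u)); split => // q c hq.
case/andP: (hq) => q1 q2.
have q0 : 0 <= q by lra.
have main c' : dot c' c' = 1 ->
    `|avg (fun u => `|dot c' (v (pt (a u)))| `^ q) - mean P (fun y => `|dot c' (v y)| `^ q)|
      <= eps * mean P (fun y => `|dot c' (v y)| `^ q).
  move=> c1; pose F y := `|dot c' (v y)| `^ q.
  have bF : bmeas F by exact: bmeas_powR.
  have FA y : ~ A y -> F y = 0.
    by move=> /vA vy; rewrite /F vy dotC dot0l normr0 powR0// gt_eqF//; lra.
  have dD y : 0 <= `|dot c' (v y)| <= D.
    rewrite normr_ge0/=; apply: ler_norm_of_sqr; first exact: ltW.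
    apply: (le_trans (dot_CS _ _)); rewrite c1 mul1r; apply: (le_trans (vD y)).
    by rewrite expr2 ler_peMr// ltW.
  have FD y : 0 <= F y <= D ^+ 2.
    rewrite powR_ge0/=; apply: (@le_trans _ _ (D `^ q)).
      by case/andP: (dD y) => *; rewrite ge0_ler_powR ?nnegrE// ltW.
    by rewrite -powR_mulrn ?ler_powR// ltW.
  have h1 := ha (fun g => F (pt g)) (D ^+ 2) (fun g => FD (pt g)).
  have Flip y y' : A y -> A y' -> (forall i, `|v y 0 i - v y' 0 i| <= eta) ->
      `|F y - F y'| <= eps / (2 * D).
    move=> _ _ hv; apply: (le_trans (powR_lip hq (dD y) (dD y'))).
    have h2 : `| `|dot c' (v y)| - `|dot c' (v y')| | <= k%:R * eta.
      apply: (le_trans (ler_dist_dist _ _)); rewrite -dotBr.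
      apply: (le_trans (ler_norm_sum _ _ _)).
      rewrite -[k in k%:R]card_ord mulr_natl -sumr_const; apply: ler_sum => i _.
      rewrite normrM -[X in _ <= X]mul1r; apply: ler_pM => //.
        by apply: dot_coord_le => //; rewrite c1.
      by rewrite !mxE; exact: hv.
    have h3 : D `^ (q - 1) <= D by apply: ler1_powR => //; lra.
    apply: (@le_trans _ _ (2 * D * (k%:R * eta))).
      apply: ler_pM => //; first by rewrite mulr_ge0// powR_ge0.
      by rewrite ler_pM2l.
    have -> : 2 * D * (k%:R * eta) = eps / (2 * D) * (k%:R / (k%:R + 1)).
      by rewrite /eta; field; rewrite !gt_eqF.
    rewrite ler_piMr ?divr_ge0 ?(ltW eps0)//; first by rewrite mulr_ge0// ltW.
    by rewrite ler_pdivrMr// mul1r lerDl.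
  have e0 : 0 <= eps / (2 * D) by rewrite divr_ge0 ?mulr_ge0 ?(ltW eps0) ?(ltW D0).
  have h2 := hw F _ bF FA Flip e0.
  have h3 : #|G|%:R / #|U|%:R * D ^+ 2 <= eps / (2 * D).
    have : #|G|%:R * (2 * D ^+ 3) / eps <= #|U|%:R.
      by apply: ltW; apply: lt_le_trans NU.
    move=> h.
    have -> : #|G|%:R / #|U|%:R * D ^+ 2 =
        eps / (2 * D) * (#|G|%:R * (2 * D ^+ 3) / eps) / #|U|%:R.
      by field; rewrite !gt_eqF.
    by rewrite ler_pdivrMr// ler_wpM2l.
  have h4 := mean_powR_ge hq c1.
  have h5 : eps / D <= eps * mean P F by rewrite ler_pM2l.
  have e2 : eps / D = eps / (2 * D) + eps / (2 * D) by field; rewrite gt_eqF.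
  apply: le_trans h5; rewrite e2.
  rewrite [_ - _](_ : _ = (avg (fun u => F (pt (a u))) - \sum_g w g * F (pt g)) +
    (\sum_g w g * F (pt g) - mean P F)); last by rewrite /F; ring.
  apply: (le_trans (ler_normD _ _)); apply: lerD => //.
  exact: le_trans h3.
have [c0|c0] := eqVneq (dot c c) 0.
  have z y : `|dot c y| `^ q = 0.
    by rewrite (dot_eq0 c0) dot0l normr0 powR0// gt_eqF//; lra.
  rewrite (eq_mean P (g := fun=> 0)) ?mean_cst ?mulr0; last by move=> y; exact: z.
  by rewrite /avg big1 ?mulr0 ?subrr ?normr0// => u _; exact: z.
have cp : 0 < dot c c by rewrite lt_neqAle eq_sym c0 dot_ge0.
pose r := Num.sqrt (dot c c).
have r0 : 0 < r by rewrite sqrtr_gt0.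
have rr : r ^+ 2 = dot c c by rewrite sqr_sqrtr// ltW.
pose c' := r^-1 *: c.
have c1 : dot c' c' = 1.
  by rewrite /c' dotZl dotZr mulrA -invfM -expr2 rr mulVf.
have ec y : `|dot c y| `^ q = r `^ q * `|dot c' y| `^ q.
  rewrite -powRM ?(ltW r0)//; congr (_ `^ _).
  by rewrite /c' dotZl normrM gtr0_norm ?invr_gt0// mulVKf// gt_eqF.
have rq : 0 <= r `^ q by exact: powR_ge0.
have bc : bmeas (fun y => `|dot c' (v y)| `^ q) by exact: bmeas_powR.
rewrite (eq_mean P (g := fun y => r `^ q * `|dot c' (v y)| `^ q)); last by move=> y; exact: ec.
rewrite meanZ//.
have -> : avg (fun u => `|dot c (v (pt (a u)))| `^ q) =
    r `^ q * avg (fun u => `|dot c' (v (pt (a u)))| `^ q).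
  by rewrite -avgZ /avg; congr (_ * _); apply: eq_bigr => u _; exact: ec.
by rewrite -mulrBr normrM ger0_norm// mulrCA ler_wpM2l//; exact: main.
Qed.

End Quantize.

(** * The sampling theorem *)

(** Makes [ln (ln 3)] positive. The sixth power of exp(1/6) <= 6/5 is below 2.99. *)
Lemma ln3_gt1 (R : realType) : 1 < ln 3 :> R.
Proof.
have h : expR (6^-1) <= 6 / 5 :> R.
  have := expR_ge1Dx (- 6^-1 : R); rewrite expRN => h.
  have h' : (6 / 5)^-1 <= (expR 6^-1)^-1 :> R.
    by apply: le_trans h; rewrite invf_div; lra.
  by rewrite lef_pV2 ?posrE ?expR_gt0 ?divr_gt0 in h'.
rewrite -ltr_expR lnK ?posrE//.
have -> : expR 1 = expR (6^-1) ^+ 6 :> R.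
  by rewrite -expRM_natl divff.
apply: (@le_lt_trans _ _ ((6 / 5) ^+ 6)); last by lra.
by rewrite lerXn2r// nnegrE ?expR_ge0// divr_ge0.
Qed.

Lemma logge3_ge (R : realType) (t : R) : ln 3 <= logge3 t.
Proof. by rewrite /logge3 ler_ln ?posrE// ?lt_max ?le_max ?lexx ?orbT ?ltr0n ?orbT. Qed.

Lemma ln_le_logge3 (R : realType) (t : R) : 0 < t -> ln t <= logge3 t.
Proof. by move=> t0; rewrite /logge3 ler_ln ?posrE// ?lt_max ?le_max ?lexx ?t0. Qed.

Lemma sample_size (R : realType) (C : R) : 0 < C -> exists C3 : R, 1 <= C3 /\
  forall D eps : R, 1 <= D -> 0 < eps < 1 ->
  let M := C3 * eps ^- 2 * D * (logge3 D + ln eps^-1) in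
  D <= M /\ forall m : nat, M <= m%:R <= 2 * M ->
    C * halving_error D m <= eps / 4.
Proof.
move=> C0; pose t := 1 + 176 * C ^+ 2.
have C2 : 0 < C ^+ 2 by rewrite exprn_gt0.
have t1 : 1 <= t by rewrite /t; lra.
(* The constant C3 also enters log m, but only as ln C3 = 2 ln t, linear in t at worst, while the
   number of points gains t^2. The inequality needed is 11 * 16 C^2 <= t. *)
exists (t ^+ 2); split; first by nra.
move=> D eps D1 /andP[e0 e1] M.
have D0 : 0 < D by lra.
have l3 := ln3_gt1 R.
have L3 := logge3_ge D; have LD := ln_le_logge3 D0.
have ie : 1 <= eps^-1 by rewrite invf_ge1// ltW.
have le0 : 0 <= ln eps^-1 by exact: ln_ge0.
set l := logge3 D + ln eps^-1 in M *.
have l1 : 1 <= l by rewrite /l; lra.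
have E : eps ^- 2 = eps^-1 ^+ 2 by rewrite exprVn.
have Me : M = t ^+ 2 * eps^-1 ^+ 2 * D * l by rewrite /M E.
have t2 : 1 <= t ^+ 2 by nra.
have ie2 : 1 <= eps^-1 ^+ 2 by nra.
have te : 1 <= t ^+ 2 * eps^-1 ^+ 2 by nra.
have DM : D <= M.
  have h : D <= t ^+ 2 * eps^-1 ^+ 2 * D by rewrite ler_peMl// ltW.
  by rewrite Me; apply: (le_trans h); rewrite ler_peMr//; lra.
split=> // m /andP[Mm m2M].
have m1 : 1 <= m%:R :> R by lra.
have m0 : (0 < m)%N by rewrite -(ler1n R).
have mp : 0 < m%:R :> R by lra.
have hL : logN R m <= 11 * t * l.
  have h1 : logN R m <= ln (12 * M).
    by rewrite /logN ler_ln ?posrE; lra.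
  have h2 : ln (12 * M) = ln 12 + (ln t *+ 2 + ln eps^-1 *+ 2 + ln D + ln l).
    have tp : 0 < t by apply: lt_le_trans t1.
    have lp : 0 < l by apply: lt_le_trans l1.
    by rewrite Me !lnM ?lnXn ?posrE ?mulr_gt0 ?exprn_gt0 ?invr_gt0.
  have h3 : ln t <= t - 1.
    have := @le_ln1Dx R (t - 1); rewrite (addrC 1) subrK; apply; lra.
  have h4 : ln l <= l.
    by apply: ltW; apply: ln_sublinear; lra.
  have h5 : ln 12 <= 6 :> R.
    have e2 : 2 <= expR 1 :> R by have := expR_ge1Dx (1 : R); lra.
    rewrite -ler_expR lnK ?posrE//.
    have -> : expR 6 = expR 1 ^+ 6 :> R by rewrite -expRM_natl mulr1.
    apply: (@le_trans _ _ (2 ^+ 6)); first by lra.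
    by rewrite lerXn2r// nnegrE// expR_ge0.
  have h6 : ln D + ln eps^-1 <= l by rewrite /l; lra.
  have h7 : ln eps^-1 <= l by rewrite /l; lra.
  have h8 : ln 12 + (ln t *+ 2 + ln eps^-1 *+ 2 + ln D + ln l) <= 6 + 2 * (t - 1) + 3 * l.
    rewrite !mulr2n; lra.
  apply: (le_trans h1); rewrite h2; apply: (le_trans h8).
  nra.
have h : D * logN R m / m%:R <= (eps / (4 * C)) ^+ 2.
  rewrite ler_pdivrMr//.
  apply: (@le_trans _ _ (D * (11 * t * l))); first by rewrite ler_pM2l.
  apply: (@le_trans _ _ ((eps / (4 * C)) ^+ 2 * M)); last first.
    by rewrite ler_wpM2l// sqr_ge0.
  have -> : (eps / (4 * C)) ^+ 2 * M = t ^+ 2 / (16 * C ^+ 2) * (D * l).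
    by rewrite Me; field; rewrite !gt_eqF.
  have -> : D * (11 * t * l) = 11 * t * (D * l) by ring.
  rewrite ler_wpM2r ?mulr_ge0//; [by lra|by lra|].
  rewrite ler_pdivlMr ?mulr_gt0//.
  have -> : 11 * t * (16 * C ^+ 2) = t * (176 * C ^+ 2) by ring.
  by rewrite expr2 ler_pM2l /t; lra.
rewrite /halving_error.
have q0 : 0 <= eps / (4 * C) by rewrite divr_ge0 ?mulr_ge0//; lra.
have h9 : Num.sqrt (D * logN R m / m%:R) <= eps / (4 * C).
  by rewrite -[X in _ <= X]ger0_norm// -sqrtr_sqr ler_wsqrtr.
apply: (le_trans (ler_wpM2l (ltW C0) h9)).
by rewrite le_eqVlt; apply/orP; left; apply/eqP; field; rewrite gt_eqF.
Qed.

Lemma points_bound_ge (R : realType) (C K : R) (n : nat) (eps : R) :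
  0 <= C -> 1 <= K * n%:R -> 0 < eps < 1 ->
  C * eps ^- 2 * (K * n%:R) * (logge3 (K * n%:R) + ln eps^-1) <=
  points_bound (C / ln (ln 3) ^+ 2) K n eps.
Proof.
move=> C0 D1 /andP[e0 e1]; rewrite /points_bound; set D := K * n%:R in D1 *.
have l3 : 0 < ln (ln 3) :> R by rewrite ln_gt0// ln3_gt1.
have ie0 : 0 <= ln eps^-1 by rewrite ln_ge0// invf_ge1// ltW.
have L3 : ln 3 <= logge3 D by exact: logge3_ge.
have p3 : 0 < ln 3 :> R by apply: lt_trans (ln3_gt1 R).
have pL : 0 < logge3 D by apply: lt_le_trans L3.
have LL : ln (ln 3) <= ln eps^-1 + ln (logge3 D).
  by rewrite -[X in X <= _]add0r lerD// ler_ln.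
have LL2 : ln (ln 3) ^+ 2 <= (ln eps^-1 + ln (logge3 D)) ^+ 2.
  by rewrite lerXn2r// nnegrE ?(ltW l3)//; apply: le_trans LL; exact: ltW.
set l := logge3 D + ln eps^-1.
have l0 : 0 <= l by rewrite addr_ge0// ltW.
have W0 : 0 <= C / ln (ln 3) ^+ 2 * eps ^- 2 * D * l.
  have i2 : 0 <= eps ^- 2 by rewrite invr_ge0 exprn_ge0// ltW.
  have c2 : 0 <= C / ln (ln 3) ^+ 2 by rewrite divr_ge0// exprn_ge0// ltW.
  have D0 : 0 <= D by apply: le_trans D1.
  exact: mulr_ge0 (mulr_ge0 (mulr_ge0 c2 i2) D0) l0.
apply: le_trans (ler_wpM2l W0 LL2).
rewrite le_eqVlt; apply/orP; left; apply/eqP.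
by field; rewrite (gt_eqF e0) (gt_eqF l3).
Qed.

Lemma relative_error_half (R : realType) (e q s : R) : 0 <= e -> 0 <= q ->
  `|s - q| <= e / 2 * q -> (1 - e) * q <= s /\ s <= (1 + e) * q.
Proof. by move=> e0 q0; have := mulr_ge0 e0 q0; rewrite ler_norml; lra. Qed.

Section ContOn.
Variables (R : realType) (d : nat) (Omega : set 'rV[R]_d).
Variable mu : probability (borel_rV R d) R.
Hypothesis cO : compact Omega.

Lemma compact_borel : measurable (Omega : set (borel_rV R d)).
Proof.
rewrite -(setCK Omega); apply: measurableC; apply: sub_sigma_algebra.
rewrite /= openC; apply: compact_closed => //; exact: norm_hausdorff.
Qed.

(** Extension by zero may be discontinuous on the boundary, so the sets f >= r are described
    directly: closed in Omega if r > 0, with the complement of Omega added if r <= 0. *)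
Lemma contOn_measurable f : contOn Omega f ->
  measurable_fun [set: borel_rV R d] f.
Proof.
move=> [cf f0]; apply: (measurability (@RGenCInfty.G R)).
  exact: RGenCInfty.measurableE.
move=> _ [_ [r ->] <-]; rewrite setTI.
have closedm (C : set 'rV[R]_d) : closed C -> measurable (C : set (borel_rV R d)).
  move=> cC; rewrite -(setCK C); apply: measurableC; apply: sub_sigma_algebra.
  by rewrite /= openC.
have clf : closed (f @^-1` `[r, +oo[%classic : set (subspace Omega)).
  move/continuous_closedP: cf; apply.
  by rewrite set_itvcy; exact: closed_ge.
have [W cW WE] := (closed_subspaceP _ _).1 clf.
have mW : measurable (W `&` Omega : set (borel_rV R d)).
  by apply: measurableI; [exact: closedm|exact: compact_borel].
have [r0|r0] := ltP 0 r.
  rewrite (_ : _ @^-1` _ = W `&` Omega)//.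
  rewrite WE; apply/seteqP; split => x /=; last by case.
  rewrite in_itv/= andbT => rx; split => //.
  by apply: contrapT => nO; move: rx; rewrite f0// leNgt r0.
rewrite (_ : _ @^-1` _ = (W `&` Omega) `|` ~` Omega).
  by apply: measurableU => //; apply: measurableC; exact: compact_borel.
rewrite WE; apply/seteqP; split => x /=.
  by move=> h; have [Ox|Ox] := pselect (Omega x); [left|right].
by move=> [[]//|nO]; rewrite f0// in_itv/= r0.
Qed.

Lemma contOn_has_sup f : contOn Omega f -> has_ubound [set `|f x| | x in Omega].
Proof.
move=> [cf f0].
have := continuous_compact cf cO => /compact_bounded[M [_ hM]].
exists (M + 1) => _ [x Ox <-].
by apply: (hM (M + 1)); [rewrite ltrDl|exists x].
Qed.

Lemma le_supnorm f x : contOn Omega f -> Omega x -> `|f x| <= supnorm Omega f.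
Proof.
by move=> cf Ox; apply: (ub_le_sup (contOn_has_sup cf)); exists x.
Qed.

Lemma contOn_bmeas f : contOn Omega f -> bmeas (S := borel_rV R d) f.
Proof.
move=> cf; split; first exact: contOn_measurable.
have [M hM] := contOn_has_sup cf.
exists (Num.max M 0) => x; have [Ox|Ox] := pselect (Omega x).
  by rewrite le_max hM//; exists x.
by rewrite cf.2// normr0 le_max lexx orbT.
Qed.

Lemma Lpnorm_mean q f : 0 < q -> bmeas (S := borel_rV R d) f ->
  Lpnorm mu q f = ((mean mu (fun x => `|f x| `^ q)) `^ q^-1)%:E.
Proof.
move=> q0 bf; rewrite /Lpnorm unlock /Lnorm.
have -> : (\int[mu]_x `|(EFin \o f) x| `^ q = (mean mu (fun x => `|f x| `^ q))%:E)%E.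
  rewrite /mean /Rintegral fineK.
    exact: eq_integral.
  apply: integrable_fin_num => //; apply: bmeas_integrable.
  by apply: bmeas_powR => //; exact: ltW.
by rewrite poweR_EFin.
Qed.

Lemma Lpnorm_powR q f : 0 < q -> bmeas (S := borel_rV R d) f ->
  ((Lpnorm mu q f) `^ q)%E = (mean mu (fun x => `|f x| `^ q))%:E.
Proof.
move=> q0 bf; rewrite Lpnorm_mean// poweR_EFin -powRrM mulVf ?gt_eqF// powRr1//.
by apply: mean_ge0 => x; exact: powR_ge0.
Qed.

End ContOn.

Lemma orthonormal_coordinates (R : realType) (d : nat) (Omega : set 'rV[R]_d)
    (n : nat) (K : R) (X : set ('rV[R]_d -> R))
    (mu : probability (borel_rV R d) R) :
  compact Omega -> 1 <= K -> (0 < n)%N -> subspace_of (contOn Omega) X ->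
  dim_le X n -> nikolskii Omega mu X n K ->
  exists (k : nat) (v : 'rV[R]_d -> 'rV[R]_k),
    [/\ (k <= n)%N, forall i, contOn Omega (fun x => v x 0 i),
        forall f, X f -> exists c, forall x, f x = dot c (v x),
        forall c, mean mu (fun x => dot c (v x) ^+ 2) = dot c c &
        forall x, dot (v x) (v x) <= K * n%:R].
Proof.
move=> cO K1 n0 [XC X0 Xlin] [k0 [b [k0n [Xb _ bspan]]]] hN.
have D0 : 0 <= K * n%:R by rewrite mulr_ge0//; lra.
pose B (f g : 'rV[R]_d -> R) := mean mu (fun x => f x * g x).
have bX f : X f -> bmeas (S := borel_rV R d) f.
  by move=> Xf; exact: (contOn_bmeas cO (XC _ Xf)).
have sup_le f x : X f -> Omega x -> f x ^+ 2 <= K * n%:R * B f f.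
  move=> Xf Ox; have h1 := le_supnorm cO (XC _ Xf) Ox.
  have := hN f Xf; rewrite Lpnorm_mean//; last exact: bX.
  rewrite -EFinM lee_fin powR12_sqrt; last by apply: mean_ge0 => *; exact: powR_ge0.
  rewrite -sqrtrM// => h2; have h3 := le_trans h1 h2.
  have e : mean mu (fun x => `|f x| `^ 2) = B f f.
    by apply: eq_mean => y; rewrite powR_mulrn// real_normK ?num_real// expr2.
  rewrite e in h3.
  have B0 : 0 <= B f f by apply: mean_ge0 => y; rewrite -expr2 sqr_ge0.
  have KB0 : 0 <= K * n%:R * B f f by exact: mulr_ge0.
  rewrite -real_normK ?num_real// -[X in _ <= X](sqr_sqrtr KB0).
  by rewrite lerXn2r// nnegrE ?sqrtr_ge0.
have Bsym f g : X f -> X g -> B f g = B g f.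
  by move=> _ _; apply: eq_mean => x; rewrite mulrC.
have Blin a f g h : X f -> X g -> X h -> B (a *: f + g) h = a * B f h + B g h.
  move=> Xf Xg Xh; rewrite /B -meanZ; last by apply: bmeasM; exact: bX.
  rewrite -meanD; [|by apply: bmeasZ; apply: bmeasM; exact: bX|by apply: bmeasM; exact: bX].
  by apply: eq_mean => x; rewrite mulrA -mulrDl.
(* The Nikol'skii inequality makes the L_2 form definite on X, whatever the support of mu. *)
have Bpos f : X f -> f != 0 -> 0 < B f f.
  move=> Xf f0; rewrite ltNge; apply/negP => Bf; move/eqP: f0; apply.
  apply/funext => x; have [Ox|Ox] := pselect (Omega x); last by rewrite (XC _ Xf).2.
  have h := sup_le f x Xf Ox.
  have : f x ^+ 2 <= 0 by apply: (le_trans h); rewrite mulr_ge0_le0.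
  by rewrite -[f x]/(f x) => h0; apply/eqP; rewrite -sqrf_eq0 eq_le h0 sqr_ge0.
have [k [e [kk0 Xe eON eb]]] := gram_schmidt X0 Xlin Bsym Blin Bpos Xb.
pose v x : 'rV[R]_k := \row_i e i x.
have fcE (c : 'rV[R]_k) x : dot c (v x) = (\sum_i c 0 i *: e i) x.
  by rewrite /dot fct_sumE; apply: eq_bigr => i _; rewrite mxE.
have Xc (c : 'rV[R]_k) : X (\sum_i c 0 i *: e i) by exact: lincomb_closed.
have Bc (c : 'rV[R]_k) : B (\sum_i c 0 i *: e i) (\sum_i c 0 i *: e i) = dot c c.
  rewrite (bilinear_lincomb X0 Xlin Blin)//; apply: eq_bigr => i _; congr (_ * _).
  rewrite Bsym// (bilinear_lincomb X0 Xlin Blin)// (bigD1 i)//= big1 => [|j ji].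
    by rewrite eON eqxx mulr1 addr0.
  by rewrite eON (negbTE ji) mulr0.
have vc c : mean mu (fun x => dot c (v x) ^+ 2) = dot c c.
  by rewrite -Bc; apply: eq_mean => x; rewrite !fcE expr2.
exists k, v; split.
- exact: leq_trans k0n.
- move=> i; rewrite (_ : (fun x => v x 0 i) = e i); first exact: XC.
  by apply/funext => x; rewrite mxE.
- move=> f /bspan[c ->]; pose C i := projT1 (cid (eb i)).
  have CE i : b i = \sum_j C i j *: e j by exact: (projT2 (cid (eb i))).
  exists (\row_j \sum_i c i * C i j) => x.
  rewrite fct_sumE /dot.
  rewrite (eq_bigr (fun i => \sum_j c i * C i j * e j x)); last first.
    move=> i _; rewrite CE /= [LHS](_ : _ = c i * (\sum_j C i j *: e j) x)//.
    by rewrite fct_sumE mulr_sumr; apply: eq_bigr => j _; rewrite mulrA.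
  rewrite exchange_big; apply: eq_bigr => j _.
  by rewrite !mxE -mulr_suml.
- exact: vc.
- move=> x; have [Ox|Ox] := pselect (Omega x); last first.
    rewrite (_ : v x = 0) ?dot0l//; apply/rowP => i; rewrite !mxE.
    exact: (XC _ (Xe i)).2.
  (* The reproducing kernel at x: the combination of the e i with coefficients e i x has value |v
     x|^2 at x and L_2 norm |v x|. The Nikol'skii inequality for it reads |v x|^4 <= K n |v x|^2. *)
  have h := sup_le _ _ (Xc (v x)) Ox.
  rewrite -fcE Bc in h.
  have [z|z] := eqVneq (dot (v x) (v x)) 0; first by rewrite z.
  have zp : 0 < dot (v x) (v x) by rewrite lt_neqAle eq_sym z dot_ge0.
  by rewrite expr2 ler_pM2r in h.
Qed.

Unset Implicit Arguments.

Theorem theorem1p2 (R : realType) (p : R) (hp : 1 < p < 2) :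
  exists C : R, 0 < C /\
    forall (d : nat) (Omega : set 'rV[R]_d) (n : nat) (K : R)
           (X : set ('rV[R]_d -> R)) (mu : probability (borel_rV R d) R),
      compact Omega ->
      mu Omega = 1%E ->
      (0 < n)%N ->
      1 <= K ->
      subspace_of (contOn Omega) X ->
      dim_le X n ->
      nikolskii Omega mu X n K ->
      forall eps : R, 0 < eps < 1 ->
        exists (m : nat) (xi : 'I_m -> 'rV[R]_d),
          [/\ (0 < m)%N,
              forall j, Omega (xi j),
              m%:R <= points_bound C K n eps,
              discretizes mu X p eps xi
            & discretizes mu X 2 eps xi].
Proof.
have /andP[p1 p2] := hp.
have [C [C0 hC]] := halving p1 p2.
have [C3 [C31 hC3]] := sample_size C0.
have ll0 : 0 < ln (ln 3) :> R by rewrite ln_gt0// ln3_gt1.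
(* The 2 leaves room to round M to an integer m, and the denominator converts the factor squared in
   [points_bound]. *)
exists (2 * C3 / ln (ln 3) ^+ 2); split.
  by rewrite divr_gt0 ?exprn_gt0// mulr_gt0//; lra.
move=> d Omega n K X mu cO muO n0 K1 hX hdim hN eps heps.
have /andP[e0 e1] := heps.
pose D := K * n%:R.
have n1 : 1 <= n%:R :> R by rewrite ler1n.
have nD : n%:R <= D by rewrite /D ler_peMl//; lra.
have D1 : 1 <= D by lra.
have [DM hM] := hC3 D eps D1 heps.
set M := C3 * _ * _ * _ in DM hM.
have M1 : 1 <= M by lra.
have [m [m0 Mm m2M]] : exists m : nat, [/\ (0 < m)%N, M <= m%:R & m%:R <= 2 * M].
  exists (Num.trunc M).+1; split => //; first by apply: ltW; exact: truncnS_gt.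
  have : (Num.trunc M)%:R <= M by rewrite truncn_le; lra.
  by rewrite -natr1; lra.
have hH := hM m; rewrite Mm m2M in hH; have {}hH := hH isT.
have [k [v [kn vC vspan viso vD]]] := orthonormal_coordinates cO K1 n0 hX hdim hN.
have mv i : measurable_fun [set: borel_rV R d] (fun x => v x 0 i).
  exact: (contOn_measurable cO (vC i)).
have v0 x : ~ Omega x -> v x = 0.
  by move=> nO; apply/rowP => i; rewrite (vC i).2// mxE.
have e40 : 0 < eps / 4 by lra.
have [N0 hN0] := discretize_measure (S := borel_rV R d) (compact_borel cO) muO
  mv v0 D1 vD viso e40.
(* N0 halvings are always enough, as 2^N0 >= N0. *)
have cdbl : (N0 <= #|dbl m N0|)%N.
  rewrite card_dbl (leq_trans (ltnW (ltn_expl N0 (ltnSn 1))))//.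
  by rewrite leq_pmull.
have [x [Ox hx]] := hN0 (dbl m N0) cdbl.
have km : (k <= m)%N.
  by rewrite -(ler_nat R) (le_trans _ Mm)// (le_trans _ DM)// (le_trans _ nD)// ler_nat.
have q2 : (1 < 2 :> R) && (2 <= 2 :> R) by rewrite ltr1n lexx.
have qp : 1 < p <= 2 by rewrite p1 ltW.
pose Q c := mean mu (fun y => `|dot c (v y)| `^ p).
have Q0 c : 0 <= Q c by apply: mean_ge0 => y; exact: powR_ge0.
have p22 (y : R) : `|y| `^ 2 = y ^+ 2 by rewrite powR_mulrn// real_normK ?num_real.
have Q2 c : mean mu (fun y => `|dot c (v y)| `^ 2) = dot c c.
  by rewrite -viso; apply: eq_mean => y; exact: p22.
have a2 c : `|avg (fun u => dot c (v (x u)) ^+ 2) - dot c c| <= eps / 4 * dot c c.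
  have := hx 2 c q2; rewrite Q2 /avg.
  by under eq_bigr do rewrite p22.
(* Half of the error eps / 2 is spent on the discretization of mu, the other half on the
   halvings. *)
have ab : eps / 4 + C * halving_error D m <= eps / 2 by lra.
have b2 : eps / 2 <= 2^-1 by lra.
have [sel hsel] := hC k m N0 (fun u => v (x u)) D (eps / 4) (eps / 2) Q D1
  m0 km (fun u => vD _) Q0 (ltW e40) ab b2 (fun c => hx p c qp) a2.
exists m, (fun i => x (sel i)); split => //.
- apply: (le_trans m2M); apply: le_trans (points_bound_ge _ D1 heps).
    by rewrite /M !mulrA.
  by rewrite mulr_ge0// (le_trans _ C31).
- move=> f Xf S; have [c fc] := vspan f Xf.
  have bf : bmeas (S := borel_rV R d) f.
    by case: hX => XC _ _; exact: (contOn_bmeas cO (XC _ Xf)).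
  rewrite Lpnorm_powR//; last exact: lt_trans p1.
  have -> : mean mu (fun y => `|f y| `^ p) = Q c.
    by apply: eq_mean => y; rewrite fc.
  have -> : S = avg (fun i => `|dot c (v (x (sel i)))| `^ p).
    by rewrite /S /avg card_ord; congr (_ * _); apply: eq_bigr => i _; rewrite fc.
  rewrite -!EFinM !lee_fin.
  exact: relative_error_half (ltW e0) (Q0 c) (proj1 (hsel c)).
- move=> f Xf S; have [c fc] := vspan f Xf.
  have bf : bmeas (S := borel_rV R d) f.
    by case: hX => XC _ _; exact: (contOn_bmeas cO (XC _ Xf)).
  rewrite Lpnorm_powR//.
  have -> : mean mu (fun y => `|f y| `^ 2) = dot c c.
    by rewrite -Q2; apply: eq_mean => y; rewrite fc.
  have -> : S = avg (fun i => dot c (v (x (sel i))) ^+ 2).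
    by rewrite /S /avg card_ord; congr (_ * _); apply: eq_bigr => i _; rewrite fc p22.
  rewrite -!EFinM !lee_fin.
  exact: relative_error_half (ltW e0) (dot_ge0 c) (proj2 (hsel c)).
Qed.
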